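(* Let $G$ be a closed, connected, self adjoint, noncompact subgroup of $GL(n,\mathbb{R})$, let $d_R$ be the canonical right invariant Riemannian metric on $G$, and let $v\in\mathbb{R}^n$ be a nonzero vector such that the orbit $G(v)$ is unbounded in $\mathbb{R}^n$. Then: 1) The function $g\mapsto d_R(g,G_v)$ is unbounded on $G$. 2) If $v$ is minimal, then $\lambda^-(v)>0$. For arbitrary such nonzero $v$, $-1\le \lambda^-(v)\le\lambda^+(v)\le 1$. 3) $\lambda^-(v)\le \underline{\lim}_{d_R(g,G_v)\to\infty}\frac{\log|g(v)|}{d_R(g,G_v)}\le \overline{\lim}_{d_R(g,G_v)\to\infty}\frac{\log|g(v)|}{d_R(g,G_v)}\le\lambda^+(v)$.
   Context: $M(n,\mathbb{R})$ carries the inner product $\langle A,B\rangle=\mathrm{trace}(AB^t)$, $|A|^2=\langle A,A\rangle$. A subgroup $G\subset GL(n,\mathbb{R})$ is self adjoint if $g^t\in G$ whenever $g\in G$. $\mathfrak{G}=\{X\in M(n,\mathbb{R}):\exp(tX)\in G\ \forall t\}$ is the Lie algebra of $G$; $K=G\cap O(n,\mathbb{R})$, $\mathfrak{K}=\{X\in\mathfrak{G}:X^t=-X\}$, $\mathfrak{P}=\{X\in\mathfrak{G}:X^t=X\}$, so $\mathfrak{G}=\mathfrak{K}\oplus\mathfrak{P}$. The canonical right (resp. left) invariant Riemannian metric $d_R$ (resp. $d_L$) on $G$ is the one induced by the right (resp. left) invariant Riemannian structure on $G$ whose value at the identity $I$ is $\langle\,,\rangle$ restricted to $T_IG\cong\mathfrak{G}$;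 $d(g,S)=\inf_{s\in S}d(g,s)$. For nonzero $v\in\mathbb{R}^n$: $G_v=\{g\in G:g(v)=v\}$, $\mathfrak{G}_v=\{X\in\mathfrak{G}:X(v)=0\}$, and $\widetilde{\mathfrak{P}_v}=(\mathfrak{K}+\mathfrak{G}_v)^\perp$ (orthogonal complement in $\mathfrak{G}$), which lies in $\mathfrak{P}$. For nonzero $X\in\mathfrak{P}$ and nonzero $v$, $\lambda_X(v)$ is the largest eigenvalue $\lambda$ of $X$ such that $v$ has a nonzero component in the eigenspace $\{w:Xw=\lambda w\}$. Define $\lambda^-(v)=\inf\{\lambda_X(v):X\in\widetilde{\mathfrak{P}_v},|X|=1\}$ and $\lambda^+(v)=\sup\{\lambda_X(v):X\in\widetilde{\mathfrak{P}_v},|X|=1\}$. A vector $v$ is minimal if $|g(v)|\ge|v|$ for all $g\in G$. $\underline{\lim}_{d_R(g,G_v)\to\infty}\frac{\log|g(v)|}{d_R(g,G_v)}$ (resp. $\overline{\lim}$) is the smallest (resp. largest) limit of $\frac{\log|g_k(v)|}{d_R(g_k,G_v)}$ over sequences $(g_k)$ in $G$ with $d_R(g_k,G_v)\to\infty$. *)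

(* Defs.v *)
From mathcomp Require Import all_boot.
From Stdlib Require Import Reals ClassicalEpsilon List.

Set Implicit Arguments.
Unset Strict Implicit.
Unset Printing Implicit Defensive.

Open Scope R_scope.

Definition vec (n : nat) := 'I_n -> R.
Definition mat (n : nat) := 'I_n -> 'I_n -> R.

Definition rsum (n : nat) (f : 'I_n -> R) : R := \big[Rplus/0]_(i < n) f i.

Definition vzero {n : nat} : vec n := fun _ => 0.
Definition vsub (n : nat) (u w : vec n) : vec n := fun i => u i - w i.
Definition vscale (n : nat) (a : R) (u : vec n) : vec n := fun i => a * u i.
Definition vdot (n : nat) (u w : vec n) : R := rsum (fun i => u i * w i).
Definition vnorm (n : nat) (u : vec n) : R := sqrt (vdot u u).

Definition mzero {n : nat} : mat n := fun _ _ => 0.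
Definition mid {n : nat} : mat n := fun i j => if i == j then 1 else 0.
Definition madd (n : nat) (A B : mat n) : mat n := fun i j => A i j + B i j.
Definition msub (n : nat) (A B : mat n) : mat n := fun i j => A i j - B i j.
Definition mscale (n : nat) (a : R) (A : mat n) : mat n := fun i j => a * A i j.
Definition mopp (n : nat) (A : mat n) : mat n := fun i j => - A i j.
Definition mtr (n : nat) (A : mat n) : mat n := fun i j => A j i.
Definition mmul (n : nat) (A B : mat n) : mat n :=
  fun i j => rsum (fun k => A i k * B k j).
Definition mvmul (n : nat) (A : mat n) (u : vec n) : vec n :=
  fun i => rsum (fun k => A i k * u k).
Definition mtrace (n : nat) (A : mat n) : R := rsum (fun i => A i i).

Definition minner (n : nat) (A B : mat n) : R := mtrace (mmul A (mtr B)).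
Definition mnorm (n : nat) (A : mat n) : R := sqrt (minner A A).

Fixpoint mpow (n : nat) (A : mat n) (k : nat) : mat n :=
  match k with O => mid | S k' => mmul A (mpow A k') end.

Definition is_mexp (n : nat) (X E : mat n) : Prop :=
  forall i j, Un_cv (fun N => sum_f_R0 (fun k => mpow X k i j / INR (Factorial.fact k)) N) (E i j).

Definition invertible (n : nat) (g : mat n) : Prop :=
  exists h : mat n, mmul g h = mid /\ mmul h g = mid.

Definition subgroup_GL (n : nat) (G : mat n -> Prop) : Prop :=
  (forall g, G g -> invertible g) /\
  G (mid) /\
  (forall g h, G g -> G h -> G (mmul g h)) /\
  (forall g, G g -> exists h, G h /\ mmul g h = mid /\ mmul h g = mid).

Definition self_adjoint (n : nat) (G : mat n -> Prop) : Prop :=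
  forall g, G g -> G (mtr g).

Definition open_set (n : nat) (U : mat n -> Prop) : Prop :=
  forall x, U x -> exists eps, 0 < eps /\ forall y, mnorm (msub y x) < eps -> U y.

Definition closed_in_GL (n : nat) (G : mat n -> Prop) : Prop :=
  forall g, invertible g -> ~ G g ->
    exists eps, 0 < eps /\
      forall h, invertible h -> mnorm (msub h g) < eps -> ~ G h.

Definition rel_open (n : nat) (G U : mat n -> Prop) : Prop :=
  (forall x, U x -> G x) /\
  forall x, U x -> exists eps, 0 < eps /\
    forall y, G y -> mnorm (msub y x) < eps -> U y.

Definition mat_connected (n : nat) (G : mat n -> Prop) : Prop :=
  forall U V : mat n -> Prop, rel_open G U -> rel_open G V ->
    (forall x, G x -> U x \/ V x) -> (forall x, ~ (U x /\ V x)) ->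
    (forall x, ~ U x) \/ (forall x, ~ V x).

Definition mat_compact (n : nat) (G : mat n -> Prop) : Prop :=
  forall (I : Type) (U : I -> mat n -> Prop),
    (forall i, open_set (U i)) -> (forall x, G x -> exists i, U i x) ->
    exists l : list I, forall x, G x -> exists i, In i l /\ U i x.

Definition lie_alg (n : nat) (G : mat n -> Prop) (X : mat n) : Prop :=
  forall t : R, exists E, is_mexp (mscale t X) E /\ G E.

Definition frakK (n : nat) (G : mat n -> Prop) (X : mat n) : Prop :=
  lie_alg G X /\ mtr X = mopp X.

Definition frakP (n : nat) (G : mat n -> Prop) (X : mat n) : Prop :=
  lie_alg G X /\ mtr X = X.

Definition stab (n : nat) (G : mat n -> Prop) (v : vec n) (g : mat n) : Prop :=
  G g /\ mvmul g v = v.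

Definition frakG_v (n : nat) (G : mat n -> Prop) (v : vec n) (X : mat n) : Prop :=
  lie_alg G X /\ mvmul X v = vzero.

Definition Ptilde (n : nat) (G : mat n -> Prop) (v : vec n) (X : mat n) : Prop :=
  lie_alg G X /\
  forall K Y, frakK G K -> frakG_v G v Y -> minner X (madd K Y) = 0.

Definition is_glb (S : R -> Prop) (m : R) : Prop :=
  (forall x, S x -> m <= x) /\ (forall b, (forall x, S x -> b <= x) -> b <= m).

Definition Rinf (S : R -> Prop) : R := epsilon (inhabits 0) (is_glb S).
Definition Rsup (S : R -> Prop) : R := epsilon (inhabits 0) (is_lub S).

(* curve_len G gam l : gam is a C^1 curve, lying in G on [0,1], whose length
   for the right invariant structure, int_0^1 |gam'(t) gam(t)^{-1}| dt, is l
   (eta t = gam'(t) gam(t)^{-1}, the unique solution of eta t * gam t = gam' t) *)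
Definition curve_len (n : nat) (G : mat n -> Prop) (gam : R -> mat n) (l : R) : Prop :=
  exists (gam' eta : R -> mat n),
    (forall t i j, derivable_pt_lim (fun s => gam s i j) t (gam' t i j)) /\
    (forall i j, continuity (fun t => gam' t i j)) /\
    (forall t, 0 <= t <= 1 -> G (gam t)) /\
    (forall t, 0 <= t <= 1 -> mmul (eta t) (gam t) = gam' t) /\
    exists pr : Riemann_integrable (fun t => mnorm (eta t)) 0 1, RiemannInt pr = l.

Definition dR (n : nat) (G : mat n -> Prop) (g h : mat n) : R :=
  Rinf (fun l => exists gam, gam 0 = g /\ gam 1 = h /\ curve_len G gam l).

Definition dR_set (n : nat) (G : mat n -> Prop) (g : mat n) (S : mat n -> Prop) : R :=
  Rinf (fun d => exists s, S s /\ d = dR G g s).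

(* v has a nonzero component c in the eigenspace {w : Xw = lam w}
   (orthogonal decomposition, X symmetric) *)
Definition has_component (n : nat) (X : mat n) (v : vec n) (lam : R) : Prop :=
  exists c : vec n, mvmul X c = vscale lam c /\
    (forall w, mvmul X w = vscale lam w -> vdot (vsub v c) w = 0) /\
    c <> vzero.

Definition is_lambdaX (n : nat) (X : mat n) (v : vec n) (l : R) : Prop :=
  has_component X v l /\ forall mu, has_component X v mu -> mu <= l.

Definition lambda_minus (n : nat) (G : mat n -> Prop) (v : vec n) : R :=
  Rinf (fun l => exists X, Ptilde G v X /\ mnorm X = 1 /\ is_lambdaX X v l).

Definition lambda_plus (n : nat) (G : mat n -> Prop) (v : vec n) : R :=
  Rsup (fun l => exists X, Ptilde G v X /\ mnorm X = 1 /\ is_lambdaX X v l).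

Definition minimal_vec (n : nat) (G : mat n -> Prop) (v : vec n) : Prop :=
  forall g, G g -> vnorm v <= vnorm (mvmul g v).

Definition orbit_unbounded (n : nat) (G : mat n -> Prop) (v : vec n) : Prop :=
  forall M, exists g, G g /\ M < vnorm (mvmul g v).

(* Main.v *)
(* Every [g] in [G] is [k exp(X) h] with [k] in [K], [X] in [P] and [h] in [G_v] (polar
   decomposition); take [|X|] minimal. First variation gives [X] orthogonal to [Lie(G_v)], and a
   symmetric [X] is orthogonal to skew matrices, so [X] lies in the space [P~_v].
   Moreover [|X| <= d_R(g, G_v) <= |X| + C]. The lower bound is a calibration: if
   [X = Q diag(d) Q^T], the function [- sum_i d_i ln L_ii] of the Cholesky factor [L] of
   [Q^T gam^T gam Q] varies along a curve [gam] at rate at most [|X|] times its speed, and by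
   [|X|^2] in total when [gam] joins [k exp(X)] to [1]. The upper bound is the length of a path
   from [g] that first moves [k] to [1], at a cost bounded by compactness of [K], and then
   contracts [exp(X)].
   Since [|g v| = |exp(X) v|], it remains to study [ln |exp(tY) v| - ln |v|] for unit [Y] in
   [P~_v]. It is at most [t lambda_Y(v)], and its quotient by [t] increases with [t] to
   [lambda_Y(v)]; compactness of the unit sphere makes the lower estimate uniform in [Y]. If [v]
   is minimal, [lambda_Y(v) <= 0] would force [Y v = 0], hence [Y] orthogonal to itself. *)
Require Import Defs.
From mathcomp Require Import all_boot all_order all_algebra.
From mathcomp Require Import Rstruct.
From Stdlib Require Import Reals FunctionalExtensionality ClassicalEpsilon Lra.
From Coquelicot Require Coquelicot.
From mathcomp Require Import ring lra.

Set Implicit Arguments.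
Unset Strict Implicit.
Unset Printing Implicit Defensive.

Import Order.TTheory GRing.Theory Num.Theory.

Local Open Scope ring_scope.

(** The obstacle is the polar decomposition itself. For [g] in [G] with [g^T g = exp (2 W)], the
    group is known to contain [exp (2 m W)] only for integers [m], so [W] is seen to be tangent to
    [G] only when it is small. Connectedness bridges the gap: the set of elements with a polar
    decomposition is open and closed in [G]. For openness, write [g = u exp(W) exp(X)] with [u]
    orthogonal and [W] symmetric in all of GL(n), [X] in [P], and [|W|] minimal. Near an element
    with a polar decomposition [|W|] is small, hence [W] is tangent to [G], and a nonzero [W] could
    be shortened. The calibration is the only source of lower bounds on length. Its potential is
    linear in the Iwasawa projection, which the Cholesky factor computes. It holds for curves in all
    of GL(n) and serves three times: for [d_R], for the shortening above, and for the first
    variation. In the last two uses the curve is an explicit product of exponentials, so that the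
    polar part of a product never has to be differentiated. *)

Module IntegralBound.
Import Coquelicot.Coquelicot.
Local Ltac rlra := Stdlib.micromega.Lra.lra.
Local Open Scope R_scope.
Local Arguments Rplus (_ _)%_R_scope.

(** * Integrating a pointwise bound on a derivative *)

Section IntegralBound.
Variables F F' phi : R -> R.
Hypothesis HF : forall t, 0 <= t <= 1 -> derivable_pt_lim F t (F' t).
Hypothesis Hphi : forall t, 0 <= t <= 1 -> F' t <= phi t.

(** A tag has to be a total function of the two endpoints; endpoints that are out of order or
    outside [0, 1] get the point [x], about which nothing more is claimed. *)
Lemma mean_value_tag x y : exists t, (x <= y -> x <= t <= y) /\
  (0 <= x -> x <= y -> y <= 1 -> F y - F x = F' t * (y - x)).
Proof.
case: (Rlt_le_dec x y) => xy; last first.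
  have xy' : x <= y -> y = x by move=> ?; apply: Rle_antisym.
  by exists x; split=> [?|_ /xy' -> _]; [split; [exact: Rle_refl|]|rewrite !Rminus_diag Rmult_0_r].
case: (Rle_lt_dec 0 x) => x0; last by exists x; split=> *; [split; rlra|rlra].
case: (Rle_lt_dec y 1) => y1; last by exists x; split=> *; [split; rlra|rlra].
have [|t [E ty]] := MVT_cor2 F F' x y xy; first by move=> c c01; apply: HF; split; rlra.
by exists t; split=> *; [split; rlra|].
Qed.

Let tag x y := sval (constructive_indefinite_description _ (mean_value_tag x y)).

Lemma tag_between x y : x <= y -> x <= tag x y <= y.
Proof. by move=> xy; have [] := svalP (constructive_indefinite_description _ (mean_value_tag x y)); auto. Qed.

Lemma tagE x y : 0 <= x -> x <= y -> y <= 1 -> F y - F x = F' (tag x y) * (y - x).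
Proof. by have [] := svalP (constructive_indefinite_description _ (mean_value_tag x y)). Qed.

Lemma sorted_le_last h (P : list R) : sorted Rle (h :: P) -> h <= seq.last h P.
Proof.
elim: P h => [|a P IH] h /=; first by rlra.
by case=> ha /IH H; apply: Rle_trans ha H.
Qed.

Lemma Riemann_sum_telescope h (P : list R) : sorted Rle (h :: P) -> 0 <= h -> seq.last h P <= 1 ->
  Riemann_sum F' (SF_seq_f2 tag (h :: P)) = F (seq.last h P) - F h.
Proof.
elim: P h => [|a P IH] h Hs h0 h1; first by rewrite /Riemann_sum /=; rewrite /zero /=; rlra.
rewrite SF_cons_f2 //; last exact/ssrnat.ltP.
rewrite Riemann_sum_cons /=; case: Hs => ha Hs; move: h1 => /= h1.
rewrite IH //; last rlra.
have := sorted_le_last Hs => a1.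
have := tagE h0 ha; rewrite /plus /scal /= /mult /= => E; have := E _; rlra.
Qed.

(** In the calibration [F'] comes from a choice and has no known regularity, so it cannot be
    integrated. With mean value points as tags its Riemann sums equal [F 1 - F 0] exactly, while the
    sums of [phi] with the same tags tend to the integral. *)
Lemma le_RiemannInt (pr : Riemann_integrable phi 0 1) : F 1 - F 0 <= RiemannInt pr.
Proof.
rewrite -RInt_Reals; have /RInt_correct := ex_RInt_Reals_1 _ _ _ pr.
set I := RInt _ _ _ => HI; apply: le_epsilon => e e0.
have [d Hd] := (proj1 (filterlim_locally _ _)) HI (mkposreal e e0).
have [N [HN /lt_0_INR N0]] := archimed_cor1 d (cond_pos d).
have := Riemann_fine_unif_part tag 0 1 N tag_between Rle_0_1.
have := head_unif_part 0 0 1 N; have := last_unif_part 0 0 1 N; have := unif_part_sort 0 1 N Rle_0_1.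
case: (unif_part 0 1 N) => [|h P] /= Ps Pl Ph; first by rlra.
rewrite {}Ph in Ps Pl *; case=> H1 [H2 [H3 H4]].
have /Hd : seq_step (SF_lx (SF_seq_f2 tag (0 :: P))) < d.
  apply: Rle_lt_trans H1 _; rewrite Rminus_0_r /Rdiv Rmult_1_l; apply: Rlt_trans HN.
  by apply: Rinv_lt_contravar; [apply: Rmult_lt_0_compat; rlra|rlra].
rewrite Rmin_left; last rlra; rewrite Rmax_right; last rlra.
move=> /(_ (conj H2 (conj H3 H4))); rewrite Rminus_0_r sign_eq_1; last rlra.
rewrite /ball /= /AbsRing_ball /abs /minus /plus /opp /scal /= /mult /= => /Rabs_def2 [Hb _].
have Hle : Riemann_sum F' (SF_seq_f2 tag (0 :: P)) <= Riemann_sum phi (SF_seq_f2 tag (0 :: P)).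
  by apply: Riemann_sum_le H2 _ => t; rewrite /SF_lx /= H4; apply: Hphi.
have E : Riemann_sum F' (SF_seq_f2 tag (0 :: P)) = F 1 - F 0.
  by rewrite Riemann_sum_telescope ?Pl //; apply: Rle_refl.
rewrite E in Hle; move: Hb Hle; move: (Riemann_sum phi _) (I : R) => /= S J Hb Hle.
rlra.
Qed.

Lemma RiemannInt_le (pr : Riemann_integrable phi 0 1) (B B' : R -> R) :
  (forall t, derivable_pt_lim B t (B' t)) -> continuity B' ->
  (forall t, 0 < t < 1 -> phi t <= B' t) -> RiemannInt pr <= B 1 - B 0.
Proof.
move=> HB cB leB; rewrite -RInt_Reals.
apply: (is_RInt_le phi B' 0 1); [exact: Rle_0_1|exact/RInt_correct/ex_RInt_Reals_1| |exact: leB].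
apply: (is_RInt_derive B B') => x _; first exact/is_derive_Reals.
exact/continuity_pt_filterlim/cB.
Qed.

End IntegralBound.
End IntegralBound.

Local Bind Scope ring_scope with R.
Local Arguments Un_cv (_ _)%_ring_scope.
Local Arguments derivable_pt_lim _%_function_scope (_ _)%_ring_scope.
Local Arguments exp _%_ring_scope.
Local Arguments ln _%_ring_scope.

(** * Limits and norms *)

Lemma Un_cvP (u : nat -> R) (l : R) :
  Un_cv u l <-> (forall e, 0 < e -> exists N, forall k, (N <= k)%nat -> `|u k - l| < e).
Proof.
split=> H e e0.
  have [N HN] := H e (elimT RltP e0); exists N => k /ssrnat.leP Hk.
  by have /RltP := HN k Hk; rewrite /Rdist ?RealsE.
have [N HN] := H e (introT RltP e0); exists N => k Hk.
have /HN : (N <= k)%nat by apply/ssrnat.leP.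
by move=> ?; apply/RltP; rewrite /Rdist ?RealsE.
Qed.

Lemma cv_cst (c : R) : Un_cv (fun=> c) c.
Proof. by apply/Un_cvP => e e0; exists 0%nat => k _; rewrite subrr normr0. Qed.

Lemma cvD u v (a b : R) : Un_cv u a -> Un_cv v b -> Un_cv (fun k => u k + v k) (a + b).
Proof. exact: CV_plus. Qed.

Lemma cvN u (a : R) : Un_cv u a -> Un_cv (fun k => - u k) (- a).
Proof. exact: CV_opp. Qed.

Lemma cvB u v (a b : R) : Un_cv u a -> Un_cv v b -> Un_cv (fun k => u k - v k) (a - b).
Proof. exact: CV_minus. Qed.

Lemma cvM u v (a b : R) : Un_cv u a -> Un_cv v b -> Un_cv (fun k => u k * v k) (a * b).
Proof. exact: CV_mult. Qed.

Lemma eq_cv u v (l : R) : (forall k, u k = v k) -> Un_cv u l -> Un_cv v l.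
Proof.
move=> uv /Un_cvP H; apply/Un_cvP => e /H[N HN].
by exists N => k; rewrite -uv; apply: HN.
Qed.

Lemma cv_uniq u (a b : R) : Un_cv u a -> Un_cv u b -> a = b.
Proof. exact: UL_sequence. Qed.

Lemma cv_sum (I : Type) (r : seq I) (P : pred I) (u : nat -> I -> R) (l : I -> R) :
  (forall i, Un_cv (fun k => u k i) (l i)) ->
  Un_cv (fun k => \sum_(i <- r | P i) u k i) (\sum_(i <- r | P i) l i).
Proof.
move=> H; elim: r => [|i r IH].
  by rewrite big_nil; apply: eq_cv (cv_cst 0) => k; rewrite big_nil.
rewrite big_cons; case: ifP => Pi.
  by apply: eq_cv (cvD (H i) IH) => k; rewrite big_cons Pi.
by apply: eq_cv IH => k; rewrite big_cons Pi.
Qed.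

Lemma cv_le u v (a b : R) : (forall k, u k <= v k) -> Un_cv u a -> Un_cv v b -> a <= b.
Proof.
move=> uv ua vb; apply/RleP.
by apply: (Rle_cv_lim (Un := u) (Vn := v)) => // k; apply/RleP.
Qed.

Lemma cv_sub u (l : R) (phi : nat -> nat) :
  Un_cv u l -> (forall k, (k <= phi k)%nat) -> Un_cv (fun k => u (phi k)) l.
Proof.
move=> /Un_cvP H Hphi; apply/Un_cvP => e /H[N HN]; exists N => k Nk.
exact/HN/(leq_trans Nk).
Qed.

Lemma cv_inv_succ : Un_cv (fun k => k.+1%:R^-1) 0.
Proof.
apply/Un_cvP => e e0; exists (Num.bound e^-1) => k Nk.
rewrite subr0 ger0_norm ?invr_ge0 ?ler0n // invf_plt ?posrE ?ltr0Sn //.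
apply: lt_le_trans (archi_boundP _) _; first by rewrite invr_ge0 ltW.
by rewrite ler_nat ltnW.
Qed.

Lemma cv_squeeze0 u v : (forall k, `|u k| <= v k) -> Un_cv v 0 -> Un_cv u 0.
Proof.
move=> uv /Un_cvP H; apply/Un_cvP => e /H[N HN]; exists N => k /HN.
rewrite !subr0; apply: le_lt_trans; exact: le_trans (uv k) (ler_norm _).
Qed.

(** The condition [k <= phi k] stands in for strict monotonicity of the extraction: it preserves
    limits, is stable under composition, and is read off a cluster point one index at a time. *)
Lemma cv_bw (u : nat -> R) (M : R) : (forall k, `|u k| <= M) ->
  exists (phi : nat -> nat) l, (forall k, (k <= phi k)%nat) /\ Un_cv (fun k => u (phi k)) l.
Proof.
move=> uM.
have [k|l Hl] := Bolzano_Weierstrass u (fun c => Rle (- M) c /\ Rle c M) (compact_P3 _ _).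
  by have := uM k; rewrite ler_norml => /andP[? ?]; split; apply/RleP.
have /(_ _)/constructive_indefinite_description H k :
    exists p, (k <= p)%nat /\ `|u p - l| < k.+1%:R^-1.
  have e0 : Rlt 0 (k.+1%:R^-1) by apply/RltP; rewrite invr_gt0 ltr0Sn.
  have [|p [/ssrnat.leP kp up]] := Hl (disc l (mkposreal _ e0)) k.
    by exists (mkposreal _ e0).
  by exists p; split=> //; move/RltP: up; rewrite /= ?RealsE.
exists (fun k => sval (H k)), l; split=> [k|]; first by case: (H k) => ? [].
have : Un_cv (fun k => u (sval (H k)) - l) 0.
  apply: cv_squeeze0 cv_inv_succ => k; have [_ ?] := svalP (H k); exact: ltW.
move=> H0; have := cvD H0 (cv_cst l); rewrite add0r; apply: eq_cv => k; ring.
Qed.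

Lemma cv_bw_fin (I : finType) (u : nat -> I -> R) (M : R) : (forall k i, `|u k i| <= M) ->
  exists (phi : nat -> nat) (l : I -> R),
    (forall k, (k <= phi k)%nat) /\ forall i, Un_cv (fun k => u (phi k) i) (l i).
Proof.
move=> uM.
suff H (s : seq I) : exists (phi : nat -> nat) (l : I -> R), (forall k, (k <= phi k)%nat) /\
    forall i, i \in s -> Un_cv (fun k => u (phi k) i) (l i).
  have [phi [l [H1 H2]]] := H (enum I).
  by exists phi, l; split=> // i; apply: H2; rewrite mem_enum.
elim: s => [|i s [phi [l [H1 H2]]]]; first by exists (fun k => k), (fun=> 0).
have [psi [a [H3 H4]]] := @cv_bw (fun k => u (phi k) i) M (fun k => uM _ _).
exists (phi \o psi), (fun j => if j == i then a else l j); split=> [k|j].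
  exact: leq_trans (H3 k) (H1 _).
rewrite inE; case: eqP => [-> _|_ /=]; first exact: H4.
by move=> /H2 /cv_sub; apply.
Qed.

(** * The Frobenius inner product and limits of matrices *)

Section Norm.
Variables m n : nat.
Implicit Types A B C : 'M[R]_(m, n).

Definition dotm A B : R := \tr (A *m B^T).
Definition nrm A : R := Num.sqrt (dotm A A).

Lemma dotmE A B : dotm A B = \sum_i \sum_j A i j * B i j.
Proof.
by apply: eq_bigr => i _; rewrite mxE; apply: eq_bigr => j _; rewrite mxE.
Qed.

Lemma dotmC A B : dotm A B = dotm B A.
Proof. by rewrite /dotm -mxtrace_tr trmx_mul trmxK. Qed.

Lemma dotmDl A B C : dotm (A + B) C = dotm A C + dotm B C.
Proof. by rewrite /dotm mulmxDl mxtraceD. Qed.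

Lemma dotmDr A B C : dotm C (A + B) = dotm C A + dotm C B.
Proof. by rewrite !(dotmC C) dotmDl. Qed.

Lemma dotmZl a A B : dotm (a *: A) B = a * dotm A B.
Proof. by rewrite /dotm -scalemxAl mxtraceZ. Qed.

Lemma dotmZr a A B : dotm A (a *: B) = a * dotm A B.
Proof. by rewrite dotmC dotmZl dotmC. Qed.

Lemma dotmNl A B : dotm (- A) B = - dotm A B.
Proof. by rewrite -scaleN1r dotmZl mulN1r. Qed.

Lemma dotmNr A B : dotm A (- B) = - dotm A B.
Proof. by rewrite dotmC dotmNl dotmC. Qed.

Lemma dotm0l A : dotm 0 A = 0.
Proof. by rewrite -(scale0r 0) dotmZl mul0r. Qed.

Lemma dotm0r A : dotm A 0 = 0.
Proof. by rewrite dotmC dotm0l. Qed.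

Definition dotmE_lin := (dotmDl, dotmDr, dotmNl, dotmNr, dotmZl, dotmZr).

Lemma dotm_ge0 A : 0 <= dotm A A.
Proof. by rewrite dotmE; do 2!apply: sumr_ge0 => ? _; rewrite -expr2 sqr_ge0. Qed.

Lemma sqr_nrm A : nrm A ^+ 2 = dotm A A.
Proof. by rewrite sqr_sqrtr ?dotm_ge0. Qed.

Lemma nrm_ge0 A : 0 <= nrm A.
Proof. exact: sqrtr_ge0. Qed.

Lemma entry_le_nrm A i j : `|A i j| <= nrm A.
Proof.
rewrite -sqrtr_sqr ler_sqrt ?dotm_ge0 // dotmE (bigD1 i) //= (bigD1 j) //= -expr2.
rewrite -addrA lerDl addr_ge0 //; first by apply: sumr_ge0 => ? _; rewrite -expr2 sqr_ge0.
by do 2!apply: sumr_ge0 => ? _; rewrite -expr2 sqr_ge0.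
Qed.

Lemma nrm_eq0 A : nrm A = 0 -> A = 0.
Proof.
move=> A0; apply/matrixP => i j; rewrite mxE; apply/eqP.
by rewrite -normr_le0 -A0 entry_le_nrm.
Qed.

Lemma nrm0 : nrm 0 = 0.
Proof. by rewrite /nrm dotm0l sqrtr0. Qed.

Lemma nrm_gt0 A : A != 0 -> 0 < nrm A.
Proof.
by move=> A0; rewrite lt_neqAle nrm_ge0 andbT; apply: contraNneq A0 => /esym/nrm_eq0 ->.
Qed.

Lemma nrmZ a A : nrm (a *: A) = `|a| * nrm A.
Proof. by rewrite /nrm dotmZl dotmZr mulrA -expr2 sqrtrM ?sqr_ge0 // sqrtr_sqr. Qed.

Lemma nrmN A : nrm (- A) = nrm A.
Proof. by rewrite -scaleN1r nrmZ normrN1 mul1r. Qed.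

Lemma dotm_le A B : dotm A B <= nrm A * nrm B.
Proof.
have [->|A0] := eqVneq A 0; first by rewrite dotm0l nrm0 mul0r.
have [->|B0] := eqVneq B 0; first by rewrite dotm0r nrm0 mulr0.
have a0 := nrm_gt0 A0; have b0 := nrm_gt0 B0.
have := dotm_ge0 (nrm B *: A - nrm A *: B).
rewrite !dotmE_lin -!sqr_nrm (dotmC B A) => H.
rewrite -(ler_pM2l (mulr_gt0 a0 b0)); nra.
Qed.

Lemma norm_dotm_le A B : `|dotm A B| <= nrm A * nrm B.
Proof. by rewrite ler_norml dotm_le andbT lerNl -dotmNl -(nrmN A) dotm_le. Qed.

Lemma ler_nrmD A B : nrm (A + B) <= nrm A + nrm B.
Proof.
rewrite -(ler_pXn2r (isT : (0 < 2)%nat)) ?nnegrE ?addr_ge0 ?nrm_ge0 //.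
rewrite sqr_nrm !dotmE_lin -!sqr_nrm (dotmC B A); have := dotm_le A B; nra.
Qed.

Lemma ler_nrmB A B : nrm (A - B) <= nrm A + nrm B.
Proof. by rewrite -(nrmN B) ler_nrmD. Qed.

Lemma ler_nrm_sub A B : nrm A - nrm B <= nrm (A - B).
Proof. by rewrite lerBlDr; apply: le_trans (ler_nrmD _ _); rewrite subrK. Qed.

Lemma nrmE A : nrm A = Num.sqrt (dotm A A).
Proof. by []. Qed.

End Norm.

Lemma dotm_tr m n (A B : 'M[R]_(m, n)) : dotm A^T B^T = dotm A B.
Proof. by rewrite /dotm trmxK mxtrace_mulC -mxtrace_tr trmx_mul trmxK. Qed.

Lemma nrm_tr m n (A : 'M[R]_(m, n)) : nrm A^T = nrm A.
Proof. by rewrite /nrm dotm_tr. Qed.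

Lemma dotm_mull m n p (A : 'M[R]_(m, n)) B (C : 'M[R]_(m, p)) :
  dotm (A *m B) C = dotm B (A^T *m C).
Proof. by rewrite /dotm trmx_mul trmxK -mulmxA mxtrace_mulC -mulmxA. Qed.

Lemma dotm_mulr m n p (A : 'M[R]_(m, n)) B (C : 'M[R]_(m, p)) :
  dotm (A *m B) C = dotm A (C *m B^T).
Proof. by rewrite /dotm trmx_mul trmxK -!mulmxA. Qed.

(** Cauchy-Schwarz for each entry, a row of [A] against a column of [B]; the squared norms of the
    rows add up to [|A|^2], those of the columns to [|B|^2]. *)
Lemma nrm_mulmx m n p (A : 'M[R]_(m, n)) (B : 'M[R]_(n, p)) : nrm (A *m B) <= nrm A * nrm B.
Proof.
rewrite -(ler_pXn2r (isT : (0 < 2)%nat)) ?nnegrE ?mulr_ge0 ?nrm_ge0 //.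
rewrite exprMn !sqr_nrm [dotm (_ *m _) _]dotmE.
have AE : dotm A A = \sum_i dotm (row i A) (row i A).
  rewrite dotmE; apply: eq_bigr => i _; rewrite dotmE big_ord1.
  by apply: eq_bigr => j _; rewrite !mxE.
have BE : dotm B B = \sum_j dotm (col j B)^T (col j B)^T.
  rewrite dotmE exchange_big; apply: eq_bigr => j _; rewrite dotmE big_ord1.
  by apply: eq_bigr => i _; rewrite !mxE.
rewrite AE BE big_distrl; apply: ler_sum => i _.
rewrite big_distrr; apply: ler_sum => j _ /=.
have -> : (A *m B) i j = dotm (row i A) (col j B)^T.
  by rewrite mxE dotmE big_ord1; apply: eq_bigr => k _; rewrite !mxE.
have /= := norm_dotm_le (row i A) (col j B)^T.
rewrite -expr2 -!sqr_nrm -exprMn => H.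
by rewrite -[leLHS]real_normK ?num_real // ler_pXn2r ?nnegrE ?mulr_ge0 ?nrm_ge0.
Qed.

Definition mcv m n (A : nat -> 'M[R]_(m, n)) (L : 'M[R]_(m, n)) : Prop :=
  forall i j, Un_cv (fun k => A k i j) (L i j).

Section MatrixLimits.
Variables m n : nat.
Implicit Types (A B : nat -> 'M[R]_(m, n)) (L : 'M[R]_(m, n)).

Lemma mcv_cst L : mcv (fun=> L) L.
Proof. by move=> i j; apply: cv_cst. Qed.

Lemma eq_mcv A B L : (forall k, A k = B k) -> mcv A L -> mcv B L.
Proof. by move=> AB H i j; apply: eq_cv (H i j) => k; rewrite AB. Qed.

Lemma mcvD A B L M : mcv A L -> mcv B M -> mcv (fun k => A k + B k) (L + M).
Proof. by move=> H K i j; rewrite mxE; apply: eq_cv (cvD (H i j) (K i j)) => k; rewrite mxE. Qed.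

Lemma mcvZ a A (b : R) L : Un_cv a b -> mcv A L -> mcv (fun k => a k *: A k) (b *: L).
Proof. by move=> H K i j; rewrite mxE; apply: eq_cv (cvM H (K i j)) => k; rewrite mxE. Qed.

Lemma mcvN A L : mcv A L -> mcv (fun k => - A k) (- L).
Proof. by move=> H i j; rewrite mxE; apply: eq_cv (cvN (H i j)) => k; rewrite mxE. Qed.

Lemma mcvB A B L M : mcv A L -> mcv B M -> mcv (fun k => A k - B k) (L - M).
Proof. by move=> H K; apply: mcvD => //; apply: mcvN. Qed.

Lemma mcv_tr A L : mcv A L -> mcv (fun k => (A k)^T) L^T.
Proof. by move=> H i j; rewrite mxE; apply: eq_cv (H j i) => k; rewrite mxE. Qed.

Lemma mcv_uniq A L M : mcv A L -> mcv A M -> L = M.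
Proof. by move=> H K; apply/matrixP => i j; exact: cv_uniq (H i j) (K i j). Qed.

Lemma mcv_sub A L (phi : nat -> nat) :
  mcv A L -> (forall k, (k <= phi k)%nat) -> mcv (fun k => A (phi k)) L.
Proof. by move=> H K i j; exact: (cv_sub (H i j)). Qed.

Lemma cv_dotm A B L M : mcv A L -> mcv B M -> Un_cv (fun k => dotm (A k) (B k)) (dotm L M).
Proof.
move=> H K; rewrite dotmE; apply: (@eq_cv (fun k => \sum_i \sum_j A k i j * B k i j)) => [k|].
  by rewrite dotmE.
by do 2!apply: cv_sum => ?; apply: cvM.
Qed.

Lemma cv_sqrt u (l : R) : 0 <= l -> Un_cv u l -> Un_cv (fun k => Num.sqrt (u k)) (Num.sqrt l).
Proof.
move=> l0 H; rewrite -RsqrtE; apply: (@eq_cv (fun k => sqrt (u k))) => [k|]; first by rewrite RsqrtE.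
by apply: continuity_seq => //; apply: continuity_pt_sqrt; apply/RleP.
Qed.

Lemma cv_nrm A L : mcv A L -> Un_cv (fun k => nrm (A k)) (nrm L).
Proof. by move=> H; apply: cv_sqrt (cv_dotm H H); exact: dotm_ge0. Qed.

Lemma mcvP A L : mcv A L <-> Un_cv (fun k => nrm (A k - L)) 0.
Proof.
split=> H; first by have := cv_nrm (mcvB H (mcv_cst L)); rewrite subrr nrm0.
move=> i j; have : Un_cv (fun k => A k i j - L i j) 0.
  by apply: cv_squeeze0 H => k; apply: le_trans (entry_le_nrm _ i j); rewrite !mxE.
move=> H0; have := cvD H0 (cv_cst (L i j)); rewrite add0r; apply: eq_cv => k; ring.
Qed.

Lemma mcv_bw A (M : R) : (forall k, nrm (A k) <= M) ->
  exists (phi : nat -> nat) L, (forall k, (k <= phi k)%nat) /\ mcv (fun k => A (phi k)) L.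
Proof.
move=> AM; have [|phi [l [H1 H2]]] := @cv_bw_fin ('I_m * 'I_n)%type (fun k ij => A k ij.1 ij.2) M.
  by move=> k [i j]; exact: le_trans (entry_le_nrm _ _ _) (AM k).
exists phi, (\matrix_(i, j) l (i, j)); split=> // i j; rewrite mxE; exact: (H2 (i, j)).
Qed.

End MatrixLimits.

Lemma mcvM m n p (A : nat -> 'M[R]_(m, n)) (B : nat -> 'M[R]_(n, p)) L M :
  mcv A L -> mcv B M -> mcv (fun k => A k *m B k) (L *m M).
Proof.
move=> H K i j; rewrite mxE.
apply: (@eq_cv (fun k => \sum_l A k i l * B k l j)) => [k|]; first by rewrite mxE.
by apply: cv_sum => l; apply: cvM.
Qed.

Opaque nrm.

(** * Derivatives and the matrix exponential *)

Lemma expR_gt0 (x : R) : 0 < exp x.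
Proof. exact/RltP/exp_pos. Qed.

Lemma expR_le (x y : R) : x <= y -> exp x <= exp y.
Proof.
rewrite le_eqVlt => /predU1P[->//|/RltP xy].
exact/ltW/RltP/exp_increasing.
Qed.

Lemma expR_ge1Dx (x : R) : 1 + x <= exp x.
Proof.
have [->|/eqP x0] := eqVneq x 0; first by rewrite addr0 exp_0.
exact/ltW/RltP/exp_ineq1.
Qed.

Lemma exp_add (x y : R) : exp (x + y) = exp x * exp y.
Proof. exact: exp_plus. Qed.

Lemma expRN (x : R) : exp (- x) = (exp x)^-1.
Proof. exact: exp_Ropp. Qed.

Lemma eq_dpt f g t (a b : R) : (forall s, f s = g s) -> a = b ->
  derivable_pt_lim f t a -> derivable_pt_lim g t b.
Proof. by move=> fg <-; apply: derivable_pt_lim_ext. Qed.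

Lemma dpt_cst c t : derivable_pt_lim (fun=> c) t 0.
Proof. exact: derivable_pt_lim_const. Qed.

Lemma dptD f g t (a b : R) : derivable_pt_lim f t a -> derivable_pt_lim g t b ->
  derivable_pt_lim (fun s => f s + g s) t (a + b).
Proof. exact: derivable_pt_lim_plus. Qed.

Lemma dptN f t (a : R) : derivable_pt_lim f t a -> derivable_pt_lim (fun s => - f s) t (- a).
Proof. exact: derivable_pt_lim_opp. Qed.

Lemma dptM f g t (a b : R) : derivable_pt_lim f t a -> derivable_pt_lim g t b ->
  derivable_pt_lim (fun s => f s * g s) t (a * g t + f t * b).
Proof. exact: derivable_pt_lim_mult. Qed.

Lemma dpt_comp f g t (a b : R) : derivable_pt_lim f t a -> derivable_pt_lim g (f t) b ->
  derivable_pt_lim (fun s => g (f s)) t (b * a).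
Proof. exact: derivable_pt_lim_comp. Qed.

Lemma dpt_affine (a b t : R) : derivable_pt_lim (fun s => s * a + b) t a.
Proof.
apply: eq_dpt (dptD (dptM (derivable_pt_lim_id t) (dpt_cst a t)) (dpt_cst b t)) => //.
by rewrite mulr0 !addr0 mul1r.
Qed.

Lemma dpt_sum (I : Type) (r : seq I) (P : pred I) (f : I -> R -> R) (a : I -> R) t :
  (forall i, P i -> derivable_pt_lim (f i) t (a i)) ->
  derivable_pt_lim (fun s => \sum_(i <- r | P i) f i s) t (\sum_(i <- r | P i) a i).
Proof.
move=> H; elim: r => [|i r IH].
  by rewrite big_nil; apply: eq_dpt (dpt_cst 0 t) => // s; rewrite big_nil.
rewrite big_cons; case: ifP => Pi.
  by apply: eq_dpt (dptD (H i Pi) IH) => // s; rewrite big_cons Pi.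
by apply: eq_dpt IH => // s; rewrite big_cons Pi.
Qed.

Lemma mvt_le f f' c : (forall t : R, 0 <= t <= 1 -> derivable_pt_lim f t (f' t)) ->
  (forall t : R, 0 <= t <= 1 -> f' t <= c) -> f 1 - f 0 <= c.
Proof.
move=> Hf Hc.
have [|t [/RleP t0 /RleP t1]|t [E [/RltP t0 /RltP t1]]] := MVT_cor2 f f' 0 1.
- exact: Rlt_0_1.
- by apply: Hf; rewrite t0 t1.
have : f 1 - f 0 = f' t * (1 - 0) by rewrite -!RminusE E.
by rewrite subr0 mulr1 => ->; apply: Hc; rewrite !ltW.
Qed.

Definition mder m n (F : R -> 'M[R]_(m, n)) (t : R) (F' : 'M[R]_(m, n)) : Prop :=
  forall i j, derivable_pt_lim (fun s => F s i j) t (F' i j).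

Section MatrixDerivative.
Variables m n : nat.
Implicit Types (F G : R -> 'M[R]_(m, n)) (D E : 'M[R]_(m, n)).

Lemma eq_mder F G t D E : (forall s, F s = G s) -> D = E -> mder F t D -> mder G t E.
Proof. by move=> FG <- H i j; apply: eq_dpt (H i j) => // s; rewrite FG. Qed.

Lemma mder_cst D t : mder (fun=> D) t 0.
Proof. by move=> i j; rewrite mxE; apply: dpt_cst. Qed.

Lemma mderD F G t D E : mder F t D -> mder G t E -> mder (fun s => F s + G s) t (D + E).
Proof.
by move=> HF HG i j; apply: eq_dpt (dptD (HF i j) (HG i j)) => [s|]; rewrite mxE.
Qed.

Lemma mderN F t D : mder F t D -> mder (fun s => - F s) t (- D).
Proof. by move=> HF i j; apply: eq_dpt (dptN (HF i j)) => [s|]; rewrite mxE. Qed.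

Lemma mderZ f F t (a : R) D : derivable_pt_lim f t a -> mder F t D ->
  mder (fun s => f s *: F s) t (a *: F t + f t *: D).
Proof.
by move=> Hf HF i j; apply: eq_dpt (dptM Hf (HF i j)) => [s|]; rewrite !mxE.
Qed.

Lemma mder_tr F t D : mder F t D -> mder (fun s => (F s)^T) t D^T.
Proof. by move=> HF i j; apply: eq_dpt (HF j i) => [s|]; rewrite mxE. Qed.

Lemma mder_comp (phi : R -> R) F t (a : R) D : derivable_pt_lim phi t a -> mder F (phi t) D ->
  mder (fun s => F (phi s)) t (a *: D).
Proof.
move=> Hp HF i j; apply: eq_dpt (dpt_comp Hp (HF i j)) => //.
by rewrite mxE mulrC.
Qed.

Lemma dpt_dotm F G t D E : mder F t D -> mder G t E ->
  derivable_pt_lim (fun s => dotm (F s) (G s)) t (dotm D (G t) + dotm (F t) E).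
Proof.
move=> HF HG.
apply: (@eq_dpt (fun s => \sum_i \sum_j F s i j * G s i j) _ t
  (\sum_i \sum_j (D i j * G t i j + F t i j * E i j))) => [s||].
- by rewrite dotmE.
- by rewrite !dotmE -big_split; apply: eq_bigr => i _; rewrite -big_split.
by do 2!apply: dpt_sum => ? _; apply: dptM.
Qed.

(** Pairing [F] with its own increment [D] reduces to the scalar mean value theorem, which gives
    [|D|^2 <= c |D|]. *)
Lemma mvt_mx F F' (c : R) : (forall t : R, 0 <= t <= 1 -> mder F t (F' t)) ->
  (forall t : R, 0 <= t <= 1 -> nrm (F' t) <= c) -> nrm (F 1 - F 0) <= c.
Proof.
move=> HF Hc; set D := F 1 - F 0.
have [->|D0] := eqVneq D 0.
  by rewrite nrm0; apply: le_trans (Hc 0 _); rewrite ?nrm_ge0 // lexx ler01.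
rewrite -(ler_pM2r (nrm_gt0 D0)) -expr2 sqr_nrm {1}/D dotmDl dotmNl.
apply: (@mvt_le (fun t => dotm (F t) D) (fun t => dotm (F' t) D)) => t t01.
  apply: eq_dpt (dpt_dotm (HF t t01) (mder_cst D t)) => //.
  by rewrite dotm0r addr0.
apply: le_trans (dotm_le _ _) _; by rewrite ler_wpM2r ?nrm_ge0 ?Hc.
Qed.

Lemma mder0_cst F : (forall t : R, 0 <= t <= 1 -> mder F t 0) -> F 1 = F 0.
Proof.
move=> HF; apply/subr0_eq/nrm_eq0/le_anti; rewrite nrm_ge0 andbT.
by apply: (mvt_mx HF) => t _; rewrite nrm0.
Qed.

End MatrixDerivative.

Lemma mderM m n p (F : R -> 'M[R]_(m, n)) (G : R -> 'M[R]_(n, p)) t D E :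
  mder F t D -> mder G t E -> mder (fun s => F s *m G s) t (D *m G t + F t *m E).
Proof.
move=> HF HG i j.
apply: (@eq_dpt (fun s => \sum_k F s i k * G s k j) _ t
  (\sum_k (D i k * G t k j + F t i k * E k j))) => [s||].
- by rewrite mxE.
- by rewrite !mxE -big_split.
by apply: dpt_sum => k _; apply: dptM.
Qed.

Lemma mderMl m n p (A : 'M[R]_(m, n)) (G : R -> 'M[R]_(n, p)) t E :
  mder G t E -> mder (fun s => A *m G s) t (A *m E).
Proof.
by move=> H; apply: eq_mder (mderM (mder_cst A t) H) => //; rewrite mul0mx add0r.
Qed.

Lemma mderMr m n p (F : R -> 'M[R]_(m, n)) (B : 'M[R]_(n, p)) t D :
  mder F t D -> mder (fun s => F s *m B) t (D *m B).
Proof.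
by move=> H; apply: eq_mder (mderM H (mder_cst B t)) => //; rewrite mulmx0 addr0.
Qed.

Fixpoint mxpow n (A : 'M[R]_n) k : 'M[R]_n := if k is k'.+1 then A *m mxpow A k' else 1%:M.

Definition ecoef n (A : 'M[R]_n) i j k : R := mxpow A k i j / INR (Factorial.fact k).

(** Each entry is a real power series at 1. The entries of [exp (t A)] are then the same series at
    [t], so the derivative in [t] is a termwise derivative. *)
Definition mexp n (A : 'M[R]_n) : 'M[R]_n :=
  \matrix_(i, j) Coquelicot.PSeries.PSeries (ecoef A i j) 1.

Definition esum n (A : 'M[R]_n) N : 'M[R]_n :=
  \sum_(k < N.+1) (INR (Factorial.fact k))^-1 *: mxpow A k.

Section Exponential.
Variable n : nat.
Implicit Types A B P X : 'M[R]_n.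

Lemma nrm_mxpow A k : nrm (mxpow A k) <= nrm (1%:M : 'M[R]_n) * nrm A ^+ k.
Proof.
elim: k => [|k IH] /=; first by rewrite expr0 mulr1.
by apply: le_trans (nrm_mulmx _ _) _; rewrite exprS mulrCA ler_wpM2l ?nrm_ge0.
Qed.

Lemma mxpowZ t A k : mxpow (t *: A) k = t ^+ k *: mxpow A k.
Proof.
elim: k => [|k IH] /=; first by rewrite expr0 scale1r.
by rewrite IH -scalemxAl -scalemxAr scalerA exprS.
Qed.

Lemma mxpow_comm A k : mxpow A k *m A = A *m mxpow A k.
Proof.
elim: k => [|k IH] /=; first by rewrite mul1mx mulmx1.
by rewrite -mulmxA IH.
Qed.

Lemma fact_gt0 k : 0 < INR (Factorial.fact k).
Proof. exact/RltP/INR_fact_lt_0. Qed.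

(** It suffices that the terms be bounded at the radius [r = |x| + 1]; they are at most
    [|1| (|A| r)^k / k!], which tends to 0. *)
Lemma ecoef_radius A i j (x : R) :
  Coquelicot.Rbar.Rbar_lt (Coquelicot.Rbar.Finite (Rabs x)) (Coquelicot.PSeries.CV_radius (ecoef A i j)).
Proof.
set r : R := `|x| + 1.
have [l [_ Hl]] := @maj_by_pos _ (exist _ _ (cv_speed_pow_fact (nrm A * r))).
have [H _] := Coquelicot.PSeries.CV_radius_bounded (ecoef A i j).
apply: (Coquelicot.Rbar.Rbar_lt_le_trans _ (Coquelicot.Rbar.Finite r)).
  by apply/RltP; rewrite /r RealsE ltrDl.
apply: H; exists (nrm (1%:M : 'M[R]_n) * l) => k; apply/RleP.
have f0 := fact_gt0 k.
have fV0 : 0 <= (INR (Factorial.fact k))^-1 by rewrite invr_ge0 ltW.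
have {}Hl : (nrm A * r) ^+ k * (INR (Factorial.fact k))^-1 <= l.
  apply: le_trans (ler_norm _) _; have /RleP := Hl k.
  by rewrite -RabsE RdivE RpowE.
rewrite RpowE RabsE RmultE normrM /ecoef normrM normrX (ger0_norm (_ : 0 <= r)) ?addr_ge0 //.
rewrite (ger0_norm fV0).
apply: le_trans (_ : nrm (1%:M : 'M[R]_n) * ((nrm A * r) ^+ k * (INR (Factorial.fact k))^-1) <= _).
  rewrite exprMn mulrA [X in _ <= X * _]mulrA mulrAC ler_wpM2r // ler_wpM2r ?exprn_ge0 ?addr_ge0 //.
  exact: le_trans (entry_le_nrm _ _ _) (nrm_mxpow _ _).
by rewrite ler_wpM2l ?nrm_ge0.
Qed.

Lemma sum_f_R0_ord (u : nat -> R) N : sum_f_R0 u N = \sum_(k < N.+1) u k.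
Proof. by elim: N => [|N IH] /=; rewrite big_ord_recr /= ?big_ord0 ?add0r // IH. Qed.

Lemma pseries_cv (a : nat -> R) (x : R) :
  Coquelicot.Rbar.Rbar_lt (Coquelicot.Rbar.Finite (Rabs x)) (Coquelicot.PSeries.CV_radius a) ->
  Un_cv (fun N => \sum_(k < N.+1) a k * x ^+ k) (Coquelicot.PSeries.PSeries a x).
Proof.
move=> /Coquelicot.PSeries.CV_radius_inside/Coquelicot.PSeries.PSeries_correct.
move=> /Coquelicot.PSeries.is_pseries_R/Coquelicot.Series.is_series_Reals H.
apply: (@eq_cv (sum_f_R0 (fun k => a k * x ^+ k))) => [N|]; first by rewrite sum_f_R0_ord.
move=> e e0; have [N HN] := H e e0; exists N => k Hk; have := HN k Hk.
by rewrite (sum_eq _ (fun k => a k * x ^+ k)) // => l _; rewrite RpowE.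
Qed.

Lemma mexp_cv A : mcv (esum A) (mexp A).
Proof.
move=> i j; rewrite mxE.
apply: eq_cv (pseries_cv (ecoef_radius A i j 1)) => N.
rewrite /esum summxE; apply: eq_bigr => k _.
by rewrite expr1n mulr1 mxE mulrC.
Qed.

Lemma mexpZ_entry A t i j : mexp (t *: A) i j = Coquelicot.PSeries.PSeries (ecoef A i j) t.
Proof.
apply: (cv_uniq (mexp_cv (t *: A) i j)).
apply: eq_cv (pseries_cv (ecoef_radius A i j t)) => N.
rewrite /esum summxE; apply: eq_bigr => k _.
by rewrite mxpowZ !mxE /ecoef; ring.
Qed.

Lemma mexp_comm A : mexp A *m A = A *m mexp A.
Proof.
apply: mcv_uniq (mcvM (mexp_cv A) (mcv_cst A)) _.
apply: eq_mcv (mcvM (mcv_cst A) (mexp_cv A)) => k.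
rewrite /esum mulmx_suml mulmx_sumr; apply: eq_bigr => l _.
by rewrite -scalemxAl mxpow_comm scalemxAr.
Qed.

Lemma mder_mexp A t : mder (fun s => mexp (s *: A)) t (A *m mexp (t *: A)).
Proof.
move=> i j; have rad := ecoef_radius A i j t.
have /Coquelicot.Derive.is_derive_Reals H := Coquelicot.PSeries.is_derive_PSeries _ _ rad.
apply: eq_dpt H => [s|]; first by rewrite mexpZ_entry.
have rad' := rad; rewrite -Coquelicot.PSeries.CV_radius_derive in rad'.
apply: cv_uniq (pseries_cv rad') _.
apply: eq_cv ((mcvM (mcv_cst A) (mexp_cv (t *: A))) i j) => N.
rewrite /esum mulmx_sumr summxE; apply: eq_bigr => k _.
rewrite -scalemxAr mxpowZ -scalemxAr !mxE -[Coquelicot.PSeries.PS_derive _ _]/(INR k.+1 * ecoef A i j k.+1).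
rewrite /ecoef fact_simpl mult_INR RmultE invfM mulrA.
have k0 : INR k.+1 != 0 by rewrite INRE pnatr_eq0.
by rewrite /= !mxE; field; rewrite k0 gt_eqF // fact_gt0.
Qed.

Lemma mexp0 : mexp (0 : 'M[R]_n) = 1%:M.
Proof.
apply: mcv_uniq (mexp_cv 0) _; apply: eq_mcv (mcv_cst 1%:M) => N.
rewrite /esum big_ord_recl /= invr1 scale1r big1 ?addr0 // => i _.
by rewrite /= mul0mx scaler0.
Qed.

Lemma mexpZ_comm c A : mexp (c *: A) *m A = A *m mexp (c *: A).
Proof.
have [->|c0] := eqVneq c 0; first by rewrite scale0r mexp0 mul1mx mulmx1.
by apply: (scalerI c0); rewrite scalemxAr mexp_comm -scalemxAl.
Qed.

(* Differentiate [mexp ((1 - t) *: A) *m F t]. *)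
Lemma mexp_ode p A (F : R -> 'M[R]_(n, p)) :
  (forall t : R, 0 <= t <= 1 -> mder F t (A *m F t)) -> F 1 = mexp A *m F 0.
Proof.
move=> HF; have := @mder0_cst n p (fun t => mexp ((t * -1 + 1) *: A) *m F t) _.
rewrite mul1r addNr mul0r add0r scale0r mexp0 mul1mx scale1r; apply.
move=> t /HF Ht; have := mderM (mder_comp (dpt_affine (-1) 1 t) (mder_mexp A _)) Ht.
by apply: eq_mder => //; rewrite mulmxA mexpZ_comm scaleN1r mulNmx addNr.
Qed.

Lemma mexpD_scale s t A : mexp ((s + t) *: A) = mexp (s *: A) *m mexp (t *: A).
Proof.
have := @mexp_ode n (s *: A) (fun u => mexp ((u * s + t) *: A)).
rewrite mul1r mul0r add0r; apply=> u _.
apply: eq_mder (mder_comp (dpt_affine s t u) (mder_mexp A _)) => //.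
by rewrite scalemxAl.
Qed.

Lemma mexpNK A : mexp A *m mexp (- A) = 1%:M.
Proof.
by rewrite -scaleN1r -{1}(scale1r A) -mexpD_scale subrr scale0r mexp0.
Qed.

Lemma mexpKN A : mexp (- A) *m mexp A = 1%:M.
Proof. by rewrite -{2}(opprK A) mexpNK. Qed.

Lemma mexp_tr A : mexp A^T = (mexp A)^T.
Proof.
have := @mexp_ode n A^T (fun t => (mexp (t *: A))^T).
rewrite scale1r scale0r mexp0 trmx1 mulmx1 => -> // t _.
apply: eq_mder (mder_tr (mder_mexp A t)) => //; by rewrite -trmx_mul mexpZ_comm.
Qed.

Lemma mexp_conj P Q A : Q *m P = 1%:M -> mexp (P *m A *m Q) = P *m mexp A *m Q.
Proof.
move=> QP; have PQ := mulmx1C QP.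
have := @mexp_ode n (P *m A *m Q) (fun t => P *m mexp (t *: A) *m Q).
rewrite scale1r scale0r mexp0 mulmx1 PQ mulmx1 => -> // t _.
apply: eq_mder (mderMr Q (mderMl P (mder_mexp A t))) => //.
by rewrite !mulmxA -[P *m A *m Q *m P]mulmxA QP mulmx1.
Qed.

Lemma mexp_fix p A (x : 'M[R]_(n, p)) : A *m x = 0 -> mexp A *m x = x.
Proof.
move=> Ax; have := @mder0_cst n p (fun t => mexp (t *: A) *m x).
rewrite scale1r scale0r mexp0 mul1mx; apply=> t _.
by apply: eq_mder (mderMr x (mder_mexp A t)) => //; rewrite -mexpZ_comm -mulmxA Ax mulmx0.
Qed.

Lemma mexp_diag (d : 'rV[R]_n) : mexp (diag_mx d) = diag_mx (map_mx exp d).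
Proof.
have := @mexp_ode n (diag_mx d) (fun t => diag_mx (map_mx exp (t *: d))).
rewrite scale1r scale0r (_ : map_mx exp 0 = const_mx 1); last first.
  by apply/rowP => i; rewrite !mxE exp_0.
rewrite diag_const_mx mulmx1 => -> // t _ i j.
rewrite mul_diag_mx !mxE; case: eqP => [<-|/eqP/negbTE ij].
  apply: eq_dpt (dpt_comp (dpt_affine (d 0 i) 0 t) (derivable_pt_lim_exp _)) => [s|].
    by rewrite !mxE eqxx mulr1n addr0.
  by rewrite addr0 mulr1n mulrC.
by apply: eq_dpt (dpt_cst 0 t) => [s|]; rewrite ?mxE ?ij ?mulr0.
Qed.

(** Gronwall: [exp (- 2 c t) |exp (t A)|^2] does not increase when [c = |A|]. The factor is its
    value at 0, as the identity does not have Frobenius norm 1. *)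
Lemma nrm_mexp A : nrm (mexp A) <= nrm (1%:M : 'M[R]_n) * exp (nrm A).
Proof.
set c : R := nrm A; set e := fun t => mexp (t *: A).
rewrite -(ler_pXn2r (isT : (0 < 2)%nat)) ?nnegrE ?mulr_ge0 ?nrm_ge0 //; last exact/ltW/expR_gt0.
have := @mvt_le (fun t => exp (t * (- (2 * c)) + 0) * dotm (e t) (e t)) (fun t =>
  exp (t * (- (2 * c)) + 0) * - (2 * c) * dotm (e t) (e t) +
  exp (t * (- (2 * c)) + 0) * (dotm (A *m e t) (e t) + dotm (e t) (A *m e t))) 0 _ _.
rewrite /e mul0r mul1r scale1r scale0r mexp0 !addr0 exp_0 mul1r -!sqr_nrm.
have -> : exp (- (2 * c)) = (exp c ^+ 2)^-1.
  by rewrite expRN mulr2n mulrDl mul1r exp_add -expr2.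
have E0 := expR_gt0 c.
move=> H; rewrite exprMn mulrC -ler_pdivrMl ?exprn_gt0 // -subr_le0; apply: H => t _.
  apply: dptM (dpt_dotm (mder_mexp A t) (mder_mexp A t)).
  exact: dpt_comp (dpt_affine _ _ _) (derivable_pt_lim_exp _).
rewrite (dotmC (mexp _)) -mulrA -mulrDr pmulr_rle0; last exact: expR_gt0.
have := dotm_le (A *m mexp (t *: A)) (mexp (t *: A)).
have := nrm_mulmx A (mexp (t *: A)); have := nrm_ge0 (mexp (t *: A)).
rewrite -/c; set x := nrm (mexp _); set y := nrm (A *m _); set z := dotm _ _ => *.
by rewrite -sqr_nrm -/x; nra.
Qed.

End Exponential.

(* Duhamel: differentiate [mexp (t *: A) *m mexp ((1 - t) *: B)]. *)
Lemma mexp_lip n (A B : 'M[R]_n) (r : R) : nrm A <= r -> nrm B <= r ->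
  nrm (mexp A - mexp B) <= (nrm (1%:M : 'M[R]_n) * exp r) ^+ 2 * nrm (A - B).
Proof.
move=> Ar Br; set b : R := nrm (1%:M : 'M[R]_n) * exp r.
have bound (t : R) (C : 'M[R]_n) : 0 <= t <= 1 -> nrm C <= r -> nrm (mexp (t *: C)) <= b.
  move=> /andP[t0 t1] Cr; apply: le_trans (nrm_mexp _) _; rewrite ler_wpM2l ?nrm_ge0 //.
  apply: expR_le; rewrite nrmZ ger0_norm //.
  by apply: le_trans _ Cr; rewrite ler_piMl ?nrm_ge0.
have := @mvt_mx n n (fun t => mexp (t *: A) *m mexp ((t * -1 + 1) *: B))
  (fun t => mexp (t *: A) *m (A - B) *m mexp ((t * -1 + 1) *: B)) (b ^+ 2 * nrm (A - B)).
rewrite mul1r addNr mul0r add0r !scale1r !scale0r mexp0 mulmx1 mul1mx.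
apply=> t t01.
  apply: eq_mder (mderM (mder_mexp A t) (mder_comp (dpt_affine (-1) 1 t) (mder_mexp B _))) => //.
  rewrite scaleN1r mulmxN mulmxBr mulmxBl -mulmxA; congr (_ - _); last by rewrite mulmxA.
  by rewrite mulmxA mexpZ_comm.
have b0 : 0 <= b by rewrite mulr_ge0 ?nrm_ge0 //; exact/ltW/expR_gt0.
apply: le_trans (nrm_mulmx _ _) _.
have H1 := bound t A t01 Ar.
have H2 : nrm (mexp ((t * -1 + 1) *: B)) <= b.
  by apply: bound => //; case/andP: t01 => *; apply/andP; split; lra.
have H3 := nrm_mulmx (mexp (t *: A)) (A - B).
rewrite expr2 -mulrA mulrC.
apply: ler_pM; rewrite ?nrm_ge0 //; apply: le_trans H3 _.
by rewrite ler_wpM2r ?nrm_ge0.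
Qed.

Lemma mcv_mexp n (A : nat -> 'M[R]_n) L : mcv A L -> mcv (fun k => mexp (A k)) (mexp L).
Proof.
move=> H; have [r Hr] := @maj_by_pos _ (exist _ _ (cv_nrm H)).
case: Hr => r0 Hr; have {}Hr k : nrm (A k) <= r.
  by have /RleP := Hr k; rewrite RabsE; apply: le_trans; apply: ler_norm.
have Lr : nrm L <= r by apply: cv_le Hr (cv_nrm H) (cv_cst r).
apply/mcvP; apply: (@cv_squeeze0 _ (fun k => (nrm (1%:M : 'M[R]_n) * exp r) ^+ 2 * nrm (A k - L))).
  by move=> k; rewrite ger0_norm ?nrm_ge0 ?mexp_lip.
by rewrite -[0](mulr0 ((nrm (1%:M : 'M[R]_n) * exp r) ^+ 2)); apply: cvM (cv_cst _) _; apply/mcvP.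
Qed.

Opaque mexp.

(** * The spectral theorem *)

(** The direct method, with compactness of sublevel sets as a hypothesis on sequences: it is applied
    to vectors, to Lie algebra elements and to triples of factors. *)
Lemma inf_attained (T : Type) (S : T -> Prop) (f : T -> R) :
  (exists x, S x) -> (forall x, S x -> 0 <= f x) ->
  (forall (u : nat -> T) (M : R), (forall k, S (u k)) -> (forall k, f (u k) <= M) ->
    exists (phi : nat -> nat) x, [/\ forall k, (k <= phi k)%nat, S x &
      Un_cv (fun k => f (u (phi k))) (f x)]) ->
  exists2 x, S x & forall y, S y -> f x <= f y.
Proof.
move=> [x0 Sx0] f0 Hseq.
have [||m [ub lub]] := completeness (fun r => exists2 x, S x & r = - f x).
- by exists 0 => r [x Sx ->]; apply/RleP; rewrite oppr_le0 f0.
- by exists (- f x0), x0.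
have mle y : S y -> - m <= f y.
  by move=> Sy; rewrite lerNl; apply/RleP/ub; exists y.
have /(_ _)/constructive_indefinite_description u k :
    exists x, S x /\ f x <= - m + k.+1%:R^-1.
  apply: NNPP => H; have : m <= m - k.+1%:R^-1.
    apply/RleP/lub => r [x Sx ->]; apply/RleP.
    rewrite lerNl opprB addrC leNgt; apply/negP => /ltW fx; apply: H.
    by exists x.
  by rewrite lerBrDr gerDl leNgt invr_gt0 ltr0Sn.
have [k|k|phi [x [Hphi Sx fx]]] := Hseq (fun k => sval (u k)) (- m + 1).
- by case: (svalP (u k)).
- case: (svalP (u k)) => _ /le_trans; apply.
  by rewrite lerD2l invf_le1 ?ltr0Sn // ler1n.
exists x => // y /mle; apply: le_trans.
rewrite -[- m]addr0; apply: (cv_le _ fx (cvD (cv_cst (- m)) (cv_sub cv_inv_succ Hphi))) => k.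
by case: (svalP (u (phi k))).
Qed.

Section Orthogonal.
Variable n : nat.
Implicit Types A B Q X : 'M[R]_n.

Definition orth Q := Q^T *m Q = 1%:M.

Lemma orthC Q : orth Q -> Q *m Q^T = 1%:M.
Proof. exact: mulmx1C. Qed.

Lemma orth1 : orth 1%:M.
Proof. by rewrite /orth trmx1 mulmx1. Qed.

Lemma orth_tr Q : orth Q -> orth Q^T.
Proof. by move=> H; rewrite /orth trmxK orthC. Qed.

Lemma orthM Q B : orth Q -> orth B -> orth (Q *m B).
Proof. by move=> HQ HB; rewrite /orth trmx_mul -mulmxA (mulmxA Q^T) HQ mul1mx HB. Qed.

Lemma nrm_orthl m Q (A : 'M[R]_(n, m)) : orth Q -> nrm (Q *m A) = nrm A.
Proof. by move=> HQ; rewrite !nrmE dotm_mull mulmxA HQ mul1mx. Qed.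

Lemma nrm_orthr m Q (A : 'M[R]_(m, n)) : orth Q -> nrm (A *m Q) = nrm A.
Proof. by move=> HQ; rewrite -nrm_tr trmx_mul nrm_orthl ?nrm_tr //; apply: orth_tr. Qed.

Lemma nrm_orth Q : orth Q -> nrm Q = nrm (1%:M : 'M[R]_n).
Proof. by move=> HQ; rewrite -{1}(mulmx1 Q) nrm_orthl. Qed.

Lemma mcv_orth (Q : nat -> 'M[R]_n) L : (forall k, orth (Q k)) -> mcv Q L -> orth L.
Proof.
move=> HQ QL; apply: mcv_uniq (mcvM (mcv_tr QL) QL) _.
by apply: eq_mcv (mcv_cst _) => k; rewrite HQ.
Qed.

End Orthogonal.

(* At a maximizer [x] of the Rayleigh quotient, with value [l], the form of [l - A] is
   nonnegative and vanishes at [x], so [x] lies in its kernel. *)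
Lemma sym_eigenvector n (A : 'M[R]_n.+1) : A^T = A ->
  exists (x : 'cV[R]_n.+1) (l : R), nrm x = 1 /\ A *m x = l *: x.
Proof.
move=> AT.
have [||u M Hu _|x x1 xmax] := @inf_attained 'cV[R]_n.+1 (fun x => nrm x = 1)
  (fun x => nrm A - dotm (A *m x) x).
- exists (delta_mx 0 0); rewrite  nrmE dotmE (bigD1 0) //= big_ord1 mxE eqxx mulr1.
  by rewrite big1 ?addr0 ?sqrtr1 // => i /negbTE i0; rewrite big_ord1 !mxE i0 mulr0.
- move=> x x1; rewrite subr_ge0; apply: le_trans (dotm_le _ _) _.
  by rewrite x1 mulr1 (le_trans (nrm_mulmx _ _)) // x1 mulr1.
- have [k|phi [x [Hphi ux]]] := mcv_bw (A := u) (M := 1); first by rewrite Hu.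
  exists phi, x; split=> //.
    by apply: cv_uniq (cv_nrm ux) _; apply: eq_cv (cv_cst 1) => k; rewrite Hu.
  by apply: cvB (cv_cst _) (cv_dotm (mcvM (mcv_cst _) ux) ux).
set l : R := dotm (A *m x) x; exists x, l; split=> //.
have q0 (y : 'cV[R]_n.+1) : dotm (A *m y) y <= l * dotm y y.
  have [->|y0] := eqVneq y 0; first by rewrite dotm0r dotm0r mulr0.
  have ny := nrm_gt0 y0; have := xmax ((nrm y)^-1 *: y).
  rewrite nrmZ gtr0_norm ?invr_gt0 // mulVf ?gt_eqF // => /(_ erefl).
  rewrite lerD2l lerN2 -scalemxAr dotmZl dotmZr mulrA -invfM -expr2 sqr_nrm.
  by rewrite mulrC ler_pdivrMr // -sqr_nrm exprn_gt0.
have [z zE] : exists z, z = A *m x - l *: x by eexists.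
apply/subr0_eq/nrm_eq0; rewrite -zE.
apply/eqP; rewrite -sqrf_eq0 sqr_nrm; apply/eqP/le_anti; rewrite dotm_ge0 andbT.
rewrite leNgt; apply/negP => z0; set b : R := l * dotm z z - dotm (A *m z) z.
have b0 : 0 <= b by rewrite subr_ge0 q0.
have xx : dotm x x = 1 by rewrite -sqr_nrm x1 expr1n.
(* Comparing the two forms at [x + s z] leaves [2 s |z|^2 <= s^2 b]. This [s] satisfies
   [s b <= |z|^2], a contradiction; the [+ 1] covers [b = 0]. *)
set s : R := dotm z z / (b + 1).
have s0 : 0 < s by rewrite divr_gt0 // ltr_wpDl.
have := q0 (x + s *: z); rewrite mulmxDr -scalemxAr !dotmE_lin -/l xx.
have Axz : dotm (A *m x) z = dotm z z + l * dotm x z by rewrite -dotmZl -dotmDl zE subrK.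
rewrite [dotm (A *m z) x]dotm_mull AT (dotmC z (A *m x)) Axz -/b.
rewrite (dotmC z x) => H.
have Hs : s * (b + 1) = dotm z z by rewrite divfK // gt_eqF // ltr_wpDl.
have : 2 * s * dotm z z <= s * (s * b) by rewrite /b; lra.
rewrite [2 * s]mulrC -mulrA ler_pM2l //; nra.
Qed.

(** The reflection along [w = x - e] exchanges [e] and [x] because both have norm 1, which is the
    identity [<w, e> = - |w|^2 / 2]. When [w = 0] the identity matrix serves. *)
Lemma householder n (x : 'cV[R]_(1 + n)) : nrm x = 1 ->
  exists H : 'M[R]_(1 + n), [/\ H^T = H, orth H & H *m delta_mx 0 0 = x].
Proof.
move=> x1; set e : 'cV[R]_(1 + n) := delta_mx 0 0.
have [w wE] : exists w, w = x - e by eexists.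
have wT : w^T = x^T - e^T by rewrite wE linearB.
have e1 : e^T *m e = 1%:M by rewrite /e trmx_delta mul_delta_mx; apply/matrixP => i j; rewrite !ord1 !mxE.
have xx : x^T *m x = 1%:M.
  by apply/matrixP => i j; rewrite !ord1 -trace_mx11 mxtrace_mulC -/(dotm x x) -sqr_nrm x1 expr1n mxE.
have [w0|w0] := eqVneq w 0.
  by exists 1%:M; split; [exact: trmx1|exact: orth1|rewrite mul1mx -/e; apply/esym/subr0_eq; rewrite -wE].
set c : R := dotm w w.
have c0 : c != 0 by rewrite /c -sqr_nrm sqrf_eq0 gt_eqF ?nrm_gt0.
have wwc : w^T *m w = c%:M.
  by apply/matrixP => i j; rewrite !ord1 -trace_mx11 mxtrace_mulC mxE mulr1n.
have we : w^T *m e = (- (c / 2))%:M.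
  have xe : x^T *m e = (e^T *m x) by rewrite -[LHS]trmxK trmx_mul trmxK; apply/matrixP => i j; rewrite !ord1 mxE.
  have [y yE] : exists y, x^T *m e = y%:M by exists ((x^T *m e) 0 0); apply: mx11_scalar.
  have cE : c%:M = 2%:M - 2 *: (x^T *m e).
    rewrite -wwc wT wE mulmxBl !mulmxBr xx e1 -xe.
    by apply/matrixP => i j; rewrite !ord1 yE !mxE; ring.
  have {}cE : c = 2 - 2 * y by have /matrixP/(_ 0 0) := cE; rewrite yE !mxE !mulr1n.
  by rewrite wT mulmxBl e1 yE; apply/matrixP => i j; rewrite !ord1 !mxE cE !mulr1n; field.
set H : 'M[R]_(1 + n) := 1%:M - (2 / c) *: (w *m w^T).
have HT : H^T = H by rewrite /H linearB /= trmx1 linearZ /= trmx_mul trmxK.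
exists H; split=> //.
  rewrite /orth HT /H mulmxBl mul1mx mulmxBr mulmx1 -!scalemxAl -!scalemxAr -mulmxA (mulmxA w^T) wwc.
  rewrite mul_scalar_mx -scalemxAr !scalerA.
  by apply/matrixP => i j; rewrite !mxE; field.
rewrite /H mulmxBl mul1mx -scalemxAl -mulmxA we mul_mx_scalar scalerA.
rewrite (_ : 2 / c * - (c / 2) = -1); last by field.
by rewrite scaleN1r opprK wE addrC subrK.
Qed.

(** Deflation: conjugating by a reflection that sends the first basis vector to a unit eigenvector
    clears the first column off the diagonal, and by symmetry the first row. *)
Lemma spectral n (A : 'M[R]_n) : A^T = A ->
  exists (Q : 'M[R]_n) (d : 'rV[R]_n), orth Q /\ A = Q *m diag_mx d *m Q^T.
Proof.
elim: n A => [|n IH] A AT.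
  by exists 1%:M, 0; split; [exact: orth1|apply/matrixP => - []].
have [x [l [x1 Ax]]] := sym_eigenvector AT.
move: A AT x x1 Ax; rewrite -[n.+1]/(1 + n)%nat => A AT x x1 Ax.
have [H [HT HO Hx]] := @householder n x x1.
have HH : H *m H = 1%:M by rewrite -{1}HT.
have [B BHA] : exists B : 'M[R]_(1 + n), B = H *m A *m H by eexists.
have BT : B^T = B by rewrite BHA !trmx_mul HT AT mulmxA.
have Be : B *m delta_mx 0 0 = l *: delta_mx 0 0 :> 'cV[R]_(1 + n).
  by rewrite BHA -!mulmxA Hx Ax -scalemxAr -Hx mulmxA HH mul1mx.
have Bi i : B i 0 = if i == 0 then l else 0.
  have /matrixP/(_ i 0) := Be; rewrite -colE !mxE => ->.
  by case: eqP => _; rewrite ?mulr1 ?mulr0.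
have BE : B = block_mx l%:M 0 0 (drsubmx B).
  rewrite -{1}[B]submxK; congr block_mx; apply/matrixP => i j.
  - by rewrite !mxE !ord1 (_ : lshift n 0 = 0) ?Bi //; apply: val_inj.
  - by rewrite !mxE !ord1 (_ : lshift n 0 = 0) -1?BT 1?mxE ?Bi //; apply: val_inj.
  - by rewrite !mxE !ord1 (_ : lshift n 0 = 0) ?Bi //; apply: val_inj.
have [|Q [d [QO dE]]] := IH (drsubmx B).
  by rewrite -{2}BT trmx_drsub.
exists (H *m block_mx 1%:M 0 0 Q), (row_mx l%:M d); split.
  apply: orthM => //; rewrite /orth tr_block_mx mulmx_block !trmx0 !mul0mx !mulmx0 QO.
  by rewrite trmx1 mulmx1 !addr0 add0r -scalar_mx_block.
have -> : A = H *m B *m H by rewrite BHA !mulmxA HH mul1mx -mulmxA HH mulmx1.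
rewrite trmx_mul HT !mulmxA; congr (_ *m _); rewrite -!mulmxA; congr (_ *m _).
rewrite BE dE diag_mx_row tr_block_mx !mulmx_block.
rewrite !(trmx0, mul0mx, mulmx0, trmx1, mul1mx, mulmx1, addr0, add0r) mulmxA; congr block_mx.
by apply/matrixP => i j; rewrite !ord1 !mxE.
Qed.

(** * Cholesky factors *)

Definition lower_tri n (A : 'M[R]_n) := forall i j : 'I_n, (i < j)%nat -> A i j = 0.

Definition posdef n (A : 'M[R]_n) := forall x : 'cV[R]_n, x != 0 -> 0 < dotm (A *m x) x.

(** An explicit recursion on the Schur complement rather than an existence statement, so that the
    factor is a function of the matrix and can be differentiated along a curve. It is a Cholesky
    factor only at symmetric positive definite matrices. *)
Fixpoint chol n : 'M[R]_n -> 'M[R]_n :=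
  if n is n'.+1 then fun A : 'M[R]_(1 + n') =>
    let a := A 0 0 in let b := dlsubmx A in
    block_mx (Num.sqrt a)%:M 0 ((Num.sqrt a)^-1 *: b) (chol (drsubmx A - a^-1 *: (b *m b^T)))
  else fun A => A.

Lemma cholE n (A : 'M[R]_(1 + n)) : @chol n.+1 A =
  block_mx (Num.sqrt (A 0 0))%:M 0 ((Num.sqrt (A 0 0))^-1 *: dlsubmx A)
    (chol (drsubmx A - (A 0 0)^-1 *: (dlsubmx A *m (dlsubmx A)^T))).
Proof. by []. Qed.

Lemma lower_tri_block n (a : R) (b : 'cV[R]_n) (C : 'M[R]_n) :
  lower_tri C -> lower_tri (block_mx a%:M 0 b C : 'M_(1 + n)).
Proof.
move=> HC i j; case: (split_ordP i) => i' ->; case: (split_ordP j) => j' ->.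
- by rewrite !ord1.
- by rewrite block_mxEur mxE.
- by rewrite /= ord1 ltn0.
- by rewrite block_mxEdr /= ltn_add2l; apply: HC.
Qed.

Lemma chol_tri n (A : 'M[R]_n) : lower_tri (chol A).
Proof. elim: n A => [|n IH] A; [by case|rewrite cholE; exact/lower_tri_block]. Qed.

Lemma dotm_col m1 m2 p (A : 'M[R]_(m1, p)) (B : 'M[R]_(m2, p)) C D :
  dotm (col_mx A B) (col_mx C D) = dotm A C + dotm B D.
Proof. by rewrite /dotm tr_col_mx mul_col_row mxtrace_block. Qed.

Lemma sym_blockE n (A : 'M[R]_(1 + n)) : A^T = A ->
  A = block_mx (A 0 0)%:M (dlsubmx A)^T (dlsubmx A) (drsubmx A).
Proof.
move=> AT; rewrite -{1}[A]submxK; congr block_mx; last by rewrite trmx_dlsub AT.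
by apply/matrixP => i j; rewrite !ord1 !mxE (_ : lshift n 0 = 0) //; apply: val_inj.
Qed.

Lemma posdef_00 n (A : 'M[R]_(1 + n)) : A^T = A -> posdef A -> 0 < A 0 0.
Proof.
move=> AT Apos; have := Apos (col_mx 1%:M 0); rewrite {1}(sym_blockE AT) mul_block_col.
rewrite !mulmx0 !addr0 !mulmx1 dotm_col dotm0r addr0 /dotm trmx1 mulmx1 mxtrace_scalar mulr1n.
apply; apply/eqP => /(congr1 usubmx).
by rewrite col_mxKu linear0 => /matrixP/(_ 0 0)/eqP; rewrite !mxE oner_eq0.
Qed.

Definition schur n (A : 'M[R]_(1 + n)) : 'M[R]_n :=
  drsubmx A - (A 0 0)^-1 *: (dlsubmx A *m (dlsubmx A)^T).

Lemma schur_sym n (A : 'M[R]_(1 + n)) : A^T = A -> (schur A)^T = schur A.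
Proof.
by move=> AT; rewrite /schur linearB linearZ /= trmx_mul trmxK trmx_drsub AT.
Qed.

(** The form of the Schur complement at [y] is the form of [A] at the vector above [y] whose first
    coordinate minimizes it. *)
Lemma schur_posdef n (A : 'M[R]_(1 + n)) : A^T = A -> posdef A -> posdef (schur A).
Proof.
move=> AT Apos y y0; have a0 := posdef_00 AT Apos.
have := Apos (col_mx (- ((A 0 0)^-1 *: ((dlsubmx A)^T *m y))) y).
rewrite [X in dotm (X *m _)](sym_blockE AT) mul_block_col dotm_col.
rewrite mul_scalar_mx scalerN scalerA divff ?gt_eqF // scale1r addNr dotm0l add0r.
rewrite mulmxN addrC -scalemxAr mulmxA scalemxAl -mulmxBl; apply.
by apply: contraNneq y0 => /(congr1 dsubmx); rewrite col_mxKd linear0 => ->.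
Qed.

Lemma chol_spec n (A : 'M[R]_n) : A^T = A -> posdef A ->
  chol A *m (chol A)^T = A /\ forall i, 0 < chol A i i.
Proof.
elim: n A => [|n IH] A; first by move=> *; split=> [|[]//]; apply/matrixP => - [].
move: A; rewrite -[n.+1]/(1 + n)%nat => A AT Apos; rewrite cholE -/(schur A).
have [LS dS] := IH _ (schur_sym AT) (schur_posdef AT Apos).
have a0 := posdef_00 AT Apos.
have s0 : 0 < Num.sqrt (A 0 0) by rewrite sqrtr_gt0.
have ss : Num.sqrt (A 0 0) * Num.sqrt (A 0 0) = A 0 0 by rewrite -expr2 sqr_sqrtr // ltW.
split=> [|i].
  rewrite tr_block_mx mulmx_block !trmx0 !mulmx0 !mul0mx !addr0 [RHS](sym_blockE AT) tr_scalar_mx.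
  rewrite LS -scalar_mxM ss linearZ /= mul_scalar_mx mul_mx_scalar -scalemxAl -scalemxAr !scalerA.
  rewrite -invfM ss mulfV ?gt_eqF // !scale1r /schur.
  by congr block_mx; rewrite addrC subrK.
by case: (split_ordP i) => i' ->; rewrite ?block_mxEul ?block_mxEdr ?mxE ?eqxx ?ord1 ?mulr1n.
Qed.

Lemma lower_tri_inv n (L : 'M[R]_n) : lower_tri L -> (forall i, L i i != 0) ->
  exists M, [/\ lower_tri M, M *m L = 1%:M & L *m M = 1%:M].
Proof.
move=> HL Hd; suff [M [HM ML]] : exists M, lower_tri M /\ M *m L = 1%:M.
  by exists M; split=> //; apply: mulmx1C.
elim: n L HL Hd => [|n IH] L.
  by exists L; split=> //; apply/matrixP => - [].
move: L; rewrite -[n.+1]/(1 + n)%nat => L HL Hd.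
have lift0 : lshift n 0 = 0 :> 'I_(1 + n) by apply: val_inj.
have LE : L = block_mx (L 0 0)%:M 0 (dlsubmx L) (drsubmx L).
  rewrite -{1}[L]submxK; congr block_mx; apply/matrixP => i j; rewrite !ord1 !mxE lift0 //.
  by rewrite HL.
have [i j ij|i|M [HM ML]] := IH (drsubmx L).
- by rewrite !mxE HL //= ltn_add2l.
- by rewrite !mxE.
exists (block_mx (L 0 0)^-1%:M 0 (- ((L 0 0)^-1 *: (M *m dlsubmx L))) M); split.
  exact: lower_tri_block.
rewrite [X in _ *m X]LE mulmx_block !mul0mx !mulmx0 !addr0 add0r ML -scalar_mxM mulVf //.
rewrite mul_mx_scalar scalerN scalerA mulfV // scale1r addNr.
by rewrite [RHS]scalar_mx_block.
Qed.

Lemma lower_tri_mul_diag n (A B : 'M[R]_n) i : lower_tri A -> lower_tri B ->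
  (A *m B) i i = A i i * B i i.
Proof.
move=> HA HB; rewrite mxE (bigD1 i) //= big1 ?addr0 // => j ji.
by case: (ltngtP i j) => [ij|ij|/val_inj ij]; rewrite ?(HA _ _ ij) ?(HB _ _ ij) ?mul0r ?mulr0 ?ij ?eqxx // in ji *.
Qed.

Lemma dpt_sqrt f t (a : R) : derivable_pt_lim f t a -> 0 < f t ->
  exists b, derivable_pt_lim (fun s => Num.sqrt (f s)) t b.
Proof.
move=> Hf /RltP f0; eexists.
apply: eq_dpt (dpt_comp Hf (derivable_pt_lim_sqrt _ f0)) => [s|]; [by rewrite RsqrtE|by []].
Qed.

Lemma dpt_inv f t (a : R) : derivable_pt_lim f t a -> f t != 0 ->
  exists b, derivable_pt_lim (fun s => (f s)^-1) t b.
Proof.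
move=> Hf /eqP f0; have H := derivable_pt_lim_div _ _ _ _ _ (dpt_cst 1 t) Hf f0.
eexists; apply: eq_dpt H => [s|]; last by [].
by rewrite -[LHS]/(Rdiv 1 (f s)) RdivE div1r.
Qed.

Lemma mder_block m1 m2 n1 n2 (A : R -> 'M[R]_(m1, n1)) (B : R -> 'M[R]_(m1, n2))
    (C : R -> 'M[R]_(m2, n1)) (D : R -> 'M[R]_(m2, n2)) t A' B' C' D' :
  mder A t A' -> mder B t B' -> mder C t C' -> mder D t D' ->
  mder (fun s => block_mx (A s) (B s) (C s) (D s)) t (block_mx A' B' C' D').
Proof.
move=> HA HB HC HD i j; case: (split_ordP i) => i' ->; case: (split_ordP j) => j' ->.
- by apply: eq_dpt (HA i' j') => [s|]; rewrite block_mxEul.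
- by apply: eq_dpt (HB i' j') => [s|]; rewrite block_mxEur.
- by apply: eq_dpt (HC i' j') => [s|]; rewrite block_mxEdl.
- by apply: eq_dpt (HD i' j') => [s|]; rewrite block_mxEdr.
Qed.

(** The existence of a derivative is enough: what has to be known about it follows later from
    differentiating [F = L L^T]. *)
Lemma chol_mder n (F : R -> 'M[R]_n) t D : mder F t D -> (F t)^T = F t -> posdef (F t) ->
  exists D', mder (fun s => chol (F s)) t D'.
Proof.
elim: n F D => [|n IH] F D; first by move=> *; exists D.
move: F D; rewrite -[n.+1]/(1 + n)%nat => F D HF FT Fpos.
have [u Hu] := dpt_sqrt (HF 0 0) (posdef_00 FT Fpos).
have a0 : F t 0 0 != 0 by rewrite gt_eqF // posdef_00.
have [w Hw] := dpt_inv (HF 0 0) a0.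
have s0 : Num.sqrt (F t 0 0) != 0 by rewrite gt_eqF // sqrtr_gt0 posdef_00.
have [r Hr] := dpt_inv Hu s0.
have Hb : mder (fun s => dlsubmx (F s)) t (dlsubmx D).
  by move=> i j; apply: eq_dpt (HF _ _) => [s|]; rewrite !mxE.
have Hc : mder (fun s => drsubmx (F s)) t (drsubmx D).
  by move=> i j; apply: eq_dpt (HF _ _) => [s|]; rewrite !mxE.
have [E HE] := IH _ _ (mderD Hc (mderN (mderZ Hw (mderM Hb (mder_tr Hb)))))
  (schur_sym FT) (schur_posdef FT Fpos).
have Hs : mder (fun s => (Num.sqrt (F s 0 0))%:M : 'M_1) t u%:M.
  by move=> i j; rewrite !ord1 mxE; apply: eq_dpt Hu => // s; rewrite !mxE.
eexists; exact: mder_block Hs (mder_cst 0 t) (mderZ Hr Hb) HE.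
Qed.

(** * Polar decomposition and calibration *)

Section SymmetricExp.
Variable n : nat.
Implicit Types A Q X : 'M[R]_n.

Lemma mexp_spectral Q (d : 'rV[R]_n) : orth Q ->
  mexp (Q *m diag_mx d *m Q^T) = Q *m diag_mx (map_mx exp d) *m Q^T.
Proof. by move=> HQ; rewrite mexp_conj ?mexp_diag. Qed.

Lemma nrm_spectral Q A : orth Q -> nrm (Q *m A *m Q^T) = nrm A.
Proof. by move=> HQ; rewrite nrm_orthr ?nrm_orthl //; apply: orth_tr. Qed.

Lemma sqr_nrm_diag (d : 'rV[R]_n) : nrm (diag_mx d) ^+ 2 = \sum_i d 0 i ^+ 2.
Proof.
rewrite sqr_nrm dotmE; apply: eq_bigr => i _.
rewrite (bigD1 i) //= big1 ?addr0 => [|j /negbTE ji]; first by rewrite !mxE eqxx mulr1n.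
by rewrite !mxE eq_sym ji mulr0.
Qed.

Lemma mexp_sym X : X^T = X -> (mexp X)^T = mexp X.
Proof. by move=> XT; rewrite -mexp_tr XT. Qed.

Lemma mexp_unit X : mexp X \in unitmx.
Proof. by have [] := mulmx1_unit (mexpNK X). Qed.

(** Coercivity for the compactness arguments: bounds on [exp X] and [exp (- X)] together bound a
    symmetric [X]. On eigenvalues it follows from [1 + x <= exp x] at [x] and [- x]. *)
Lemma sqr_nrm_le_mexp X : X^T = X -> nrm X ^+ 2 <= nrm (mexp X) ^+ 2 + nrm (mexp (- X)) ^+ 2.
Proof.
move=> /spectral[Q [d [HQ XE]]].
have NXE : - X = Q *m diag_mx (- d) *m Q^T by rewrite XE linearN /= mulmxN mulNmx.
rewrite NXE XE !mexp_spectral // !nrm_spectral // !sqr_nrm_diag -big_split; apply: ler_sum => i _.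
rewrite !mxE expRN; have := expR_ge1Dx (d 0 i); have := expR_ge1Dx (- d 0 i).
rewrite expRN; set x : R := d 0 i; set y : R := exp x; set z : R := y^-1 => H1 H2.
have y0 : 0 < y by apply: expR_gt0.
have z0 : 0 < z by rewrite invr_gt0.
rewrite /=; case: (lerP 0 x) => ?; [have : x ^+ 2 <= y ^+ 2 by nra|have : x ^+ 2 <= z ^+ 2 by nra]; nra.
Qed.

Lemma polar_GL (g : 'M[R]_n) : g \in unitmx ->
  exists u W, [/\ orth u, W^T = W & g = u *m mexp W].
Proof.
move=> gU; have [|Q [c [HQ gE]]] := @spectral n (g^T *m g); first by rewrite trmx_mul trmxK.
(* The eigenvalue is the squared norm of the image under [g] of the corresponding column of [Q]. *)
have c0 i : 0 < c 0 i.
  have E : (g *m Q)^T *m (g *m Q) = diag_mx c.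
    by rewrite trmx_mul -mulmxA (mulmxA g^T) gE !mulmxA HQ mul1mx -mulmxA HQ mulmx1.
  have -> : c 0 i = dotm (g *m col i Q) (g *m col i Q).
    have /matrixP/(_ i i) := E; rewrite [in RHS]mxE eqxx mulr1n => <-.
    rewrite -dotm_tr /dotm trmxK mxE /mxtrace big_ord1 mxE; apply: eq_bigr => j _.
    have -> : g *m col i Q = col i (g *m Q) by rewrite !colE mulmxA.
    by rewrite !mxE.
  rewrite -sqr_nrm exprn_gt0 // nrm_gt0 //; apply/eqP => g0.
  have : Q^T *m (invmx g *m (g *m col i Q)) = delta_mx i 0.
    by rewrite (mulmxA (invmx g)) mulVmx // mul1mx colE mulmxA HQ mul1mx.
  rewrite g0 !mulmx0 => /matrixP/(_ i 0)/eqP.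
  by rewrite !mxE !eqxx eq_sym oner_eq0.
set W := Q *m diag_mx (map_mx (fun x => ln x / 2) c) *m Q^T.
have WT : W^T = W by rewrite /W !trmx_mul trmxK tr_diag_mx mulmxA.
have WW : mexp W *m mexp W = g^T *m g.
  rewrite /W mexp_spectral // gE -!mulmxA; congr (_ *m _); rewrite !mulmxA; congr (_ *m _).
  rewrite -[X in X *m diag_mx _]mulmxA HQ mulmx1 mulmx_diag; congr diag_mx; apply/rowP => i.
  rewrite !mxE -exp_add (_ : ln _ / 2 + ln _ / 2 = ln (c 0 i)); last by field.
  exact/exp_ln/RltP.
exists (g *m mexp (- W)), W; split=> //; last by rewrite -mulmxA mexpKN mulmx1.
have NT : (mexp (- W))^T = mexp (- W) by rewrite mexp_sym // linearN /= WT.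
rewrite /orth trmx_mul NT -mulmxA (mulmxA g^T) -WW -mulmxA mexpNK mulmx1.
by rewrite mexpKN.
Qed.

End SymmetricExp.

Lemma dotm_diag n (d : 'rV[R]_n) A : dotm (diag_mx d) A = \sum_i d 0 i * A i i.
Proof.
rewrite dotmE; apply: eq_bigr => i _; rewrite (bigD1 i) //= big1 ?addr0 => [|j /negbTE ji].
  by rewrite mxE eqxx mulr1n.
by rewrite mxE eq_sym ji mul0r.
Qed.

(** With [M] the inverse of the factor [L], [L = diag(e) M^T], and a triangular inverse has diagonal
    entries [1 / L_ii]; hence [L_ii = e_i / L_ii]. *)
Lemma chol_diag n (e : 'rV[R]_n) i : posdef (diag_mx e) -> chol (diag_mx e) i i ^+ 2 = e 0 i.
Proof.
move=> epos; have [LL Lpos] := chol_spec (tr_diag_mx e) epos; set L := chol _ in LL Lpos *.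
have [|M [HM ML LM]] := lower_tri_inv (chol_tri (diag_mx e)) _.
  by move=> j; rewrite gt_eqF ?Lpos.
have : L = diag_mx e *m M^T by rewrite -LL -mulmxA -trmx_mul ML trmx1 mulmx1.
move/matrixP/(_ i i); rewrite mul_diag_mx !mxE => Lii.
have /matrixP/(_ i i) := ML; rewrite lower_tri_mul_diag //; last exact: chol_tri.
by rewrite mxE eqxx mulr1n => MLii; rewrite expr2 {1}Lii -mulrA MLii mulr1.
Qed.

(* Two-sided derivatives of functions agreeing on [0, 1] agree even at the endpoints. *)
Lemma dpt_uniq01 (f g : R -> R) (a b t : R) : (forall s : R, 0 <= s <= 1 -> f s = g s) ->
  0 <= t <= 1 -> derivable_pt_lim f t a -> derivable_pt_lim g t b -> a = b.
Proof.
move=> fg t01 Hf Hg; have Hh := dptD Hf (dptN Hg).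
apply/subr0_eq/eqP; apply: contraT => c0; rewrite -normr_gt0 in c0.
have [del Hdl] := Hh _ (elimT RltP c0); set dl : R := pos del in Hdl.
have dl0 : 0 < dl by apply/RltP/cond_pos.
(* An increment that points into [0, 1], rightwards from the left half and leftwards from the right
   half. There the difference quotient of [f - g] is 0, too far from a nonzero derivative. *)
set s : R := Num.min (dl / 2) (1 / 2) * (if t <= 1 / 2 then 1 else -1).
have m0 : 0 < Num.min (dl / 2) (1 / 2) by rewrite lt_min !divr_gt0.
have m1 : Num.min (dl / 2) (1 / 2) <= 1 / 2 by rewrite ge_min lexx orbT.
have s0 : s != 0 by rewrite mulf_neq0 ?(gt_eqF m0) //; case: ifP => _; rewrite ?oppr_eq0 oner_eq0.
have sdl : `|s| < dl.
  rewrite normrM (gtr0_norm m0); apply: (@le_lt_trans _ _ (dl / 2)); last by lra.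
  by case: ifP; rewrite ?normrN normr1 mulr1 ge_min lexx.
have st01 : 0 <= t + s <= 1.
  rewrite /s; move: m0 m1; move: (Num.min _ _) => m m0 m1.
  by case/andP: t01 => ? ?; case: ifPn; rewrite -?ltNge => ?; apply/andP; split; lra.
have := Hdl s (elimN eqP s0); rewrite RabsE => /(_ (elimT RltP sdl))/RltP.
rewrite !RealsE fg // fg // !subrr mul0r sub0r normrN.
by rewrite ltxx.
Qed.

Lemma mder_uniq01 m n (F G : R -> 'M[R]_(m, n)) (t : R) D E :
  (forall s : R, 0 <= s <= 1 -> F s = G s) -> 0 <= t <= 1 -> mder F t D -> mder G t E -> D = E.
Proof.
move=> FG t01 HD HE; apply/matrixP => i j.
by apply: dpt_uniq01 t01 (HD i j) (HE i j) => s /FG ->.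
Qed.

Section Calibration.
Variables (n : nat) (gam gam' eta : R -> 'M[R]_n) (k X : 'M[R]_n).
Hypotheses (Hgam : forall t, mder gam t (gam' t)).
Hypothesis gamU : forall t : R, 0 <= t <= 1 -> gam t \in unitmx.
Hypothesis Heta : forall t : R, 0 <= t <= 1 -> eta t *m gam t = gam' t.
Hypotheses (kO : orth k) (XT : X^T = X) (gam0 : gam 0 = k *m mexp X) (gam1 : gam 1 = 1%:M).

(* With [X = Q diag(d) Q^T] and [L t] the Cholesky factor of [Q^T (gam t)^T (gam t) Q], the
   potential is [- sum_i d_i ln (L t)_ii]; it is invariant under left multiplication of [gam]
   by orthogonal matrices and its derivative at [gam] is [- <W diag(d) W^T, eta>] for an
   orthogonal [W]. *)
Lemma calibration : exists F F' : R -> R,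
  F 1 - F 0 = nrm X ^+ 2 /\
  forall t : R, 0 <= t <= 1 -> derivable_pt_lim F t (F' t) /\ F' t <= nrm X * nrm (eta t).
Proof.
have [Q [d [HQ XE]]] := spectral XT.
pose p t := (gam t *m Q)^T *m (gam t *m Q).
have pT t : (p t)^T = p t by rewrite /p trmx_mul trmxK.
have ppos (t : R) : 0 <= t <= 1 -> posdef (p t).
  move=> t01 x x0; rewrite /p -mulmxA dotm_mull trmxK -sqr_nrm exprn_gt0 // nrm_gt0 //.
  apply: contraNneq x0 => H; have : Q^T *m (invmx (gam t) *m (gam t *m Q *m x)) = x.
    by rewrite !mulmxA mulmxKV ?gamU // -mulmxA (mulmxA Q^T) HQ mul1mx.
  by rewrite H !mulmx0 => <-.
have dp t : mder p t ((gam' t *m Q)^T *m (gam t *m Q) + (gam t *m Q)^T *m (gam' t *m Q)).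
  by apply: mderM; [apply: mder_tr|]; apply: mderMr.
have /(_ _)/constructive_indefinite_description dL (t : R) :
    exists D, 0 <= t <= 1 -> mder (fun s => chol (p s)) t D.
  have [t01|] := boolP (0 <= t <= 1); last by exists 0.
  by have [D HD] := chol_mder (dp t) (pT t) (ppos t t01); exists D.
pose F t := - \sum_i d 0 i * ln (chol (p t) i i).
pose F' t := - \sum_i d 0 i * (sval (dL t) i i / chol (p t) i i).
exists F, F'; split.
  have p1 : p 1 = diag_mx (const_mx 1) by rewrite /p gam1 mul1mx HQ diag_const_mx.
  have p0 : p 0 = diag_mx (map_mx (fun x => exp x ^+ 2) d).
    rewrite /p gam0 XE mexp_spectral // -!mulmxA HQ mulmx1 trmx_mul -mulmxA (mulmxA k^T) kO mul1mx.
    rewrite trmx_mul tr_diag_mx -mulmxA (mulmxA Q^T) HQ mul1mx mulmx_diag.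
    by congr diag_mx; apply/rowP => i; rewrite !mxE.
  have pos1 : posdef (p 1) by apply: ppos; rewrite ler01 lexx.
  have pos0 : posdef (p 0) by apply: ppos; rewrite ler01 lexx.
  have L1 i : ln (chol (p 1) i i) = 0.
    have [_ /(_ i) l0] := chol_spec (pT 1) pos1.
    have := @chol_diag n (const_mx 1) i; rewrite -p1 => /(_ pos1)/eqP.
    by rewrite mxE sqrf_eq1 => /orP[/eqP->|/eqP l1]; [exact: ln_1|move: l0; rewrite l1 ltr0N1].
  have L0 i : ln (chol (p 0) i i) = d 0 i.
    have [_ /(_ i) l0] := chol_spec (pT 0) pos0.
    have := @chol_diag n (map_mx (fun x => exp x ^+ 2) d) i; rewrite -p0 => /(_ pos0)/eqP.
    rewrite mxE eqrXn2 // ?ltW ?expR_gt0 // => /eqP ->; exact: ln_exp.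
  rewrite /F XE nrm_spectral // sqr_nrm_diag; under eq_bigr do rewrite L1 mulr0.
  by rewrite big1 // oppr0 add0r opprK; apply: eq_bigr => i _; rewrite L0 expr2.
move=> t t01; have [Lt Lpos] := chol_spec (pT t) (ppos t t01).
have HD := svalP (dL t) t01; rewrite /F'; set D := sval (dL t) in HD *.
split.
  apply: dptN; apply: dpt_sum => i _.
  apply: eq_dpt (dptM (dpt_cst (d 0 i) t) (dpt_comp (HD i i) (derivable_pt_lim_ln _ _))) => //.
    by rewrite mul0r add0r [/ _ * _]mulrC.
  exact/RltP/Lpos.
set L := chol (p t) in Lt Lpos *.
have Dtri : lower_tri D.
  move=> i j ij; apply: uniqueness_limite (HD i j) _.
  by apply: eq_dpt (dpt_cst 0 t) => // s; rewrite chol_tri.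
have [|M [HM ML LM]] := lower_tri_inv (chol_tri (p t)) _; first by move=> j; rewrite gt_eqF ?Lpos.
have Mii i : M i i = (L i i)^-1.
  have /matrixP/(_ i i) := ML; rewrite lower_tri_mul_diag //; last exact: chol_tri.
  by rewrite mxE eqxx mulr1n => /(canRL (mulfK _)) ->; rewrite ?mul1r // gt_eqF ?Lpos.
(* [A = W L^T] is a QR factorization. In the orthogonal frame [W], the logarithmic derivative
   [D_ii / L_ii] is the diagonal entry of [W^T eta W]: [M D] is lower triangular, and its
   symmetrization is that of [W^T eta W]. *)
set A := gam t *m Q; set W := A *m M^T.
have pE : (eta t *m A)^T *m A + A^T *m (eta t *m A) = D *m L^T + L *m D^T.
  have -> : eta t *m A = gam' t *m Q by rewrite mulmxA Heta.
  (* [gam] is known to be invertible only on [0, 1], so [p = L L^T] holds only there, while the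
     derivatives are two-sided. *)
  apply: mder_uniq01 t01 (dp t) (mderM HD (mder_tr HD)) => s s01.
  by have [-> _] := chol_spec (pT s) (ppos s s01).
have WO : orth W.
  rewrite /orth /W trmx_mul trmxK -mulmxA (mulmxA A^T) -/(p t) -Lt.
  by rewrite -mulmxA -trmx_mul ML trmx1 mulmx1.
have NE : M *m D + (M *m D)^T = (eta t *m W)^T *m W + W^T *m (eta t *m W).
  have := congr1 (fun Z => M *m Z *m M^T) pE; rewrite !mulmxDr !mulmxDl.
  rewrite (_ : M *m (D *m L^T) *m M^T = M *m D); last first.
    by rewrite -!mulmxA -trmx_mul ML trmx1 mulmx1.
  rewrite (_ : M *m (L *m D^T) *m M^T = (M *m D)^T); last first.
    by rewrite (mulmxA M) ML mul1mx trmx_mul.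
  by move=> <-; rewrite /W !trmx_mul trmxK !mulmxA.
have dE : \sum_i d 0 i * (D i i / L i i) = dotm (diag_mx d) (M *m D).
  rewrite dotm_diag; apply: eq_bigr => i _; rewrite lower_tri_mul_diag // Mii.
  by rewrite [D i i * _]mulrC.
have SE : dotm (diag_mx d) (M *m D) = dotm (W *m diag_mx d *m W^T) (eta t).
  have E1 : dotm (diag_mx d) (M *m D)^T = dotm (diag_mx d) (M *m D).
    by rewrite -dotm_tr trmxK tr_diag_mx.
  have E2 : dotm (diag_mx d) (W^T *m (eta t *m W)) = dotm (W *m diag_mx d *m W^T) (eta t).
    by rewrite dotm_mulr trmxK dotm_mull mulmxA.
  have E3 : dotm (diag_mx d) ((eta t *m W)^T *m W) = dotm (W *m diag_mx d *m W^T) (eta t).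
    by rewrite -E2 -dotm_tr tr_diag_mx trmx_mul trmxK.
  have := congr1 (dotm (diag_mx d)) NE; rewrite !dotmDr E1 E2 E3; lra.
rewrite dE SE -dotmNl; apply: le_trans (dotm_le _ _) _.
by rewrite nrmN nrm_spectral // XE nrm_spectral.
Qed.

(** The form for explicit curves, where a uniform bound on the speed replaces the length and the
    mean value theorem replaces integration. *)
Lemma calibration_const (c : R) : (forall t : R, 0 <= t <= 1 -> nrm (eta t) <= c) -> nrm X <= c.
Proof.
move=> Hc; have [F [F' [FX HF]]] := calibration.
have [X0|X0] := eqVneq X 0.
  by rewrite X0 nrm0; apply: le_trans (Hc 0 _); rewrite ?nrm_ge0 // lexx ler01.
rewrite -(ler_pM2l (nrm_gt0 X0)) -expr2 -FX; apply: (@mvt_le F F') => t t01.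
  exact: (HF t t01).1.
by apply: le_trans (HF t t01).2 _; rewrite ler_wpM2l ?nrm_ge0 ?Hc.
Qed.

End Calibration.

(** * The Lie algebra of a closed group *)

(** Near 0 the difference of exponentials is the difference of the arguments up to a small relative
    error, which gives local injectivity of [exp] and first order expansions at once. The
    interpolation is [exp (t A) exp ((1 - t) B) - t (A - B)]. *)
Lemma mexp_near n (r : R) : 0 <= r -> exists2 K, 0 < K & forall A B : 'M[R]_n,
  nrm A <= r -> nrm B <= r ->
  nrm (mexp A - mexp B - (A - B)) <= K * (nrm A + nrm B) * nrm (A - B).
Proof.
move=> r0; set b : R := nrm (1%:M : 'M[R]_n) * exp r.
have b0 : 0 <= b by rewrite mulr_ge0 ?nrm_ge0 ?ltW ?expR_gt0.
(* The two parts of the derivative cost [b^2 |A| b] and [b^2 |B|], each times [|A - B|]; the final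
   [+ 1] makes the constant positive. *)
exists (b ^+ 2 * (b + 1) + 1) => [|A B Ar Br].
  by rewrite ltr_wpDl // mulr_ge0 ?exprn_ge0 ?addr_ge0.
have scale_le (t : R) (C : 'M[R]_n) : 0 <= t <= 1 -> nrm (t *: C) <= nrm C.
  by move=> /andP[t0 t1]; rewrite nrmZ ger0_norm // ler_piMl ?nrm_ge0.
have bound (C : 'M[R]_n) : nrm C <= r -> nrm (mexp C) <= b.
  move=> Cr; apply: le_trans (nrm_mexp _) _; rewrite ler_wpM2l ?nrm_ge0 //; exact: expR_le.
have bound1 (C : 'M[R]_n) : nrm C <= r -> nrm (mexp C - 1%:M) <= b ^+ 2 * nrm C.
  move=> Cr; have := @mexp_lip n C 0 r Cr; rewrite nrm0 subr0 mexp0; exact.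
have H0 (t : R) : 0 <= t <= 1 -> 0 <= t * -1 + 1 <= 1.
  by case/andP=> *; apply/andP; split; lra.
have := @mvt_mx n n (fun t => mexp (t *: A) *m mexp ((t * -1 + 1) *: B) - t *: (A - B))
  (fun t => mexp (t *: A) *m (A - B) *m mexp ((t * -1 + 1) *: B) - (A - B))
  ((b ^+ 2 * (b + 1) + 1) * (nrm A + nrm B) * nrm (A - B)).
rewrite mul1r addNr mul0r add0r !scale1r !scale0r mexp0 mulmx1 mul1mx subr0.
rewrite addrAC; apply=> t t01.
  apply: mderD; last apply: mderN.
    apply: eq_mder (mderM (mder_mexp A t) (mder_comp (dpt_affine (-1) 1 t) (mder_mexp B _))) => //.
    by rewrite scaleN1r mulmxN mulmxBr mulmxBl -mulmxA mulmxA mexpZ_comm -!mulmxA.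
  apply: eq_mder (mderZ (dpt_affine 1 0 t) (mder_cst (A - B) t)) => [s|].
    by rewrite mulr1 addr0.
  by rewrite scaler0 addr0 scale1r.
set P := mexp _; set Q := mexp _; move: (A - B) => C.
have -> : P *m C *m Q - C = (P - 1%:M) *m C *m Q + C *m (Q - 1%:M).
  by rewrite !mulmxBl mul1mx mulmxBr mulmx1 addrA subrK.
have HA := scale_le t A t01; have HB := scale_le _ B (H0 t t01).
have P1 : nrm (P - 1%:M) <= b ^+ 2 * nrm A.
  apply: le_trans (bound1 _ (le_trans HA Ar)) _; by rewrite ler_wpM2l ?exprn_ge0.
have Q1 : nrm (Q - 1%:M) <= b ^+ 2 * nrm B.
  apply: le_trans (bound1 _ (le_trans HB Br)) _; by rewrite ler_wpM2l ?exprn_ge0.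
have Q2 : nrm Q <= b by apply: bound; apply: le_trans HB Br.
apply: le_trans (ler_nrmD _ _) _.
apply: le_trans (lerD (nrm_mulmx _ _) (nrm_mulmx _ _)) _.
have PC := nrm_mulmx (P - 1%:M) C.
have c0 := nrm_ge0 C; have q0 := nrm_ge0 Q; have pc0 := nrm_ge0 ((P - 1%:M) *m C).
have a0 := nrm_ge0 A; have bb0 := nrm_ge0 B; have p0 := nrm_ge0 (P - 1%:M).
have H1 : nrm ((P - 1%:M) *m C) * nrm Q <= b ^+ 2 * nrm A * nrm C * b.
  apply: ler_pM => //; apply: le_trans PC _; exact: ler_wpM2r.
have H2 : nrm C * nrm (Q - 1%:M) <= nrm C * (b ^+ 2 * nrm B) by apply: ler_wpM2l.
apply: le_trans (lerD H1 H2) _.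
have b2 : 0 <= b ^+ 2 by rewrite exprn_ge0.
clear H1 H2; move: (b ^+ 2) b2 => d b2.
have X1 : 0 <= d * nrm A * nrm C by rewrite !mulr_ge0.
have X2 : 0 <= d * nrm B * nrm C * b by apply: mulr_ge0 => //; rewrite !mulr_ge0.
have X5 : 0 <= d * nrm A * nrm C * b by apply: mulr_ge0.
have X3 : 0 <= nrm A * nrm C by rewrite mulr_ge0.
have X4 : 0 <= nrm B * nrm C by rewrite mulr_ge0.
lra.
Qed.

Lemma mexp_quot n (N : 'M[R]_n) (e : nat -> R) : (forall k, 0 < e k) -> Un_cv e 0 ->
  mcv (fun k => (e k)^-1 *: (mexp (e k *: N) - 1%:M)) N.
Proof.
move=> e0 ecv; have [E [/RltP E0 HE]] := @maj_by_pos _ (exist _ _ ecv).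
have {}HE k : e k <= E by have /RleP := HE k; rewrite RabsE gtr0_norm.
have [K K0 HK] := @mexp_near n (E * nrm N) (mulr_ge0 (ltW E0) (nrm_ge0 N)).
apply/mcvP; apply: (@cv_squeeze0 _ (fun k => e k * (K * nrm N * nrm N))) => [k|].
  rewrite ger0_norm ?nrm_ge0 //.
  have := HK (e k *: N) 0; rewrite nrm0 nrmZ gtr0_norm // mexp0 addr0 subr0 => H.
  have -> : (e k)^-1 *: (mexp (e k *: N) - 1%:M) - N = (e k)^-1 *: (mexp (e k *: N) - 1%:M - e k *: N).
    by rewrite [RHS]scalerBr scalerA mulVf ?gt_eqF // scale1r.
  rewrite nrmZ gtr0_norm ?invr_gt0 // mulrC ler_pdivrMr //.
  apply: le_trans (H _ _) _; rewrite ?ler_wpM2r ?nrm_ge0 //.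
    by rewrite mulr_ge0 ?nrm_ge0 // ltW.
  by rewrite nrmZ gtr0_norm // le_eqVlt; apply/orP; left; apply/eqP; ring.
by rewrite -[0](mul0r (K * nrm N * nrm N)); apply: cvM ecv (cv_cst _).
Qed.

(** Telescoping. Multiplication by [A] is bounded through [A - 1] by the factor [1 + d <= exp d];
    powers of the Frobenius norm of [A] itself would blow up, since the identity has norm
    [sqrt n]. *)
Lemma mxpow_sub n (A B : 'M[R]_n) (d : R) m : nrm (A - 1%:M) <= d -> nrm (B - 1%:M) <= d ->
  nrm (mxpow A m - mxpow B m) <= m%:R * nrm (A - B) * exp (m%:R * d).
Proof.
move=> Ad Bd.
have d0 : 0 <= d by apply: le_trans (nrm_ge0 _) Ad.
have expd k : exp (k.+1%:R * d) = exp d * exp (k%:R * d).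
  by rewrite -exp_add -natr1 mulrDl mul1r addrC.
have mulA (Z : 'M[R]_n) : nrm (A *m Z) <= exp d * nrm Z.
  have -> : A *m Z = Z + (A - 1%:M) *m Z by rewrite mulmxBl mul1mx addrC subrK.
  apply: le_trans (ler_nrmD _ _) _; apply: le_trans (lerD (lexx _) (nrm_mulmx _ _)) _.
  have z0 := nrm_ge0 Z; have := expR_ge1Dx d; nra.
have mulB k (Z : 'M[R]_n) : nrm (Z *m mxpow B k) <= exp (k%:R * d) * nrm Z.
  elim: k Z => [|k IH] Z; first by rewrite mulmx1 mul0r exp_0 mul1r.
  rewrite /= mulmxA expd; apply: le_trans (IH _) _.
  rewrite [X in _ <= X]mulrAC [X in _ <= X]mulrC; apply: ler_wpM2l; first exact/ltW/expR_gt0.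
  have -> : Z *m B = Z + Z *m (B - 1%:M) by rewrite mulmxBr mulmx1 addrC subrK.
  apply: le_trans (ler_nrmD _ _) _; apply: le_trans (lerD (lexx _) (nrm_mulmx _ _)) _.
  have z0 := nrm_ge0 Z; have := expR_ge1Dx d; nra.
elim: m => [|m IH]; first by rewrite /= subrr nrm0 !mul0r.
have -> : mxpow A m.+1 - mxpow B m.+1 = A *m (mxpow A m - mxpow B m) + (A - B) *m mxpow B m.
  by rewrite /= mulmxBr mulmxBl addrA subrK.
apply: le_trans (ler_nrmD _ _) _; apply: le_trans (lerD (mulA _) (mulB _ _)) _.
rewrite expd; have e1 : 1 <= exp d by apply: le_trans (expR_ge1Dx d); rewrite lerDl.
have c0 := nrm_ge0 (A - B); have x0 := expR_gt0 (m%:R * d).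
have := ler_wpM2l (ltW (expR_gt0 d)) IH; rewrite -natr1; set x : R := exp (m%:R * d) in x0 *.
set y : R := exp d in e1 *; set c : R := nrm (A - B) in c0 * => H.
have : 0 <= (y - 1) * (x * c) by rewrite mulr_ge0 ?subr_ge0 // mulr_ge0 // ltW.
lra.
Qed.

Lemma mxpow_mexp n (A : 'M[R]_n) m : mxpow (mexp A) m = mexp (m%:R *: A).
Proof.
elim: m => [|m IH] /=; first by rewrite scale0r mexp0.
by rewrite IH -{1}(scale1r A) -mexpD_scale -natr1 addrC.
Qed.

(** Closedness is sequential, as the compactness arguments use it, and relative to GL(n): a limit
    counts only when it is invertible. *)
Record closed_group n (G : 'M[R]_n -> Prop) : Prop := ClosedGroup {
  cg_unit : forall g, G g -> g \in unitmx;
  cg_1 : G 1%:M;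
  cg_mul : forall g h, G g -> G h -> G (g *m h);
  cg_inv : forall g, G g -> G (invmx g);
  cg_lim : forall (u : nat -> 'M[R]_n) L, (forall k, G (u k)) -> mcv u L ->
    L \in unitmx -> G L }.

Section Lie.
Variables (n : nat) (G : 'M[R]_n -> Prop).
Hypothesis HG : closed_group G.

Let GU := cg_unit HG.
Let G1 := cg_1 HG.
Let GM := cg_mul HG.
Let GV := cg_inv HG.
Let Gcl := cg_lim HG.

Definition lie (X : 'M[R]_n) := forall t : R, G (mexp (t *: X)).

Lemma lie_exp X : lie X -> G (mexp X).
Proof. by move=> /(_ 1); rewrite scale1r. Qed.

Lemma lie0 : lie 0.
Proof. by move=> t; rewrite scaler0 mexp0. Qed.

Lemma lieZ a X : lie X -> lie (a *: X).
Proof. by move=> HX t; rewrite scalerA. Qed.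

Lemma lieN X : lie X -> lie (- X).
Proof. by rewrite -scaleN1r; apply: lieZ. Qed.

Lemma invmx_mexp (X : 'M[R]_n) : invmx (mexp X) = mexp (- X).
Proof. by rewrite -[LHS]mulmx1 -(mexpNK X) mulKmx // mexp_unit. Qed.

Lemma lie_lim (X : nat -> 'M[R]_n) L : (forall k, lie (X k)) -> mcv X L -> lie L.
Proof.
move=> HX XL t; apply: Gcl (fun k => HX k t) _ (mexp_unit _).
by apply: mcv_mexp; apply: mcvZ (cv_cst t) XL.
Qed.

Lemma G_mxpow g m : G g -> G (mxpow g m).
Proof. by move=> Gg; elim: m => //= m IH; apply: GM. Qed.

(** Take [m k] the integer part of [t / e k]. Since [u k] and [exp (e k N)] differ by [o(e k)],
    their powers of order [m k] have the same limit [exp (t N)]. Negative times follow by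
    inversion. *)
Lemma lie_tangent (u : nat -> 'M[R]_n) (e : nat -> R) (N : 'M[R]_n) :
  (forall k, G (u k)) -> (forall k, 0 < e k) -> Un_cv e 0 ->
  mcv (fun k => (e k)^-1 *: (u k - 1%:M)) N -> lie N.
Proof.
move=> Gu e0 ecv uN.
suff H (t : R) : 0 <= t -> G (mexp (t *: N)).
  move=> t; case: (lerP 0 t) => [/H//|t0].
  rewrite -[t]opprK scaleNr -invmx_mexp; apply/GV/H; lra.
move=> t0; pose m k := Num.truncn (t / e k).
have mle k : (m k)%:R * e k <= t.
  by rewrite -ler_pdivlMr // truncn_le ?divr_ge0 // ltW.
have mlt k : t - e k <= (m k)%:R * e k.
  have := truncnS_gt (t / e k); rewrite -/(m k) ltr_pdivrMr // -natr1 => ?; lra.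
pose v k := mexp (e k *: N).
have vN := @mexp_quot n N e e0 ecv.
have bdd (w : nat -> 'M[R]_n) L : mcv w L -> exists C, forall k, nrm (w k) <= C.
  move=> wL; have [C [_ HC]] := @maj_by_pos _ (exist _ _ (cv_nrm wL)).
  by exists C => k; have /RleP := HC k; rewrite RabsE ger0_norm ?nrm_ge0.
have [C1 HC1] := bdd _ _ uN; have [C2 HC2] := bdd _ _ vN.
set C := Num.max C1 C2.
have eZ k (Z : 'M[R]_n) : nrm Z = e k * nrm ((e k)^-1 *: Z).
  by rewrite nrmZ gtr0_norm ?invr_gt0 // mulrA mulfV ?mul1r ?gt_eqF.
have uC k : nrm (u k - 1%:M) <= e k * C.
  by rewrite (eZ k) ler_wpM2l ?(ltW (e0 k)) // (le_trans (HC1 k)) // le_max lexx.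
have vC k : nrm (v k - 1%:M) <= e k * C.
  by rewrite (eZ k) ler_wpM2l ?(ltW (e0 k)) // (le_trans (HC2 k)) // le_max lexx orbT.
have C0 : 0 <= C by have := le_trans (nrm_ge0 _) (uC 0%nat); rewrite pmulr_rge0.
have d0 : mcv (fun k => mxpow (u k) (m k) - mxpow (v k) (m k)) 0.
  apply/mcvP; apply: (@cv_squeeze0 _ (fun k => t * exp (t * C) *
      nrm ((e k)^-1 *: (u k - 1%:M) - (e k)^-1 *: (v k - 1%:M)))) => [k|].
    rewrite subr0 ger0_norm ?nrm_ge0 //; apply: le_trans (mxpow_sub _ (uC k) (vC k)) _.
    have -> : (e k)^-1 *: (u k - 1%:M) - (e k)^-1 *: (v k - 1%:M) = (e k)^-1 *: (u k - v k).
      by rewrite -scalerBr opprB addrA subrK.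
    rewrite (eZ k (u k - v k)); set x : R := nrm _.
    rewrite mulrA [X in _ <= X]mulrAC; apply: ler_pM.
    - by rewrite !mulr_ge0 ?ler0n ?nrm_ge0 // ltW.
    - exact/ltW/expR_gt0.
    - by rewrite ler_wpM2r ?nrm_ge0.
    - by apply: expR_le; rewrite mulrA ler_wpM2r.
  rewrite -[0](mulr0 (t * exp (t * C))); apply: cvM (cv_cst _) _.
  by have := cv_nrm (mcvB uN vN); rewrite subrr nrm0.
have vt : mcv (fun k => mxpow (v k) (m k)) (mexp (t *: N)).
  apply: (@eq_mcv _ _ (fun k => mexp (((m k)%:R * e k) *: N))).
    by move=> k; rewrite mxpow_mexp scalerA.
  apply: mcv_mexp; apply: mcvZ (mcv_cst _).
  have H : Un_cv (fun k => (m k)%:R * e k - t) 0.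
    apply: cv_squeeze0 ecv => k; rewrite ler_norml; apply/andP; split.
      by have := mlt k; lra.
    by have := mle k; have := e0 k; lra.
  by have := cvD H (cv_cst t); rewrite add0r; apply: eq_cv => k; rewrite subrK.
apply: Gcl (fun k => G_mxpow (m k) (Gu k)) _ (mexp_unit _).
by have := mcvD d0 vt; rewrite add0r; apply: eq_mcv => k; rewrite subrK.
Qed.

Lemma lieD X Y : lie X -> lie Y -> lie (X + Y).
Proof.
move=> HX HY; pose e k : R := k.+1%:R^-1.
have e0 k : 0 < e k by rewrite invr_gt0 ltr0Sn.
apply: (@lie_tangent (fun k => mexp (e k *: X) *m mexp (e k *: Y)) e) => //.
- by move=> k; apply: GM.
- exact: cv_inv_succ.
have HA := @mexp_quot n X e e0 cv_inv_succ; have HB := @mexp_quot n Y e e0 cv_inv_succ.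
have HE : mcv (fun k => mexp (e k *: Y)) 1%:M.
  by rewrite -mexp0 -(scale0r Y); apply: mcv_mexp; apply: mcvZ cv_inv_succ (mcv_cst _).
have := mcvD (mcvM HA HE) HB; rewrite mulmx1; apply: eq_mcv => k.
by rewrite -scalemxAl -scalerDr mulmxBl mul1mx addrA subrK.
Qed.

Lemma lieB X Y : lie X -> lie Y -> lie (X - Y).
Proof. by move=> HX HY; apply: lieD => //; apply: lieN. Qed.

(* The minimizer [X] of [|g - exp X|] in the Lie algebra makes the direction of
   [g exp (- X) - 1] tangent to [G] in the limit; moving [X] along that direction would
   decrease the distance. *)
Lemma near1_exp (r : R) : 0 < r -> exists2 e : R, 0 < e &
  forall g, G g -> nrm (g - 1%:M) < e -> exists2 Z, lie Z & nrm Z <= r /\ g = mexp Z.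
Proof.
move=> r0; have [K K0 HK] := @mexp_near n 1 ler01.
(* 1 is the radius for which [K] was chosen, and [K s <= 1/2] keeps the remainder of [exp X - 1]
   below [|X| / 2], whence [|X| <= 2 |exp X - 1|]. *)
set s : R := Num.min r (Num.min 1 (2 * K)^-1).
have s0 : 0 < s by rewrite !lt_min r0 ltr01 invr_gt0 mulr_gt0.
have sr : s <= r by rewrite ge_min lexx.
have s1 : s <= 1 by rewrite !ge_min lexx !orbT.
have sK : K * s <= 1 / 2.
  have : s <= (2 * K)^-1 by rewrite !ge_min lexx !orbT.
  move=> /(ler_wpM2l (ltW K0)) H; apply: le_trans H _.
  by rewrite le_eqVlt; apply/orP; left; apply/eqP; field; rewrite gt_eqF.
have low (X : 'M[R]_n) : nrm X <= s -> nrm X <= 2 * nrm (mexp X - 1%:M).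
  move=> Xs; have := HK X 0; rewrite nrm0 mexp0 subr0 addr0 => /(_ (le_trans Xs s1) ler01) H.
  have x0 := nrm_ge0 X.
  have H2 : nrm X - nrm (mexp X - 1%:M) <= nrm (mexp X - 1%:M - X).
    by rewrite -[leRHS]nrmN opprB ler_nrm_sub.
  have H3 : K * nrm X * nrm X <= 1 / 2 * nrm X.
    by rewrite ler_wpM2r // (le_trans _ sK) // ler_wpM2l // ltW.
  lra.
apply: NNPP => Hno.
(* Failure of the claim gives elements of [G] tending to 1 that are not such exponentials; each
   comes with a nearest exponential from the ball of radius [s] in the Lie algebra. *)
have /(_ _)/constructive_indefinite_description H k : exists gX : 'M[R]_n * 'M[R]_n,
    [/\ G gX.1, nrm (gX.1 - 1%:M) < k.+1%:R^-1, lie gX.2, nrm gX.2 <= s & gX.1 <> mexp gX.2] /\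
    forall Y, lie Y -> nrm Y <= s -> nrm (gX.1 - mexp gX.2) <= nrm (gX.1 - mexp Y).
  apply: NNPP => Hk; apply: Hno; exists (k.+1%:R^-1); first by rewrite invr_gt0 ltr0Sn.
  move=> g Gg g1.
  have [|//|u M Hu _|X [HX Xs] Xmin] := @inf_attained 'M[R]_n (fun X => lie X /\ nrm X <= s)
    (fun X => nrm (g - mexp X)); first by exists 0; rewrite nrm0 ltW //; split=> //; apply: lie0.
  - by move=> *; apply: nrm_ge0.
  - have [k'|phi [X [Hphi uX]]] := mcv_bw (A := u) (M := s); first by case: (Hu k').
    exists phi, X; split=> //; last exact: cv_nrm (mcvB (mcv_cst g) (mcv_mexp uX)).
    split; first by apply: lie_lim uX => k'; case: (Hu (phi k')).
    by apply: cv_le (cv_nrm uX) (cv_cst s) => k'; case: (Hu (phi k')).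
  exists X => //; split; first exact: le_trans Xs sr.
  apply: NNPP => gX; apply: Hk; exists (g, X); split=> // Y HY Ys; exact: Xmin.
pose g k := (sval (H k)).1; pose X k := (sval (H k)).2.
have HgX k : [/\ G (g k), nrm (g k - 1%:M) < k.+1%:R^-1, lie (X k), nrm (X k) <= s & g k <> mexp (X k)] /\
    forall Y, lie Y -> nrm Y <= s -> nrm (g k - mexp (X k)) <= nrm (g k - mexp Y).
  exact: (svalP (H k)).
have gmin k : nrm (g k - mexp (X k)) <= nrm (g k - 1%:M).
  by rewrite -mexp0; apply: (HgX k).2; [exact: lie0|rewrite nrm0 ltW].
have g0 : Un_cv (fun k => nrm (g k - 1%:M)) 0.
  apply: cv_squeeze0 cv_inv_succ => k; rewrite ger0_norm ?nrm_ge0 // ltW //.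
  by case: (HgX k) => [[]].
have X0 : mcv X 0.
  apply/mcvP; apply: (@cv_squeeze0 _ (fun k => 4 * nrm (g k - 1%:M))) => [k|]; last first.
    by rewrite -[0](mulr0 4); apply: cvM (cv_cst _) g0.
  rewrite subr0 ger0_norm ?nrm_ge0 //; case: (HgX k) => -[_ _ _ Xs _] _.
  apply: le_trans (low _ Xs) _.
  have : nrm (mexp (X k) - 1%:M) <= nrm (g k - 1%:M) + nrm (g k - mexp (X k)).
    apply: le_trans (ler_nrmB _ _).
    by rewrite opprB (addrC (g k - _)) addrA subrK.
  by have := gmin k; lra.
have eX0 : mcv (fun k => mexp (X k)) 1%:M by rewrite -mexp0; apply: mcv_mexp.
have eNX0 : mcv (fun k => mexp (- X k)) 1%:M.
  by rewrite -mexp0 -oppr0; apply: mcv_mexp; apply: mcvN.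
pose h k := g k *m mexp (- X k).
have Gh k : G (h k).
  by case: (HgX k) => -[Gg _ HX _ _] _; apply: GM => //; apply/lie_exp/lieN.
have h1 : mcv h 1%:M.
  by rewrite -(mul1mx 1%:M); apply: mcvM eNX0; apply/mcvP.
pose e k := nrm (h k - 1%:M).
have e0 k : 0 < e k.
  apply/nrm_gt0/eqP => /subr0_eq hk; case: (HgX k) => -[_ _ _ _ gX] _; apply: gX.
  by rewrite -[g k]mulmx1 -(mexpKN (X k)) mulmxA -/(h k) hk mul1mx.
have ecv : Un_cv e 0 by apply/mcvP.
pose N k := (e k)^-1 *: (h k - 1%:M).
have N1 k : nrm (N k) = 1.
  by rewrite nrmZ gtr0_norm ?invr_gt0 // mulVf // gt_eqF.
have [k|phi [M [Hphi NM]]] := mcv_bw (A := N) (M := 1); first by rewrite N1.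
have HM : lie M by apply: (lie_tangent (fun k => Gh (phi k)) (fun k => e0 (phi k)) _ NM); apply: cv_sub.
have M1 : nrm M = 1.
  by apply: cv_uniq (cv_nrm NM) _; apply: eq_cv (cv_cst 1) => k; rewrite N1.
have Xphi := mcv_sub X0 Hphi; have ephi := cv_sub ecv Hphi.
pose P k := N (phi k) *m mexp (X (phi k)).
have PM : mcv P M by rewrite -[M]mulmx1; apply: mcvM NM (mcv_sub eX0 Hphi).
pose Y k := X (phi k) + e (phi k) *: M.
have Y0 : mcv Y 0.
  by rewrite -[0]addr0 -[X in _ + X](scale0r M); apply: mcvD Xphi (mcvZ ephi (mcv_cst M)).
(* Minimality of [X] tested at [Y = X + e M] and divided by [e]. The left side tends to [|M| = 1],
   the right side to 0. *)
have key k : nrm (Y k) <= s -> nrm (P k) <= nrm (P k - M) + K * (nrm (Y k) + nrm (X (phi k))).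
  move=> Ys; have [[_ _ HX Xs _] Hmin] := HgX (phi k).
  have := Hmin (Y k) (lieD HX (lieZ _ HM)) Ys.
  have ge : g (phi k) - mexp (X (phi k)) = e (phi k) *: P k.
    rewrite /P /N -scalemxAl scalerA mulfV ?gt_eqF // scale1r mulmxBl mul1mx.
    by rewrite -mulmxA mexpKN mulmx1.
  rewrite ge nrmZ gtr0_norm //.
  have -> : g (phi k) - mexp (Y k) = e (phi k) *: (P k - M) -
      (mexp (Y k) - mexp (X (phi k)) - (Y k - X (phi k))).
    rewrite scalerBr -ge [Y k - X _]addrAC subrr add0r.
    move: (g (phi k)) (mexp (Y k)) (mexp (X (phi k))) (e (phi k) *: M) => a b c d.
    by apply/matrixP => i j; rewrite !mxE; ring.
  move=> H1; have H2 := HK (Y k) (X (phi k)) (le_trans Ys s1) (le_trans Xs s1).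
  rewrite -(ler_pM2l (e0 (phi k))); apply: le_trans H1 _.
  apply: le_trans (ler_nrmB _ _) _; rewrite nrmZ gtr0_norm // mulrDr lerD2l.
  apply: le_trans H2 _; rewrite [Y k - X _]addrAC subrr add0r nrmZ gtr0_norm // M1 mulr1.
  by rewrite mulrC.
have Pcv := cv_nrm PM; rewrite M1 in Pcv.
have Rcv : Un_cv (fun k => nrm (P k - M) + K * (nrm (Y k) + nrm (X (phi k)))) 0.
  have := cvD (cv_nrm (mcvB PM (mcv_cst M))) (cvM (cv_cst K) (cvD (cv_nrm Y0) (cv_nrm Xphi))).
  by rewrite subrr !nrm0 addr0 mulr0 addr0.
have half : 0 < 1 / 2 :> R by lra.
have [N1' H1] := (Un_cvP _ _).1 Pcv _ half; have [N2' H2] := (Un_cvP _ _).1 Rcv _ half.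
have [N3' H3] := (Un_cvP _ _).1 (cv_nrm Y0) _ s0.
pose k := (N1' + N2' + N3')%nat.
have {}H1 : `|nrm (P k) - 1| < 1 / 2 by apply: H1; rewrite /k -addnA leq_addr.
have {}H2 := H2 k (leq_trans (leq_addl _ _) (leq_addr _ _)).
have {}H3 : nrm (Y k) <= s.
  have := H3 k (leq_addl _ _); rewrite nrm0 subr0 ger0_norm ?nrm_ge0 //; exact: ltW.
have := key k H3; move: H1 H2; rewrite subr0 !ltr_norml => /andP[? ?] /andP[? ?] ?; lra.
Qed.

End Lie.

(** * Polar decomposition in a self adjoint group *)

Lemma cv0_bound n (X : nat -> 'M[R]_n) L : mcv X L -> exists C, forall k, nrm (X k) <= C.
Proof.
move=> XL; have [C [_ HC]] := @maj_by_pos _ (exist _ _ (cv_nrm XL)).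
by exists C => k; have /RleP := HC k; rewrite RabsE ger0_norm ?nrm_ge0.
Qed.

(** From [y^-1 = x^-1 - y^-1 (y - x) x^-1]: the last term is absorbed on the left once
    [|(y - x) x^-1| <= 1/2]. *)
Lemma invmx_bound n (y : nat -> 'M[R]_n) x : mcv y x -> x \in unitmx ->
  (forall k, y k \in unitmx) ->
  exists N, forall k, (N <= k)%nat -> nrm (invmx (y k)) <= 2 * nrm (invmx x).
Proof.
move=> yx xU yU.
have D0 : Un_cv (fun k => nrm ((y k - x) *m invmx x)) 0.
  have := cv_nrm (mcvM (mcvB yx (mcv_cst x)) (mcv_cst (invmx x))).
  by rewrite subrr mul0mx nrm0.
have half : 0 < 1 / 2 :> R by lra.
have [N HN] := (Un_cvP _ _).1 D0 _ half; exists N => k /HN.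
rewrite subr0 ger0_norm ?nrm_ge0 // => Dk.
have E : invmx (y k) = invmx x - invmx (y k) *m ((y k - x) *m invmx x).
  by rewrite mulmxBl mulmxV // mulmxBr mulKmx // mulmx1 opprB addrC subrK.
have : nrm (invmx (y k)) <= nrm (invmx x) + nrm (invmx (y k)) * nrm ((y k - x) *m invmx x).
  rewrite {1}E; apply: le_trans (ler_nrmB _ _) _; rewrite lerD2l; exact: nrm_mulmx.
have := nrm_ge0 (invmx (y k)); nra.
Qed.

(** Eigenvalue by eigenvalue. If [x >= 0] then [e^(2x) - 1 >= 2x]; if [x < 0] then
    [1 - e^(2x) >= - 2x e^(2x) >= - x], because the hypothesis gives [e^(2x) >= 1/2]. *)
Lemma sym_log_bound n (W : 'M[R]_n) : W^T = W -> nrm (mexp (2 *: W) - 1%:M) <= 1 / 2 ->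
  nrm W <= nrm (mexp (2 *: W) - 1%:M).
Proof.
move=> /spectral[Q [d [HQ WE]]].
have E : mexp (2 *: W) - 1%:M = Q *m diag_mx (map_mx (fun x => exp (2 * x) - 1) d) *m Q^T.
  have -> : 2 *: W = Q *m diag_mx (2 *: d) *m Q^T by rewrite WE linearZ /= -scalemxAr -scalemxAl.
  have -> : 1%:M = Q *m 1%:M *m Q^T by rewrite mulmx1 orthC.
  rewrite mexp_spectral // -mulmxBl -mulmxBr; congr (_ *m _ *m _).
  by apply/matrixP => i j; rewrite !mxE; case: eqP; rewrite ?mulr1n // subrr.
rewrite E WE !nrm_spectral // => H.
rewrite -(ler_pXn2r (isT : (0 < 2)%nat)) ?nnegrE ?nrm_ge0 // !sqr_nrm_diag.
apply: ler_sum => i _; rewrite mxE.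
have Hi : `|exp (2 * d 0 i) - 1| <= 1 / 2.
  apply: le_trans H; apply: le_trans (entry_le_nrm _ i i).
  by rewrite !mxE eqxx mulr1n.
have := expR_ge1Dx (2 * d 0 i); have := expR_ge1Dx (- (2 * d 0 i)); rewrite expRN.
have := expR_gt0 (2 * d 0 i); move: Hi; rewrite ler_norml.
move: (d 0 i) (exp _) => x y /andP[y1 y2] y0 H1 H2.
have H3 : y * (1 - 2 * x) <= 1.
  have := ler_wpM2l (ltW y0) H1; rewrite mulfV ?gt_eqF //; lra.
case: (lerP 0 x) => x0; nra.
Qed.

Lemma half01 : 0 <= (2^-1 : R) <= 1.
Proof. by apply/andP; split; lra. Qed.

Lemma nrm_mexpZ n (A : 'M[R]_n) (t r : R) : 0 <= t <= 1 -> nrm A <= r ->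
  nrm (mexp (t *: A)) <= nrm (1%:M : 'M[R]_n) * exp r.
Proof.
move=> /andP[t0 t1] Ar; apply: le_trans (nrm_mexp _) _; rewrite ler_wpM2l ?nrm_ge0 //.
by apply: expR_le; rewrite nrmZ ger0_norm // (le_trans _ Ar) // ler_piMl ?nrm_ge0.
Qed.

Lemma mexp_half n (A : 'M[R]_n) : mexp A = mexp (2^-1 *: A) *m mexp (2^-1 *: A).
Proof. by rewrite -mexpD_scale -[LHS](congr1 (@mexp n) (scale1r A)); congr (mexp (_ *: _)); field. Qed.

(* [<W, e^A W e^(-A)> = |S W S^(-1)|^2] with [S = e^(A/2)]. *)
Lemma dotm_conj_exp n (A W : 'M[R]_n) (b : R) : A^T = A -> W^T = W ->
  nrm (mexp (2^-1 *: A)) <= b -> nrm (mexp (2^-1 *: - A)) <= b ->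
  nrm W ^+ 2 <= b ^+ 4 * dotm W (mexp A *m W *m mexp (- A)).
Proof.
move=> AT WT; rewrite [mexp A]mexp_half [mexp (- A)]mexp_half.
have ST : (mexp (2^-1 *: A))^T = mexp (2^-1 *: A) by rewrite mexp_sym // linearZ /= AT.
have NT : (mexp (2^-1 *: - A))^T = mexp (2^-1 *: - A) by rewrite mexp_sym // linearZ linearN /= AT.
have SN : mexp (2^-1 *: A) *m mexp (2^-1 *: - A) = 1%:M by rewrite scalerN mexpNK.
move: (mexp (2^-1 *: A)) (mexp (2^-1 *: - A)) ST NT SN => S T ST NT ST1 Sb Tb; have TS1 := mulmx1C ST1.
have -> : dotm W (S *m S *m W *m (T *m T)) = nrm (S *m W *m T) ^+ 2.
  by symmetry; rewrite sqr_nrm -[X in dotm X _]mulmxA dotm_mull ST dotm_mulr NT !mulmxA.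
have {1}-> : W = T *m (S *m W *m T) *m S.
  by rewrite !mulmxA TS1 mul1mx -mulmxA TS1 mulmx1.
move: (S *m W *m T) => Z; rewrite (exprM b 2 2) -exprMn.
have b0 : 0 <= b by apply: le_trans (nrm_ge0 _) Sb.
rewrite ler_pXn2r ?nnegrE ?mulr_ge0 ?exprn_ge0 ?nrm_ge0 //.
apply: le_trans (nrm_mulmx _ _) _.
apply: le_trans (_ : nrm T * nrm Z * nrm S <= _); first by rewrite ler_wpM2r ?nrm_ge0 ?nrm_mulmx.
rewrite mulrAC ler_wpM2r ?nrm_ge0 // expr2; apply: ler_pM => //; exact: nrm_ge0.
Qed.

(** The calibration along [exp((1-t)W) exp(tA) exp((1-t)X) exp(-A)], which joins
    [exp W exp X exp(-A)] to 1; the hypothesis bounds its speed by [c]. Both shortening arguments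
    use it, one with [A] a perturbation of [X], the other with [A = 0]. *)
Lemma mexp_calibration n (W W' A X k : 'M[R]_n) (c : R) :
  W'^T = W' -> orth k -> mexp W *m mexp X *m mexp (- A) = k *m mexp W' ->
  (forall t : R, 0 <= t <= 1 ->
    nrm (W + mexp ((t * -1 + 1) *: W) *m (mexp (t *: A) *m (X - A) *m mexp (t *: - A)) *m
      mexp ((t * -1 + 1) *: - W)) <= c) ->
  nrm W' <= c.
Proof.
move=> WT kO E Hc.
pose gam t := mexp ((t * -1 + 1) *: W) *m (mexp (t *: A) *m (mexp ((t * -1 + 1) *: X) *m mexp (- A))).
pose et (t : R) := - (W + mexp ((t * -1 + 1) *: W) *m (mexp (t *: A) *m (X - A) *m mexp (t *: - A)) *m
      mexp ((t * -1 + 1) *: - W)).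
apply: (@calibration_const n gam (fun t => et t *m gam t) et k W') => //.
- move=> t; rewrite /gam.
  have dW := mder_comp (dpt_affine (-1) 1 t) (mder_mexp W _).
  have dX := mder_comp (dpt_affine (-1) 1 t) (mder_mexp X _).
  apply: eq_mder (mderM dW (mderM (mder_mexp A t) (mderMr (mexp (- A)) dX))) => //.
  have NK s (Z B : 'M[R]_n) : mexp (s *: - Z) *m (mexp (s *: Z) *m B) = B.
    by rewrite mulmxA scalerN mexpKN mul1mx.
  rewrite /et mulNmx mulmxDl -!mulmxA (NK _ W) (NK _ A) !scaleN1r !mulNmx opprD.
  congr (_ + _); first by rewrite !mulmxA.
  rewrite -[RHS]mulmxN; congr (_ *m _).
  by rewrite mulmxBl mulmxBr opprB mulmxN !mulmxA mexpZ_comm.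
- by move=> t _; rewrite !unitmx_mul !mexp_unit.
- by rewrite /gam mul0r add0r !scale1r scale0r mexp0 mul1mx mulmxA.
- by rewrite /gam mul1r addNr !scale0r scale1r mexp0 !mul1mx mexpNK.
by move=> t t01; rewrite nrmN; apply: Hc.
Qed.

Section Polar.
Variables (n : nat) (G : 'M[R]_n -> Prop).
Hypothesis HG : closed_group G.
Hypothesis GT : forall g, G g -> G g^T.
Hypothesis Gconn : forall U : 'M[R]_n -> Prop,
  (forall x, G x -> U x ->
    exists2 e : R, 0 < e & forall y, G y -> nrm (y - x) < e -> U y) ->
  (forall x, G x -> ~ U x ->
    exists2 e : R, 0 < e & forall y, G y -> nrm (y - x) < e -> ~ U y) ->
  U 1%:M -> forall g, G g -> U g.

Let GU := cg_unit HG.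
Let GM := cg_mul HG.
Let GV := cg_inv HG.

Local Notation lie := (lie G).

Lemma lie_tr X : lie X -> lie X^T.
Proof. by move=> HX t; rewrite -linearZ /= mexp_tr; apply: GT. Qed.

(** Near 1 the element [exp W] is also [exp Z] with [Z] small in the Lie algebra, and [exp] is
    injective on small matrices. *)
Lemma lie_small : exists2 d : R, 0 < d & forall W, nrm W < d -> G (mexp W) -> lie W.
Proof.
have [K K0 HK] := @mexp_near n 1 ler01.
set r : R := Num.min 1 (4 * K)^-1.
have r0 : 0 < r by rewrite lt_min ltr01 invr_gt0 mulr_gt0.
have r1 : r <= 1 by rewrite ge_min lexx.
have rK : K * (r + r) <= 1 / 2.
  have rK : r <= (4 * K)^-1 by rewrite ge_min lexx orbT.
  apply: le_trans (_ : K * ((4 * K)^-1 + (4 * K)^-1) <= _).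
    by rewrite ler_wpM2l ?lerD // ltW.
  by rewrite le_eqVlt; apply/orP; left; apply/eqP; field; rewrite gt_eqF.
have [e e0 He] := near1_exp HG r0.
set b : R := (nrm (1%:M : 'M[R]_n) * exp 1) ^+ 2.
have b0 : 0 <= b by rewrite exprn_ge0 // mulr_ge0 ?nrm_ge0 ?ltW ?expR_gt0.
have b1 : 0 < b + 1 by rewrite ltr_wpDl.
exists (Num.min r (e / (b + 1))) => [|W]; first by rewrite lt_min r0 divr_gt0.
rewrite lt_min => /andP[/ltW Wr We] GW.
have [|Z HZ [Zr WZ]] := He _ GW.
  have := @mexp_lip n W 0 1 (le_trans Wr r1); rewrite nrm0 mexp0 subr0 => /(_ ler01) H.
  apply: le_lt_trans H _; rewrite -/b; move: We; rewrite ltr_pdivlMr // => We.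
  have := nrm_ge0 W; nra.
suff -> : W = Z by [].
have := HK W Z (le_trans Wr r1) (le_trans Zr r1).
rewrite WZ subrr sub0r nrmN => H; apply/subr0_eq/nrm_eq0/le_anti; rewrite nrm_ge0 andbT.
have c0 := nrm_ge0 (W - Z).
have : K * (nrm W + nrm Z) * nrm (W - Z) <= 1 / 2 * nrm (W - Z).
  by rewrite ler_wpM2r // (le_trans _ rK) // ler_wpM2l ?lerD // ltW.
lra.
Qed.

(** Only [X] is tied to [G]. The factor [exp W] measures the failure of a polar decomposition in
    [G]: if [W = 0], then [u = g exp (- X)] lies in [G] as well. *)
Definition factors g (T : 'M[R]_n * 'M[R]_n * 'M[R]_n) : Prop :=
  let: (u, W, X) := T in
  [/\ orth u, W^T = W, lie X, X^T = X & g = u *m mexp W *m mexp X].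

Lemma factors_min g : G g -> exists2 T, factors g T &
  forall T', factors g T' -> nrm T.1.2 <= nrm T'.1.2.
Proof.
move=> Gg; apply: (@inf_attained _ (factors g) (fun T => nrm T.1.2)).
- have [u [W [Hu HW gE]]] := polar_GL (GU Gg).
  exists (u, W, 0); split=> //; [exact: lie0 HG|exact: trmx0|by rewrite mexp0 mulmx1].
- by move=> *; apply: nrm_ge0.
move=> T M HT TM.
pose u k := (T k).1.1; pose W k := (T k).1.2; pose X k := (T k).2.
have {}HT k : [/\ orth (u k), (W k)^T = W k, lie (X k), (X k)^T = X k & g = u k *m mexp (W k) *m mexp (X k)].
  by rewrite /u /W /X; have := HT k; case: (T k) => -[].
set c : R := nrm (1%:M : 'M[R]_n).
(* A bound on [W] bounds [exp X = exp (- W) u^T g] and [exp (- X) = g^-1 u exp W], hence [X]. *)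
have Xb k : nrm (X k) <= c * exp M * (c * nrm g) + nrm (invmx g) * (c * (c * exp M)) + 1.
  have [Hu WT HX XT gE] := HT k.
  have EW : nrm (mexp (W k)) <= c * exp M.
    by apply: le_trans (nrm_mexp _) _; rewrite ler_wpM2l ?nrm_ge0 // expR_le // TM.
  have ENW : nrm (mexp (- W k)) <= c * exp M.
    by apply: le_trans (nrm_mexp _) _; rewrite nrmN ler_wpM2l ?nrm_ge0 // expR_le // TM.
  have EX : mexp (X k) = mexp (- W k) *m ((u k)^T *m g).
    by rewrite {1}gE !mulmxA -[_ *m (u k)^T *m u k]mulmxA Hu mulmx1 mexpKN mul1mx.
  have ENX : mexp (- X k) = invmx g *m (u k *m mexp (W k)).
    rewrite -[X in invmx g *m X]mulmx1 -(mexpNK (X k)) mulmxA -gE mulmxA mulVmx ?GU //.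
    by rewrite mul1mx.
  have A1 : nrm (mexp (X k)) <= c * exp M * (c * nrm g).
    rewrite EX; apply: le_trans (nrm_mulmx _ _) _; apply: ler_pM; rewrite ?nrm_ge0 //.
    by apply: le_trans (nrm_mulmx _ _) _; rewrite (nrm_orth (orth_tr Hu)).
  have A2 : nrm (mexp (- X k)) <= nrm (invmx g) * (c * (c * exp M)).
    rewrite ENX; apply: le_trans (nrm_mulmx _ _) _; rewrite ler_wpM2l ?nrm_ge0 //.
    by apply: le_trans (nrm_mulmx _ _) _; rewrite nrm_orth // ler_wpM2l ?nrm_ge0.
  have := sqr_nrm_le_mexp XT; have := nrm_ge0 (X k).
  have := nrm_ge0 (mexp (X k)); have := nrm_ge0 (mexp (- X k)).
  move: (nrm (mexp _)) (nrm (mexp _)) A1 A2 => x y A1 A2 x0 y0 z0 H.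
  apply: le_trans (_ : x + y <= _); last by lra.
  rewrite -(ler_pXn2r (isT : (0 < 2)%nat)) ?nnegrE ?addr_ge0 //; nra.
have [k|p1 [u' [Hp1 uu']]] := mcv_bw (A := u) (M := c); first by have [/nrm_orth ->] := HT k.
have [k|p2 [W' [Hp2 WW']]] := mcv_bw (A := W \o p1) (M := M); first exact: TM.
have [p3 [X' [Hp3 XX']]] := @mcv_bw n n (X \o p1 \o p2) _ (fun k => Xb _).
pose p := p1 \o p2 \o p3.
have Hp k : (k <= p k)%nat by apply: leq_trans (Hp3 k) (leq_trans (Hp2 _) (Hp1 _)).
have Hu : mcv (fun k => u (p k)) u'.
  by apply: mcv_sub uu' _ => k; apply: leq_trans (Hp3 k) (Hp2 _).
have HW : mcv (fun k => W (p k)) W' by apply: mcv_sub WW' _.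
have HX : mcv (fun k => X (p k)) X' by [].
exists p, (u', W', X'); split=> //; last exact: cv_nrm HW.
split.
- by apply: mcv_orth Hu => k; have [] := HT (p k).
- by apply: mcv_uniq (mcv_tr HW) _; apply: eq_mcv HW => k; have [] := HT (p k).
- by apply: (lie_lim HG _ HX) => k; have [] := HT (p k).
- by apply: mcv_uniq (mcv_tr HX) _; apply: eq_mcv HX => k; have [] := HT (p k).
apply: mcv_uniq _ (mcvM (mcvM Hu (mcv_mexp HW)) (mcv_mexp HX)).
by apply: eq_mcv (mcv_cst g) => k; have [_ _ _ _ {1}->] := HT (p k).
Qed.

(* Were [W] nonzero, [W] would be tangent to [G], and replacing [X] by [X + s W] would
   bring [exp X] closer to [g]. *)
Lemma factors_small : exists2 e : R, 0 < e & forall g u W X, G g -> factors g (u, W, X) ->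
  (forall T', factors g T' -> nrm W <= nrm T'.1.2) -> nrm W < e -> W = 0.
Proof.
have [d d0 Hd] := lie_small; exists (d / 2) => [|g u W X Gg]; first by rewrite divr_gt0.
case=> Hu WT HX XT gE Wmin Wd.
(* [u] need not lie in [G], but it disappears from [(u exp W)^T (u exp W) = exp (2 W)]. The doubling
   explains the threshold [d / 2]. *)
have HW : lie W.
  have Gu : G (u *m mexp W).
    have -> : u *m mexp W = g *m mexp (- X) by rewrite gE -mulmxA mexpNK mulmx1.
    by apply: GM => //; apply: lie_exp; apply: lieN.
  have : G (mexp (2 *: W)).
    have -> : mexp (2 *: W) = (u *m mexp W)^T *m (u *m mexp W).
      rewrite trmx_mul mexp_sym // -mulmxA (mulmxA u^T) Hu mul1mx.
      by rewrite -[2]/(1 + 1) mexpD_scale !scale1r.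
    by apply: GM => //; apply: GT.
  move=> /Hd H; have : lie (2^-1 *: (2 *: W)).
    by apply: lieZ; apply: H; rewrite nrmZ ger0_norm //; lra.
  by rewrite scalerA (_ : 2^-1 * 2 = 1) ?scale1r //; field.
apply/eqP/negPn/negP => W0; have w0 := nrm_gt0 W0.
set b : R := nrm (1%:M : 'M[R]_n) * exp (nrm X + nrm W) + 1.
have b1 : 1 <= b by rewrite lerDr mulr_ge0 ?nrm_ge0 // ltW ?expR_gt0.
have b0 : 0 < b by apply: lt_le_trans b1.
have bb : nrm (1%:M : 'M[R]_n) * exp (nrm X + nrm W) <= b by rewrite lerDl.
(* Put [q = b^4]. The squared speed below is at most [|W|^2 (1 - 2 s / q + s^2 q^2)], which is least
   at [s = q^-3]; the gain is then [q^-4 = b^-16]. *)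
set s : R := b ^- 12.
have s0 : 0 < s by rewrite invr_gt0 exprn_gt0.
have s1 : s <= 1 by rewrite invf_le1 ?exprn_gt0 // exprn_ege1.
pose A := X + s *: W.
have AT : A^T = A by rewrite /A linearD linearZ /= XT WT.
have HA : lie A by apply: (lieD HG) => //; apply: lieZ.
have Ab : nrm A <= nrm X + nrm W.
  by apply: le_trans (ler_nrmD _ _) _; rewrite lerD2l nrmZ gtr0_norm // ler_piMl ?nrm_ge0.
have Wb : nrm W <= nrm X + nrm W by rewrite lerDr nrm_ge0.
have Gg' : G (g *m mexp (- A)) by apply: GM => //; apply: lie_exp; apply: lieN.
have [u' [W' [Hu' WT' gE']]] := polar_GL (GU Gg').
have FA : factors g (u', W', A) by split=> //; rewrite -gE' -mulmxA mexpKN mulmx1.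
have := Wmin _ FA; apply/negP; rewrite /= -ltNge.
set c2 : R := nrm W ^+ 2 * (1 - b ^- 16).
have b16 : 0 < b ^- 16 by rewrite invr_gt0 exprn_gt0.
have b161 : b ^- 16 <= 1 by rewrite invf_le1 ?exprn_gt0 // exprn_ege1.
have c20 : 0 <= c2 by rewrite mulr_ge0 ?exprn_ge0 ?nrm_ge0 // subr_ge0.
apply: le_lt_trans (_ : Num.sqrt c2 < _); last first.
  rewrite -(ltr_pXn2r (isT : (0 < 2)%nat)) ?nnegrE ?sqrtr_ge0 ?nrm_ge0 // sqr_sqrtr //.
  have := mulr_gt0 (exprn_gt0 2 w0) b16; rewrite /c2; lra.
apply: (@mexp_calibration n W W' A X (u^T *m u')) => //.
- by apply: orthM => //; apply: orth_tr.
- by rewrite -[RHS]mulmxA -gE' gE -!mulmxA (mulmxA u^T) Hu mul1mx.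
move=> t t01; have t01' : 0 <= t * -1 + 1 <= 1 by case/andP: t01 => *; apply/andP; split; lra.
set E := mexp ((t * -1 + 1) *: W); set E' := mexp ((t * -1 + 1) *: - W).
have ET : E^T = E by rewrite mexp_sym // linearZ /= WT.
have ET' : E'^T = E' by rewrite mexp_sym // linearZ linearN /= WT.
have EE : E *m E' = 1%:M by rewrite /E /E' scalerN mexpNK.
have EW : E *m W = W *m E by rewrite /E mexpZ_comm.
have XA : X - A = - (s *: W) by rewrite /A opprD addrA subrr add0r.
set B := mexp (t *: A) *m W *m mexp (- (t *: A)).
have -> : W + E *m (mexp (t *: A) *m (X - A) *m mexp (t *: - A)) *m E' = W - s *: (E *m B *m E').
  by rewrite XA scalerN mulmxN -scalemxAr mulNmx -scalemxAl mulmxN -scalemxAr mulNmx -scalemxAl.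
have nE : nrm E <= b by apply: le_trans bb; apply: nrm_mexpZ.
have nE' : nrm E' <= b by apply: le_trans bb; apply: nrm_mexpZ; rewrite ?nrmN.
have nA : nrm (mexp (t *: A)) <= b by apply: le_trans bb; apply: nrm_mexpZ.
have nA' : nrm (mexp (- (t *: A))) <= b.
  by apply: le_trans bb; rewrite -scalerN; apply: nrm_mexpZ; rewrite ?nrmN.
have prod3 (P Q C : 'M[R]_n) : nrm P <= b -> nrm Q <= b -> nrm (P *m C *m Q) <= b ^+ 2 * nrm C.
  move=> Pb Qb; apply: le_trans (nrm_mulmx _ _) _.
  have PC := nrm_mulmx P C; have := nrm_ge0 C; have := nrm_ge0 P; have := nrm_ge0 Q.
  have := nrm_ge0 (P *m C); move: PC Pb Qb.
  move: (nrm (P *m C)) (nrm P) (nrm Q) (nrm C) => x p q y H1 H2 H3 x0 q0 p0 y0.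
  have H4 : x <= b * y by apply: le_trans H1 _; rewrite ler_wpM2r.
  have H5 : x * q <= b * y * b by apply: ler_pM.
  by apply: le_trans H5 _; rewrite expr2 mulrAC.
have nB : nrm (E *m B *m E') <= b ^+ 4 * nrm W.
  apply: le_trans (prod3 _ _ _ nE nE') _; rewrite (exprD b 2 2) -mulrA ler_wpM2l ?exprn_ge0 ?(ltW b0) //.
  exact: prod3.
have WB : dotm W (E *m B *m E') = dotm W B.
  rewrite dotmC dotm_mulr ET' dotm_mull ET mulmxA EW -mulmxA EE mulmx1.
  exact: dotmC.
have lowB : nrm W ^+ 2 <= b ^+ 4 * dotm W B.
  apply: (dotm_conj_exp _ WT); first by rewrite linearZ /= AT.
    apply: le_trans bb; apply: nrm_mexpZ half01 _.
    apply: le_trans Ab; rewrite nrmZ; case/andP: t01 => *; rewrite ger0_norm // ler_piMl ?nrm_ge0 //.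
  apply: le_trans bb; apply: nrm_mexpZ half01 _.
  apply: le_trans Ab; rewrite nrmN nrmZ; case/andP: t01 => *; rewrite ger0_norm // ler_piMl ?nrm_ge0 //.
rewrite -(ler_pXn2r (isT : (0 < 2)%nat)) ?nnegrE ?sqrtr_ge0 ?nrm_ge0 // [X in _ <= X]sqr_sqrtr // sqr_nrm.
rewrite !dotmE_lin (dotmC _ W) WB -!sqr_nrm.
have b4 : 0 < b ^+ 4 by rewrite exprn_gt0.
have sE : s = (b ^+ 4)^-1 ^+ 3 by rewrite /s exprVn -exprM.
have qE : b ^- 16 = (b ^+ 4)^-1 ^+ 4 by rewrite exprVn -exprM.
have nB2 : nrm (E *m B *m E') ^+ 2 <= (b ^+ 4) ^+ 2 * nrm W ^+ 2.
  by rewrite -exprMn ler_pXn2r ?nnegrE ?nrm_ge0 // mulr_ge0 ?nrm_ge0 // ltW.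
rewrite /c2 qE sE; move: (b ^+ 4) b4 lowB nB2 => q q0.
have qV : 0 < q^-1 by rewrite invr_gt0.
have qq : q^-1 * q = 1 by rewrite mulVf // gt_eqF.
move: (q^-1) qV qq => p p0 pq lowB' nB2.
have L1 : p * nrm W ^+ 2 <= dotm W B.
  by have := ler_wpM2l (ltW p0) lowB'; rewrite [X in _ <= X]mulrA pq mul1r.
have L2 : p ^+ 2 * nrm (E *m B *m E') ^+ 2 <= nrm W ^+ 2.
  have p2q2 : p ^+ 2 * q ^+ 2 = 1 by rewrite -exprMn pq expr1n.
  by have := ler_wpM2l (exprn_ge0 2 (ltW p0)) nB2; rewrite [X in _ <= X]mulrA p2q2 mul1r.
have p4 : 0 < p ^+ 4 by rewrite exprn_gt0.
have p3 : 0 < p ^+ 3 by rewrite exprn_gt0.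
have L1' := ler_wpM2l (ltW p3) L1; have L2' := ler_wpM2l (ltW p4) L2.
move: L1' L2'; clear -p.
move: (nrm W ^+ 2) (dotm W B) (nrm (E *m B *m E') ^+ 2) => w x y L1' L2'.
have -> : w - p ^+ 3 * x + (- (p ^+ 3 * x) - p ^+ 3 * - (p ^+ 3 * y)) =
  w - 2 * (p ^+ 3 * x) + p ^+ 4 * (p ^+ 2 * y) by ring.
have E4 : p ^+ 3 * (p * w) = p ^+ 4 * w by ring.
lra.
Qed.

(** The set of decomposable elements is closed because the factors of a convergent sequence stay
    bounded. It is open: for [z] near [k exp X], the element [h = z exp (- X)] is almost orthogonal,
    so its symmetric logarithm [W0] is small; the minimal [|W|] for [z] is at most [|W0|], hence
    0. *)
Lemma polar_group g : G g -> exists k X, [/\ orth k, G k, lie X, X^T = X & g = k *m mexp X].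
Proof.
have [e e0 He] := factors_small.
move: g; apply: Gconn => [x Gx [k [X [kO Gk HX XT xE]]]|x Gx nU|]; last first.
- exists 1%:M, 0; split; [exact: orth1|exact: cg_1|exact: lie0|exact: trmx0|by rewrite mexp0 mulmx1].
- apply: NNPP => H.
  have /(_ _)/constructive_indefinite_description y j : exists y, [/\ G y,
      nrm (y - x) < j.+1%:R^-1 & exists k X, [/\ orth k, G k, lie X, X^T = X & y = k *m mexp X]].
    apply: NNPP => Hj; apply: H; exists (j.+1%:R^-1); first by rewrite invr_gt0 ltr0Sn.
    by move=> y Gy yx Uy; apply: Hj; exists y.
  pose z j := sval (y j).
  have zx : mcv z x.
    apply/mcvP; apply: cv_squeeze0 cv_inv_succ => j; rewrite ger0_norm ?nrm_ge0 // /z.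
    by case: (svalP (y j)) => _ /ltW.
  have Gz j : G (z j) by case: (svalP (y j)).
  have [N HN] := invmx_bound zx (GU Gx) (fun j => GU (Gz j)).
  have [C HC] := cv0_bound zx.
  have /(_ _)/constructive_indefinite_description kX j : exists kX : 'M[R]_n * 'M[R]_n,
      [/\ orth kX.1, G kX.1, lie kX.2, kX.2^T = kX.2 & z j = kX.1 *m mexp kX.2].
    by case: (svalP (y j)) => _ _ [k [X HkX]]; exists (k, X).
  pose k j := (sval (kX j)).1; pose X j := (sval (kX j)).2.
  have HkX j : [/\ orth (k j), G (k j), lie (X j), (X j)^T = X j & z j = k j *m mexp (X j)].
    exact: svalP (kX j).
  have Xb j : (N <= j)%nat -> nrm (X j) <= C + 2 * nrm (invmx x) * nrm (1%:M : 'M[R]_n).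
    move=> /HN Hj; have [kO Gk HX XT zE] := HkX j.
    have A1 : nrm (mexp (X j)) <= C by rewrite -(nrm_orthl _ kO) -zE.
    have A2 : nrm (mexp (- X j)) <= 2 * nrm (invmx x) * nrm (1%:M : 'M[R]_n).
      have -> : mexp (- X j) = invmx (z j) *m k j.
        by rewrite -[k j]mulmx1 -(mexpNK (X j)) (mulmxA (k j)) -zE mulKmx //; apply: GU.
      apply: le_trans (nrm_mulmx _ _) _; rewrite (nrm_orth kO); apply: ler_wpM2r Hj; exact: nrm_ge0.
    have := sqr_nrm_le_mexp XT; have := nrm_ge0 (X j).
    have := nrm_ge0 (mexp (X j)); have := nrm_ge0 (mexp (- X j)).
    move: (nrm (mexp _)) (nrm (mexp _)) A1 A2 => a b A1 A2 a0 b0 c0 H'.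
    apply: le_trans (_ : a + b <= _); last by lra.
    rewrite -(ler_pXn2r (isT : (0 < 2)%nat)) ?nnegrE ?addr_ge0 //; nra.
  have [p1 [X' [Hp1 XX']]] := @mcv_bw n n (fun j => X (N + j)%nat) _ (fun j => Xb _ (leq_addr _ _)).
  have [j|p2 [k' [Hp2 kk']]] := mcv_bw (A := fun j => k (N + p1 j)%nat) (M := nrm (1%:M : 'M[R]_n)).
    by have [/nrm_orth ->] := HkX (N + p1 j)%nat.
  pose q j := (N + p1 (p2 j))%nat.
  have Hq j : (j <= q j)%nat.
    by apply: leq_trans (leq_addl N _); apply: leq_trans (Hp2 j) (Hp1 _).
  have qX : mcv (fun j => X (q j)) X' by apply: mcv_sub XX' Hp2.
  have qk : mcv (fun j => k (q j)) k' by [].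
  have k'O : orth k' by apply: mcv_orth qk => j; case: (HkX (q j)).
  apply: nU; exists k', X'; split=> //.
  - apply: (cg_lim HG) qk _; first by move=> j; case: (HkX (q j)).
    by have [] := mulmx1_unit k'O.
  - by apply: (lie_lim HG _ qX) => j; case: (HkX (q j)).
  - by apply: mcv_uniq (mcv_tr qX) _; apply: eq_mcv qX => j; case: (HkX (q j)).
  apply: mcv_uniq (mcv_sub zx Hq) _.
  by apply: eq_mcv (mcvM qk (mcv_mexp qX)) => j; case: (HkX (q j)).
apply: NNPP => H.
have /(_ _)/constructive_indefinite_description y j : exists y, [/\ G y,
    nrm (y - x) < j.+1%:R^-1 & ~ exists k X, [/\ orth k, G k, lie X, X^T = X & y = k *m mexp X]].
  apply: NNPP => Hj; apply: H; exists (j.+1%:R^-1); first by rewrite invr_gt0 ltr0Sn.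
  by move=> y Gy yx; apply: NNPP => Uy; apply: Hj; exists y.
pose z j := sval (y j).
have zx : mcv z x.
  apply/mcvP; apply: cv_squeeze0 cv_inv_succ => j; rewrite ger0_norm ?nrm_ge0 // /z.
  by case: (svalP (y j)) => _ /ltW.
pose h j := z j *m mexp (- X).
have hk : mcv (fun j => (h j)^T *m h j) 1%:M.
  have hk : mcv h k.
    have := mcvM zx (mcv_cst (mexp (- X))); by rewrite xE -mulmxA mexpNK mulmx1.
  by rewrite -kO; apply: mcvM (mcv_tr hk) hk.
have half : 0 < Num.min (1 / 2) e :> R by rewrite lt_min e0 andbT; lra.
have [N HN] := (Un_cvP _ _).1 ((mcvP _ _).1 hk) _ half.
have {HN} := HN N (leqnn N); rewrite subr0 ger0_norm ?nrm_ge0 // lt_min => /andP[h1 h2].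
case: (svalP (y N)) => Gz _; rewrite -/(z N) => nUz; apply: nUz.
have Gh : G (h N) by apply: GM => //; apply: lie_exp; apply: lieN.
have [u0 [W0 [u0O W0T hE]]] := polar_GL (GU Gh).
have hhE : (h N)^T *m h N = mexp (2 *: W0).
  rewrite hE trmx_mul mexp_sym // -mulmxA (mulmxA u0^T) u0O mul1mx.
  by rewrite -[2]/(1 + 1) mexpD_scale !scale1r.
have W0e : nrm W0 < e.
  by apply: le_lt_trans h2; rewrite hhE; apply: sym_log_bound => //; rewrite -hhE ltW.
have [[[u W] Y] /= HF Fmin] := factors_min Gz.
have W00 : W = 0.
  apply: (He _ _ _ _ Gz HF Fmin); apply: le_lt_trans W0e.
  apply: (Fmin (u0, W0, X)); split=> //.
  by rewrite -hE /h -mulmxA mexpKN mulmx1.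
case: HF => uO _ HY YT; rewrite W00 mexp0 mulmx1 => zE.
exists u, Y; split=> //.
have -> : u = z N *m mexp (- Y) by rewrite /z zE -mulmxA mexpNK mulmx1.
by apply: GM => //; apply: lie_exp; apply: lieN.
Qed.

End Polar.

(** * Paths in the group *)

Lemma eq_continuity (f g : R -> R) : (forall t, f t = g t) -> continuity f -> continuity g.
Proof. exact: continuity_eq. Qed.

Definition mcont m n (F : R -> 'M[R]_(m, n)) := forall i j, continuity (fun t => F t i j).

Section MatrixContinuity.
Variables m n : nat.
Implicit Types F G : R -> 'M[R]_(m, n).

Lemma mder_mcont F F' : (forall t, mder F t (F' t)) -> mcont F.
Proof.
by move=> H i j t; apply: derivable_continuous_pt; exists (F' t i j); apply: H.
Qed.

Lemma mcont_cst (A : 'M[R]_(m, n)) : mcont (fun=> A).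
Proof. by move=> i j; apply: continuity_const. Qed.

Lemma mcontD F G : mcont F -> mcont G -> mcont (fun t => F t + G t).
Proof.
move=> HF HG i j; apply: eq_continuity (continuity_plus _ _ (HF i j) (HG i j)) => t.
by rewrite mxE.
Qed.

Lemma mcontZ f F : continuity f -> mcont F -> mcont (fun t => f t *: F t).
Proof.
move=> Hf HF i j; apply: eq_continuity (continuity_mult _ _ Hf (HF i j)) => t.
by rewrite mxE.
Qed.

Lemma mcont_comp f F : continuity f -> mcont F -> mcont (fun t => F (f t)).
Proof. by move=> Hf HF i j; apply: (continuity_comp f _ Hf (HF i j)). Qed.

Lemma continuity_nrm F : mcont F -> continuity (fun t => nrm (F t)).
Proof.
move=> HF; apply: (@eq_continuity (fun t => sqrt (\sum_i \sum_j F t i j * F t i j))) => [t|].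
  by rewrite RsqrtE  nrmE dotmE.
move=> t; apply: (continuity_pt_comp (fun t => \sum_i \sum_j F t i j * F t i j) sqrt).
  by do 2!apply: continuity_sum => ? _; apply: continuity_mult.
by apply: continuity_pt_sqrt; rewrite -dotmE; apply/RleP/dotm_ge0.
Qed.

End MatrixContinuity.

Lemma mcontM m n p (F : R -> 'M[R]_(m, n)) (G : R -> 'M[R]_(n, p)) :
  mcont F -> mcont G -> mcont (fun t => F t *m G t).
Proof.
move=> HF HG i j.
apply: (@eq_continuity (fun t => \sum_k F t i k * G t k j)) => [t|]; first by rewrite mxE.
by apply: continuity_sum => k _; apply: continuity_mult.
Qed.

Definition ppart (x : R) : R := (x + `|x|) / 2.

Lemma ppart_ge0 x : 0 <= ppart x.
Proof. by rewrite /ppart; case: (ger0P x) => ?; lra. Qed.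

Lemma ppart_pos x : 0 <= x -> ppart x = x.
Proof. by move=> x0; rewrite /ppart ger0_norm //; field. Qed.

Lemma ppart_neg x : x <= 0 -> ppart x = 0.
Proof. by move=> x0; rewrite /ppart ler0_norm // subrr mul0r. Qed.

Lemma continuity_ppart : continuity ppart.
Proof.
apply: (@eq_continuity (fun x => (x + Rabs x) * 2^-1)) => [x|]; first by rewrite RabsE.
apply: continuity_mult; last exact: continuity_const.
apply: continuity_plus; [exact: derivable_continuous derivable_id|exact: Rcontinuity_abs].
Qed.

Lemma dpt_sqr_ppart x : derivable_pt_lim (fun t => ppart t ^+ 2) x (2 * ppart x).
Proof.
move=> e e0; exists (mkposreal e e0) => h /eqP h0 /RltP; rewrite RabsE /= => he.
apply/RltP; rewrite !RealsE; apply: le_lt_trans he.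
have -> : (ppart (x + h) ^+ 2 - ppart x ^+ 2) / h - 2 * ppart x =
  (ppart (x + h) ^+ 2 - ppart x ^+ 2 - 2 * ppart x * h) / h by field.
rewrite normrM normfV ler_pdivrMr ?normr_gt0 // -expr2 real_normK ?num_real //.
rewrite ler_norml; apply/andP.
case: (lerP 0 x) => x0; case: (lerP 0 (x + h)) => xh.
- by rewrite !ppart_pos //; split; nra.
- by rewrite (ppart_neg (ltW xh)) ppart_pos //; split; nra.
- by rewrite (ppart_neg (ltW x0)) ppart_pos //; split; nra.
- by rewrite (ppart_neg (ltW x0)) (ppart_neg (ltW xh)); split; nra.
Qed.

Section Paths.
Variables (n : nat) (G : 'M[R]_n -> Prop).
Hypothesis HG : closed_group G.
Hypothesis Gconn : forall U : 'M[R]_n -> Prop,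
  (forall x, G x -> U x ->
    exists2 e : R, 0 < e & forall y, G y -> nrm (y - x) < e -> U y) ->
  (forall x, G x -> ~ U x ->
    exists2 e : R, 0 < e & forall y, G y -> nrm (y - x) < e -> ~ U y) ->
  U 1%:M -> forall g, G g -> U g.

Definition path_to (g : 'M[R]_n) (L : R) : Prop := exists c eta : R -> 'M[R]_n,
  [/\ c 0 = 1%:M, c 1 = g, forall t, mder c t (eta t *m c t), mcont eta & forall t, G (c t)] /\
  forall t : R, 0 <= t <= 1 -> nrm (eta t) <= L.

Lemma path_to_le g L M : L <= M -> path_to g L -> path_to g M.
Proof.
move=> LM [c [eta [H Hb]]]; exists c, eta; split=> // t /Hb /le_trans; exact.
Qed.

Lemma path_to1 : path_to 1%:M 0.
Proof.
exists (fun=> 1%:M), (fun=> 0); split; last by move=> *; rewrite nrm0.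
split=> //; last by move=> _; apply: cg_1.
  by move=> t; rewrite mul0mx; apply: mder_cst.
exact: mcont_cst.
Qed.

(** The pointwise product of two curves avoids concatenation and its loss of smoothness; the price
    is the conjugation of [eta] by [exp (t X)]. *)
Lemma path_to_exp g L X (r : R) : lie G X -> nrm X <= r -> path_to g L ->
  path_to (mexp X *m g) (r + (nrm (1%:M : 'M[R]_n) * exp r) ^+ 2 * L).
Proof.
move=> HX Xr [c [eta [[c0 c1 dc ceta Gc] Hb]]].
exists (fun t => mexp (t *: X) *m c t),
  (fun t => X + mexp (t *: X) *m eta t *m mexp (t *: - X)); split; last first.
  move=> t t01; apply: le_trans (ler_nrmD _ _) _; apply: lerD => //.
  have b1 := nrm_mexpZ t01 Xr.
  have b2 : nrm (mexp (t *: - X)) <= nrm (1%:M : 'M[R]_n) * exp r by apply: nrm_mexpZ; rewrite ?nrmN.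
  apply: le_trans (nrm_mulmx _ _) _; rewrite expr2 [X in _ <= X]mulrAC.
  apply: ler_pM; rewrite ?nrm_ge0 //; apply: le_trans (nrm_mulmx _ _) _.
  by apply: ler_pM; rewrite ?nrm_ge0 ?Hb.
split.
- by rewrite scale0r mexp0 mul1mx.
- by rewrite scale1r c1.
- move=> t; apply: eq_mder (mderM (mder_mexp X t) (dc t)) => //.
  rewrite mulmxDl -!mulmxA; congr (_ + _ *m (_ *m _)).
  by rewrite mulmxA scalerN mexpKN mul1mx.
- apply: mcontD; first exact: mcont_cst.
  by apply: mcontM; [apply: mcontM => //|]; apply: mder_mcont (fun t => mder_mexp _ t).
by move=> t; apply: (cg_mul HG).
Qed.

Lemma near_exp_mul (x : 'M[R]_n) : G x -> exists2 e : R, 0 < e &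
  forall y, G y -> nrm (y - x) < e -> exists2 Z, lie G Z & nrm Z <= 1 /\ y = mexp Z *m x.
Proof.
move=> Gx; have [e e0 He] := near1_exp HG ltr01; have xU := cg_unit HG Gx.
set c : R := nrm (invmx x) + 1.
have c0 : 0 < c by rewrite ltr_wpDl ?nrm_ge0.
exists (e / c) => [|y Gy yx]; first by rewrite divr_gt0.
have [||Z HZ [Z1 ZE]] := He (y *m invmx x); last by exists Z => //; split=> //; rewrite -ZE mulmxKV.
  by apply: (cg_mul HG) => //; apply: (cg_inv HG).
have -> : y *m invmx x - 1%:M = (y - x) *m invmx x by rewrite mulmxBl mulmxV.
apply: le_lt_trans (nrm_mulmx _ _) _; move: yx; rewrite ltr_pdivlMr // => yx.
apply: le_lt_trans yx; apply: ler_wpM2l; [exact: nrm_ge0|by rewrite lerDl].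
Qed.

(** Reachability from 1 passes between [x] and any nearby [exp Z x] in both directions, so the
    reachable set and its complement are open. *)
Lemma path_to_ex g : G g -> exists L, path_to g L.
Proof.
move: g; apply: Gconn => [x Gx [L HL]|x Gx nU|]; last by exists 0; apply: path_to1.
  have [e e0 He] := near_exp_mul Gx; exists e => // y Gy /(He y Gy)[Z HZ [Z1 ->]].
  by eexists; apply: path_to_exp HZ Z1 HL.
have [e e0 He] := near_exp_mul Gx; exists e => // y Gy /(He y Gy)[Z HZ [Z1 yE]] [L HL]; apply: nU.
have -> : x = mexp (- Z) *m y by rewrite yE mulmxA mexpKN mul1mx.
by eexists; apply: path_to_exp (lieN HZ) _ HL; rewrite nrmN; exact: Z1.
Qed.

(** If no bound is uniform, elements [k_j] needing speed above [j] accumulate at some [k'], and all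
    elements near [k'] are reached from it at bounded extra speed. *)
Lemma path_to_orth : exists C, forall k, G k -> orth k -> path_to k C.
Proof.
apply: NNPP => H.
have /(_ _)/constructive_indefinite_description k j :
    exists k, [/\ G k, orth k & ~ path_to k j%:R].
  apply: NNPP => Hj; apply: H; exists j%:R => k Gk kO; apply: NNPP => nk.
  by apply: Hj; exists k.
have Hk j := svalP (k j).
have [j|phi [k' [Hphi kk']]] := mcv_bw (A := fun j => sval (k j)) (M := nrm (1%:M : 'M[R]_n)).
  by have [_ /nrm_orth ->] := Hk j.
have k'O : orth k' by apply: mcv_orth kk' => j; have [] := Hk (phi j).
have Gk' : G k'.
  apply: (cg_lim HG) kk' _; first by move=> j; have [] := Hk (phi j).
  by have [] := mulmx1_unit k'O.
have [L HL] := path_to_ex Gk'; have [e e0 He] := near_exp_mul Gk'.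
have [N HN] := (Un_cvP _ _).1 ((mcvP _ _).1 kk') _ e0.
set M : R := 1 + (nrm (1%:M : 'M[R]_n) * exp 1) ^+ 2 * L.
pose j := maxn N (Num.bound M).
have [Gj _ nj] := Hk (phi j); apply: nj.
have [|Z HZ [Z1 ->]] := He _ Gj.
  by have := HN j (leq_maxl _ _); rewrite subr0 ger0_norm ?nrm_ge0.
apply: path_to_le (path_to_exp HZ Z1 HL); rewrite -/M.
apply: le_trans (_ : (Num.bound M)%:R <= _); last first.
  by rewrite ler_nat; apply: leq_trans (leq_maxr _ _) (Hphi _).
case: (lerP 0 M) => M0; first exact/ltW/archi_boundP.
by apply: le_trans (ltW M0) _; rewrite ler0n.
Qed.

(* The path first runs along [c] with [X] frozen, then along [exp (s X)]; the squared positive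
   parts make the junction C^1. *)
Lemma concat_path k X h (C : R) : path_to k C -> lie G X -> G h ->
  exists gam eta : R -> 'M[R]_n,
  [/\ gam 0 = k *m mexp X *m h, gam 1 = h, forall t, mder gam t (eta t *m gam t), mcont eta &
      forall t, G (gam t)] /\
  forall t : R, 0 <= t <= 1 ->
    nrm (eta t) <= 4 * ppart (t * -2 + 1) * C + 4 * ppart (t * 2 + -1) * nrm X.
Proof.
move=> [c [et [[c0 c1 dc cet Gc] Hb]]] HX Gh.
(* [f] falls from 1 to 0 on the first half of [0, 1] and then stays at 0, where [p] begins to rise
   from 0 to 1: only one factor moves at a time. *)
pose f t := ppart (t * -2 + 1) ^+ 2; pose p t := ppart (t * 2 + -1) ^+ 2.
pose f' t := 2 * ppart (t * -2 + 1) * -2; pose p' t := 2 * ppart (t * 2 + -1) * 2.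
have df t : derivable_pt_lim f t (f' t).
  by apply: eq_dpt (dpt_comp (dpt_affine (-2) 1 t) (dpt_sqr_ppart _)).
have dp t : derivable_pt_lim p t (p' t).
  by apply: eq_dpt (dpt_comp (dpt_affine 2 (-1) t) (dpt_sqr_ppart _)).
have cont_aff (a b : R) : continuity (fun t => ppart (t * a + b)).
  apply: (continuity_comp (fun t => t * a + b) ppart); last exact: continuity_ppart.
  by move=> t; apply: derivable_continuous_pt; exists a; apply: dpt_affine.
have cont_f : continuity f by move=> t; apply: derivable_continuous_pt; exists (f' t); apply: df.
have cont_f' : continuity f'.
  apply: (continuity_mult (fun t => 2 * ppart (t * -2 + 1)) (fun=> -2)).
    by apply: (continuity_mult (fun=> 2)) => //; apply: continuity_const.
  exact: continuity_const.
have cont_p' : continuity p'.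
  apply: (continuity_mult (fun t => 2 * ppart (t * 2 + -1)) (fun=> 2)).
    by apply: (continuity_mult (fun=> 2)) => //; apply: continuity_const.
  exact: continuity_const.
exists (fun t => c (f t) *m mexp ((p t * -1 + 1) *: X) *m h),
  (fun t => f' t *: et (f t) + (- p' t) *: X); split; last first.
  move=> t t01; have f01 : 0 <= f t <= 1.
    rewrite /f; case/andP: t01 => t0 t1; case: (lerP 0 (t * -2 + 1)) => s0.
      by rewrite ppart_pos //; apply/andP; split; nra.
    by rewrite (ppart_neg (ltW s0)) expr0n /= lexx ler01.
  apply: le_trans (ler_nrmD _ _) _; rewrite !nrmZ normrN /f' /p'.
  have q1 := ppart_ge0 (t * -2 + 1); have q2 := ppart_ge0 (t * 2 + -1).
  rewrite [`|_ * -2|]ler0_norm; last by lra.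
  rewrite [`|_ * 2|]ger0_norm; last by lra.
  apply: lerD; last by rewrite le_eqVlt; apply/orP; left; apply/eqP; ring.
  have := Hb _ f01; have := nrm_ge0 (et (f t)); nra.
split.
- rewrite /f /p !mul0r !add0r ppart_pos // ppart_neg; last by lra.
  by rewrite expr1n expr0n /= mul0r add0r scale1r c1.
- rewrite /f /p !mul1r (ppart_neg (_ : -2 + 1 <= 0)); last by lra.
  rewrite (_ : 2 + -1 = 1); last by ring.
  by rewrite ppart_pos // expr1n expr0n /= mul1r addNr scale0r mexp0 mulmx1 c0 mul1mx.
- move=> t; have dX := mder_comp (dpt_comp (dp t) (dpt_affine (-1) 1 (p t))) (mder_mexp X _).
  apply: eq_mder (mderMr h (mderM (mder_comp (df t) (dc (f t))) dX)) => //.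
  rewrite !mulmxDl -!scalemxAl -!scalemxAr -!scalemxAl -!mulmxA mulN1r; congr (_ + _).
  (* [X] appears to the right of [c (f t)], but [eta] must stand on the left. Either the coefficient
     [p' t] is 0, or [f t = 0] and [c 0 = 1]. *)
  case: (lerP 0 (t * -2 + 1)) => s0.
    by rewrite /p' (@ppart_neg (t * 2 + -1)) ?mulr0 ?mul0r ?oppr0 ?scale0r //; lra.
  by rewrite /f (ppart_neg (ltW s0)) expr0n /= c0 !mul1mx.
- apply: mcontD; first by apply: mcontZ => //; apply: mcont_comp.
  by apply: mcontZ (mcont_cst _); apply: continuity_opp.
move=> t; apply: (cg_mul HG) => //; apply: (cg_mul HG) => //.
Qed.

End Paths.

(** * Growth along one-parameter groups *)

Section Growth.
Variables (n : nat) (v : 'cV[R]_n).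
Hypothesis v0 : v != 0.
Implicit Types X : 'M[R]_n.

Definition component X (l : R) : Prop := exists c : 'cV[R]_n,
  [/\ X *m c = l *: c, forall w : 'cV[R]_n, X *m w = l *: w -> dotm (v - c) w = 0 & c != 0].

Definition max_component X l : Prop := component X l /\ forall mu, component X mu -> mu <= l.

Lemma max_component_uniq X l m : max_component X l -> max_component X m -> l = m.
Proof.
by move=> [Cl Ml] [Cm Mm]; apply/le_anti; rewrite (Mm _ Cl) (Ml _ Cm).
Qed.

Lemma dotm_cV (x y : 'cV[R]_n) : dotm x y = \sum_i x i 0 * y i 0.
Proof. by rewrite dotmE; apply: eq_bigr => i _; rewrite big_ord1. Qed.

Lemma cV_subE (x y : 'cV[R]_n) i : (x - y) i 0 = x i 0 - y i 0.
Proof. by rewrite !mxE. Qed.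

Lemma sqr_nrm_col (w : 'cV[R]_n) : nrm w ^+ 2 = \sum_i w i 0 ^+ 2.
Proof. by rewrite sqr_nrm dotm_cV; apply: eq_bigr => i _; rewrite expr2. Qed.

Lemma sqr_nrm_mexp Q (d : 'rV[R]_n) (t : R) : orth Q ->
  nrm (mexp (t *: (Q *m diag_mx d *m Q^T)) *m v) ^+ 2 =
  \sum_i exp (t * d 0 i) ^+ 2 * (Q^T *m v) i 0 ^+ 2.
Proof.
move=> HQ; have -> : t *: (Q *m diag_mx d *m Q^T) = Q *m diag_mx (t *: d) *m Q^T.
  by rewrite linearZ /= -scalemxAr -scalemxAl.
rewrite mexp_spectral // -!mulmxA nrm_orthl // sqr_nrm_col; apply: eq_bigr => i _.
by rewrite mul_diag_mx !mxE exprMn.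
Qed.

Lemma component_spectral Q (d : 'rV[R]_n) l : orth Q ->
  component (Q *m diag_mx d *m Q^T) l <-> exists i, d 0 i = l /\ (Q^T *m v) i 0 != 0.
Proof.
move=> HQ; set w := Q^T *m v.
have QK (x : 'cV[R]_n) : Q^T *m (Q *m x) = x by rewrite mulmxA HQ mul1mx.
have KQ (x : 'cV[R]_n) : Q *m (Q^T *m x) = x by rewrite mulmxA orthC // mul1mx.
have eig (x : 'cV[R]_n) : (forall i, d 0 i != l -> x i 0 = 0) ->
    Q *m diag_mx d *m Q^T *m (Q *m x) = l *: (Q *m x).
  move=> Hx; rewrite -!mulmxA QK scalemxAr; congr (_ *m _).
  apply/colP => i; rewrite mul_diag_mx !mxE.
  by have [->//|/Hx ->] := eqVneq (d 0 i) l; rewrite !mulr0.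
split=> [[c [Xc Hc c0]]|[i [dil wi]]].
  have cd i : d 0 i != l -> (Q^T *m c) i 0 = 0.
    move=> dl; have : diag_mx d *m (Q^T *m c) = l *: (Q^T *m c).
      by rewrite scalemxAr -Xc !mulmxA HQ mul1mx.
    move/colP/(_ i); rewrite mul_diag_mx !mxE => E.
    by apply/(mulfI (_ : d 0 i - l != 0)); rewrite ?subr_eq0 // mulr0 mulrBl E subrr.
  have cw i : d 0 i = l -> (Q^T *m c) i 0 = w i 0.
    move=> dl; have := Hc (Q *m delta_mx i 0); rewrite eig => [/(_ erefl)|j dj]; last first.
      by rewrite !mxE; case: eqP => // ji; move: dj; rewrite ji dl eqxx.
    rewrite dotmC dotm_mull mulmxBr -/w => /eqP.
    rewrite dotm_cV (bigD1 i) //= big1 ?addr0 => [|j /negbTE ji]; last first.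
      by rewrite mxE ji mul0r.
    by rewrite mxE !eqxx mul1r cV_subE subr_eq0 => /eqP.
  apply: NNPP => H; move/eqP: c0; apply; rewrite -(KQ c).
  have -> : Q^T *m c = 0; last by rewrite mulmx0.
  apply/colP => i; rewrite [RHS]mxE; have [dl|/cd//] := eqVneq (d 0 i) l.
  by rewrite cw //; apply/eqP/negPn/negP => wi; apply: H; exists i.
pose x : 'cV[R]_n := \col_j (if d 0 j == l then w j 0 else 0).
exists (Q *m x); split.
- by apply: eig => j /negbTE dj; rewrite mxE dj.
- move=> y Xy; rewrite -(KQ v) -mulmxBr -/w dotm_mull dotm_cV big1 // => j _.
  rewrite cV_subE [x j 0]mxE; case: eqP => [_|/eqP dj]; first by rewrite subrr mul0r.
  have : diag_mx d *m (Q^T *m y) = l *: (Q^T *m y).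
    by rewrite scalemxAr -Xy !mulmxA HQ mul1mx.
  move/colP/(_ j); rewrite mul_diag_mx mxE [in RHS]mxE => E.
  suff -> : (Q^T *m y) j 0 = 0 by rewrite mulr0.
  by apply/(mulfI (_ : d 0 j - l != 0)); rewrite ?subr_eq0 // mulr0 mulrBl E subrr.
apply/eqP => Qx; have /colP/(_ i) : x = 0 by rewrite -(QK x) Qx mulmx0.
by rewrite mxE [RHS]mxE dil eqxx; apply/eqP.
Qed.

Lemma nrm_mexp_gt0 X : 0 < nrm (mexp X *m v).
Proof.
apply: nrm_gt0; apply: contra v0 => /eqP H.
by rewrite -[v]mul1mx -(mexpKN X) -mulmxA H mulmx0.
Qed.

(** In an eigenbasis [|exp (t X) v|^2] is the sum of [e^(2 t d_i) w_i^2], and [l] is the largest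
    [d_i] with [w_i] nonzero. If [l <= 0], no term grows, so a total that does not drop forces
    [d_i = 0] wherever [w_i] is nonzero. *)
Lemma max_component_spec X : X^T = X -> exists l, [/\ max_component X l, `|l| <= nrm X,
  forall t : R, 0 <= t -> nrm (mexp (t *: X) *m v) <= exp (t * l) * nrm v,
  exists2 c : R, 0 < c & forall t : R, c * exp (t * l) <= nrm (mexp (t *: X) *m v) &
  l <= 0 -> nrm v <= nrm (mexp X *m v) -> X *m v = 0].
Proof.
move=> /spectral[Q [d [HQ XE]]]; set w := Q^T *m v.
have vE : v = Q *m w by rewrite mulmxA orthC // mul1mx.
have [i0 wi0] : exists i, w i 0 != 0.
  apply: NNPP => H; move/eqP: v0; apply; rewrite vE (_ : w = 0) ?mulmx0 //.
  by apply/colP => i; rewrite [RHS]mxE; apply/eqP/negPn/negP => wi; apply: H; exists i.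
case: (@Order.TotalTheory.arg_maxP _ _ _ i0 (fun i => w i 0 != 0) (fun i => d 0 i) wi0) => i wi imax.
have nv : nrm v ^+ 2 = \sum_i w i 0 ^+ 2 by rewrite vE nrm_orthl // sqr_nrm_col.
have dmax j : w j 0 != 0 -> d 0 j <= d 0 i by move=> /imax.
exists (d 0 i); rewrite XE; split.
- split; first by apply/component_spectral => //; exists i.
  by move=> mu /component_spectral[//|j [<- wj]]; apply: dmax.
- rewrite nrm_spectral //; apply: le_trans (entry_le_nrm _ i i).
  by rewrite mxE eqxx mulr1n.
- move=> t t0; rewrite -(ler_pXn2r (isT : (0 < 2)%nat)) ?nnegrE ?mulr_ge0 ?nrm_ge0 ?(ltW (expR_gt0 _)) //.
  rewrite sqr_nrm_mexp // exprMn nv big_distrr /=; apply: ler_sum => j _.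
  have [wj|wj] := eqVneq (w j 0) 0; first by rewrite -/w wj expr0n /= !mulr0.
  rewrite ler_wpM2r ?sqr_ge0 // ler_pXn2r ?nnegrE ?(ltW (expR_gt0 _)) //.
  by apply: expR_le; rewrite ler_wpM2l // dmax.
- exists (`|w i 0|); first by rewrite normr_gt0.
  move=> t; rewrite -(ler_pXn2r (isT : (0 < 2)%nat)) ?nnegrE ?mulr_ge0 ?nrm_ge0 ?(ltW (expR_gt0 _)) //.
  rewrite sqr_nrm_mexp // exprMn real_normK ?num_real // mulrC (bigD1 i) //= lerDl.
  by apply: sumr_ge0 => j _; rewrite mulr_ge0 ?sqr_ge0.
move=> l0 vX; have : nrm v ^+ 2 <= nrm (mexp (1 *: (Q *m diag_mx d *m Q^T)) *m v) ^+ 2.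
  by rewrite scale1r ler_pXn2r ?nnegrE ?nrm_ge0.
rewrite sqr_nrm_mexp // nv -subr_ge0 -sumrB => S0.
have term j : exp (1 * d 0 j) ^+ 2 * w j 0 ^+ 2 - w j 0 ^+ 2 <= 0.
  have [->|wj] := eqVneq (w j 0) 0; first by rewrite expr0n /= mulr0 subrr.
  rewrite subr_le0 ler_piMl ?sqr_ge0 // exprn_ile1 ?(ltW (expR_gt0 _)) //.
  by rewrite -[leRHS]exp_0; apply: expR_le; rewrite mul1r (le_trans (dmax _ wj)).
have zero j : exp (1 * d 0 j) ^+ 2 * w j 0 ^+ 2 - w j 0 ^+ 2 = 0.
  apply/eqP; rewrite -oppr_eq0; apply/eqP.
  have : \sum_k - (exp (1 * d 0 k) ^+ 2 * w k 0 ^+ 2 - w k 0 ^+ 2) = 0.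
    apply/le_anti/andP; split; first by rewrite sumrN oppr_le0.
    by apply: sumr_ge0 => k _; rewrite oppr_ge0.
  move/psumr_eq0P; apply=> // k _; by rewrite oppr_ge0.
rewrite vE -!mulmxA (mulmxA Q^T) HQ mul1mx (_ : diag_mx d *m w = 0) ?mulmx0 //.
apply/colP => j; rewrite mul_diag_mx mxE [RHS]mxE.
have [->|wj] := eqVneq (w j 0) 0; first by rewrite mulr0.
have /eqP : (exp (1 * d 0 j) ^+ 2 - 1) * w j 0 ^+ 2 = 0 by rewrite mulrBl [1 * (w j 0 ^+ 2)]mul1r zero.
rewrite mulf_eq0 sqrf_eq0 (negbTE wj) orbF subr_eq0 sqrf_eq1 => /orP[/eqP E|/eqP E].
  have -> : d 0 j = 0; last by rewrite mul0r.
  by apply: exp_inv; rewrite -(mul1r (d 0 j)) E exp_0.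
by have := expR_gt0 (1 * d 0 j); rewrite E ltr0N1.
Qed.

Definition lgrow X (t : R) : R := ln (nrm (mexp (t *: X) *m v)) - ln (nrm v).

Let nv0 : 0 < nrm v. Proof. exact: nrm_gt0. Qed.

Lemma exp_lgrow X t : nrm (mexp (t *: X) *m v) = exp (lgrow X t) * nrm v.
Proof.
rewrite /lgrow exp_add expRN !exp_ln; [|exact/RltP|exact/RltP/nrm_mexp_gt0].
by rewrite mulfVK // gt_eqF.
Qed.

Lemma ler_lgrow X t (a : R) : nrm (mexp (t *: X) *m v) <= exp a * nrm v <-> lgrow X t <= a.
Proof.
rewrite exp_lgrow ler_pM2r //; split; last exact: expR_le.
by move=> /RleP H; apply/RleP; case: (Rle_lt_dec (lgrow X t) a) => // /exp_increasing /Rlt_not_le.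
Qed.

(** Bernoulli's inequality for the power [p] of [exp u]. *)
Lemma expR_convex (p u : R) : 1 <= p -> 1 + p * (exp u - 1) <= exp (p * u).
Proof.
move=> p1; have E0 := expR_gt0 u.
have H1 := expR_ge1Dx ((p - 1) * u); have H2 := expR_ge1Dx (- u).
have -> : exp (p * u) = exp u * exp ((p - 1) * u) by rewrite -exp_add; congr exp; ring.
have H3 : exp u * (1 + (p - 1) * u) <= exp u * exp ((p - 1) * u) by rewrite ler_wpM2l // ltW.
have H4 : exp u * (1 - u) <= 1.
  by have := ler_wpM2l (ltW E0) H2; rewrite expRN mulfV // gt_eqF.
have H5 : (p - 1) * (exp u * (1 - u)) <= p - 1.
  by rewrite -[leRHS]mulr1 ler_wpM2l // subr_ge0.
lra.
Qed.

(** Power means: with weights [w_i^2], the numbers [e^(2 (T d_i - a))] have mean 1, so by Bernoulli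
    their powers of exponent [p = t / T] have mean at least 1. *)
Lemma lgrow_slope X (T t : R) : X^T = X -> 0 < T -> T <= t -> t * lgrow X T <= T * lgrow X t.
Proof.
move=> XT T0 Tt; have [Q [d [HQ XE]]] := spectral XT.
have t0 : 0 < t by apply: lt_le_trans Tt.
set p := t / T; have p1 : 1 <= p by rewrite ler_pdivlMr // mul1r.
set a := lgrow X T; set w := Q^T *m v.
have nv : nrm v ^+ 2 = \sum_i w i 0 ^+ 2.
  by rewrite -sqr_nrm_col nrm_orthl //; apply: orth_tr.
suff H : exp (p * a) * nrm v <= nrm (mexp (t *: X) *m v).
  move: H; rewrite exp_lgrow ler_pM2r // => H.
  have {}H : p * a <= lgrow X t.
    apply/RleP; case: (Rle_lt_dec (p * a) (lgrow X t)) => // /exp_increasing/RltP.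
    by rewrite ltNge H.
  have := ler_wpM2l (ltW T0) H; rewrite mulrA [T * p]mulrC divfK ?gt_eqF //.
rewrite -(ler_pXn2r (isT : (0 < 2)%nat)) ?nnegrE ?mulr_ge0 ?nrm_ge0 ?(ltW (expR_gt0 _)) //.
have ST : \sum_i exp (T * d 0 i) ^+ 2 * w i 0 ^+ 2 = exp a ^+ 2 * \sum_i w i 0 ^+ 2.
  by rewrite -nv -exprMn -exp_lgrow XE sqr_nrm_mexp.
have sq (x : R) : exp x ^+ 2 = exp (2 * x).
  by rewrite expr2 -exp_add; congr exp; ring.
rewrite exprMn nv {1}XE sqr_nrm_mexp // -/w.
apply: le_trans (_ : exp (p * a) ^+ 2 * \sum_i
  (1 + p * (exp (2 * (T * d 0 i - a)) - 1)) * w i 0 ^+ 2 <= _).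
  rewrite le_eqVlt; apply/orP; left; apply/eqP; congr (_ * _).
  have E : \sum_i exp (2 * (T * d 0 i - a)) * w i 0 ^+ 2 = \sum_i w i 0 ^+ 2.
    have a2 : exp a ^+ 2 != 0 by rewrite sqrf_eq0 gt_eqF ?expR_gt0.
    apply: (mulfI a2); rewrite -ST big_distrr; apply: eq_bigr => i _ /=.
    by rewrite mulrA !sq -exp_add; congr (exp _ * _); ring.
  transitivity (\sum_i ((1 - p) * w i 0 ^+ 2 + p * (exp (2 * (T * d 0 i - a)) * w i 0 ^+ 2))).
    by rewrite big_split /= -!big_distrr /= E; ring.
  by apply: eq_bigr => i _; ring.
rewrite big_distrr; apply: ler_sum => i _ /=; rewrite mulrA ler_wpM2r ?sqr_ge0 //.
have := expR_convex (2 * (T * d 0 i - a)) p1.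
move=> /(ler_wpM2l (ltW (expR_gt0 (2 * (p * a))))); rewrite !sq -exp_add.
move=> /le_trans; apply; rewrite le_eqVlt; apply/orP; left; apply/eqP; congr exp.
by rewrite /p; field; rewrite gt_eqF.
Qed.

Lemma cv_lgrow (X : nat -> 'M[R]_n) L t : mcv X L -> Un_cv (fun k => lgrow (X k) t) (lgrow L t).
Proof.
move=> XL; apply: cvB (cv_cst _); apply: continuity_seq.
  apply: derivable_continuous_pt; eexists.
  exact: derivable_pt_lim_ln (elimT RltP (nrm_mexp_gt0 _)).
by apply: cv_nrm; apply: mcvM (mcv_cst v); apply: mcv_mexp; apply: mcvZ (cv_cst t) XL.
Qed.

(* Slopes [lgrow X t / t] increase with [t] to the top eigenvalue, so that the latter is lower
   semicontinuous in [X], uniformly enough to pass to the limit along [t -> oo]. *)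
Lemma max_component_lsc (S : 'M[R]_n -> Prop) (X : nat -> 'M[R]_n) (a : R) :
  (forall Y, S Y -> Y^T = Y /\ nrm Y = 1) ->
  (forall (Y : nat -> 'M[R]_n) L, (forall k, S (Y k)) -> mcv Y L -> S L) ->
  (forall k, S (X k)) -> (forall k, lgrow (X k) k.+1%:R <= k.+1%:R * a + 1) ->
  exists Y l, [/\ S Y, max_component Y l & l <= a].
Proof.
move=> SS Scl HX Ha.
have [k|phi [Y [Hphi XY]]] := mcv_bw (A := X) (M := 1); first by have [_ ->] := SS _ (HX k).
have SY : S Y by apply: Scl XY.
have [YT _] := SS _ SY; have [l [Hl _ _ [c c0 Hc] _]] := max_component_spec YT.
exists Y, l; split=> //.
(* For indices with [q k + 1 >= T], monotonicity of slopes carries the bound back to [T], where the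
   slope is at most [a + 1 / (k + 1)]; at fixed [T] the growth is continuous in the matrix. *)
have slope (T : R) : 0 < T -> lgrow Y T <= T * a.
  move=> T0; pose N := Num.bound T.
  have NT k : T <= (N + k).+1%:R.
    apply: le_trans (ltW (archi_boundP (ltW T0))) _.
    by rewrite ler_nat -addnS leq_addr.
  have Hp k : (N + k <= phi (N + k))%nat by apply: Hphi.
  pose q k := phi (N + k)%nat.
  have Hq k : (k <= q k)%nat by apply: leq_trans (Hp k); apply: leq_addl.
  have Xq : mcv (fun k => X (q k)) Y by apply: (mcv_sub XY) => k; apply: leq_addl.
  have lim : Un_cv (fun k => T * a + T * k.+1%:R^-1) (T * a).
    by rewrite -[X in Un_cv _ X]addr0 -[X in _ + X](mulr0 T); apply: cvD (cv_cst _) (cvM (cv_cst _) cv_inv_succ).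
  apply: cv_le (cv_lgrow T Xq) lim => k.
  have q0 : 0 < (q k).+1%:R :> R by rewrite ltr0Sn.
  have qT : T <= (q k).+1%:R by apply: le_trans (NT k) _; rewrite ler_nat ltnS; apply: Hp.
  have [XT _] := SS _ (HX (q k)).
  have := lgrow_slope XT T0 qT; have := ler_wpM2l (ltW T0) (Ha (q k)) => H1 H2.
  have {H1 H2} H := le_trans H2 H1; rewrite -(ler_pM2l q0); apply: le_trans H _.
  rewrite !mulrDr mulr1 mulrCA lerD2l mulrCA ler_pMr // ler_pdivlMr ?ltr0Sn // mul1r.
  by rewrite ler_nat ltnS.
rewrite leNgt; apply/negP => al.
(* The bounds [c e^(T l)] and [e^(T a) |v|] at time [T] give [e^(T (l - a)) <= b]; with
   [T = b / (l - a)] this reads [e^b <= b], which is absurd. *)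
set b : R := nrm v / c; have b0 : 0 < b by rewrite divr_gt0.
pose T : R := b / (l - a).
have T0 : 0 < T by rewrite divr_gt0 // subr_gt0.
have := Hc T; rewrite exp_lgrow => H.
have H1 : c * exp (T * l) <= exp (T * a) * nrm v.
  by apply: le_trans H _; rewrite ler_wpM2r ?nrm_ge0 // expR_le // slope.
have H2 : exp (T * (l - a)) <= b.
  rewrite /b ler_pdivlMr // mulrBr exp_add expRN mulrAC ler_pdivrMr ?expR_gt0 //.
  by rewrite mulrC [X in _ <= X]mulrC.
have TE : T * (l - a) = b by rewrite divfK // gt_eqF // subr_gt0.
rewrite TE in H2; have := le_trans (expR_ge1Dx b) H2; lra.
Qed.

End Growth.

(** * Distance to the stabilizer *)

Lemma onem01 (t : R) : 0 <= t <= 1 -> 0 <= t * -1 + 1 <= 1.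
Proof. by case/andP=> *; apply/andP; split; lra. Qed.

Section Distance.
Variables (n : nat) (G : 'M[R]_n -> Prop) (v : 'cV[R]_n).
Hypothesis HG : closed_group G.
Hypothesis GT : forall g, G g -> G g^T.
Hypothesis Gconn : forall U : 'M[R]_n -> Prop,
  (forall x, G x -> U x ->
    exists2 e : R, 0 < e & forall y, G y -> nrm (y - x) < e -> U y) ->
  (forall x, G x -> ~ U x ->
    exists2 e : R, 0 < e & forall y, G y -> nrm (y - x) < e -> ~ U y) ->
  U 1%:M -> forall g, G g -> U g.

Local Notation lie := (lie G).

Definition fixes (h : 'M[R]_n) : Prop := G h /\ h *m v = v.

Definition decomp (g : 'M[R]_n) (T : 'M[R]_n * 'M[R]_n * 'M[R]_n) : Prop :=
  let: (k, X, h) := T in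
  [/\ orth k, G k, lie X /\ X^T = X, fixes h & g = k *m mexp X *m h].

Lemma fixesV h : fixes h -> fixes (invmx h).
Proof.
move=> [Gh hv]; split; first exact: cg_inv.
by rewrite -[in LHS]hv mulKmx // (cg_unit HG).
Qed.

Lemma fixesM h h' : fixes h -> fixes h' -> fixes (h *m h').
Proof.
by move=> [Gh hv] [Gh' hv']; split; [apply: (cg_mul HG)|rewrite -mulmxA hv' hv].
Qed.

Lemma fixes1 : fixes 1%:M.
Proof. by split; [apply: cg_1|rewrite mul1mx]. Qed.

Lemma decomp_of_fixes g h : G g -> fixes h -> exists k X, decomp g (k, X, h).
Proof.
move=> Gg Hh; have Ggh : G (g *m invmx h) by apply: (cg_mul HG) => //; case: (fixesV Hh).
have [k [X [kO Gk HX XT E]]] := polar_group HG GT Gconn Ggh.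
exists k, X; split=> //; rewrite -E mulmxKV //; apply: (cg_unit HG); by case: Hh.
Qed.

(** The stabilizer need not be compact, but [h = exp (- X) k^T g] is determined by the two bounded
    factors and converges with them. *)
Lemma decomp_min g : G g -> exists2 T, decomp g T &
  forall T', decomp g T' -> nrm T.1.2 <= nrm T'.1.2.
Proof.
move=> Gg; apply: (@inf_attained _ (decomp g) (fun T => nrm T.1.2)).
- by have [k [X H]] := decomp_of_fixes Gg fixes1; exists (k, X, 1%:M).
- by move=> *; apply: nrm_ge0.
move=> T M HT TM.
pose k j := (T j).1.1; pose X j := (T j).1.2; pose h j := (T j).2.
have {}HT j : [/\ orth (k j), G (k j), lie (X j) /\ (X j)^T = X j, fixes (h j) &
    g = k j *m mexp (X j) *m h j].
  by rewrite /k /X /h; have := HT j; case: (T j) => -[].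
have [j|p1 [k' [Hp1 kk']]] := mcv_bw (A := k) (M := nrm (1%:M : 'M[R]_n)).
  by have [/nrm_orth ->] := HT j.
have [j|p2 [X' [Hp2 XX']]] := mcv_bw (A := X \o p1) (M := M); first exact: TM.
pose p := p1 \o p2.
have Hp j : (j <= p j)%nat by apply: leq_trans (Hp2 j) (Hp1 _).
have Hk : mcv (fun j => k (p j)) k' by apply: mcv_sub kk' Hp2.
have HX : mcv (fun j => X (p j)) X' by [].
have kO' : orth k' by apply: mcv_orth Hk => j; case: (HT (p j)).
have kU : k' \in unitmx by have [] := mulmx1_unit kO'.
have hE j : h j = mexp (- X j) *m ((k j)^T *m g).
  have [kO _ _ _ {1}->] := HT j.
  by rewrite !mulmxA -[_ *m (k j)^T *m k j]mulmxA kO mulmx1 mexpKN mul1mx.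
set h' := mexp (- X') *m (k'^T *m g).
have Hh : mcv (fun j => h (p j)) h'.
  apply: eq_mcv (mcvM (mcv_mexp (mcvN HX)) (mcvM (mcv_tr Hk) (mcv_cst g))) => j.
  by rewrite hE.
exists p, (k', X', h'); split=> //; last exact: cv_nrm HX.
split=> //.
- by apply: (cg_lim HG) Hk kU => j; case: (HT (p j)).
- split; first by apply: (lie_lim HG _ HX) => j; case: (HT (p j)) => _ _ [].
  by apply: mcv_uniq (mcv_tr HX) _; apply: eq_mcv HX => j; case: (HT (p j)) => _ _ [].
- split.
    apply: (cg_lim HG) Hh _; first by move=> j; case: (HT (p j)) => _ _ _ [].
    by rewrite !unitmx_mul mexp_unit unitmx_tr kU (cg_unit HG).
  apply: mcv_uniq (mcvM Hh (mcv_cst v)) _.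
  by apply: eq_mcv (mcv_cst v) => j; case: (HT (p j)) => _ _ _ [].
by rewrite /h' !mulmxA -[_ *m mexp (- X')]mulmxA mexpNK mulmx1 (orthC kO') mul1mx.
Qed.

(* First variation of the length of [exp (t X)] along [exp (s Y)]. *)
Lemma decomp_min_perp g k X h Y : G g -> decomp g (k, X, h) ->
  (forall T', decomp g T' -> nrm X <= nrm T'.1.2) ->
  lie Y -> Y *m v = 0 -> dotm X Y = 0.
Proof.
move=> Gg [kO Gk [HX XT] Hh gE] Xmin HY Yv.
set a := dotm X Y; apply/eqP/negPn/negP => a0.
set b : R := (nrm (1%:M : 'M[R]_n) * exp (nrm X)) ^+ 2.
have b0 : 0 <= b by rewrite exprn_ge0 // mulr_ge0 ?nrm_ge0 // ltW ?expR_gt0.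
set q : R := (b * nrm Y) ^+ 2; have q0 : 0 <= q by rewrite sqr_ge0.
(* The squared speed below is [|X|^2 + 2 s a + s^2 z] with [z <= q]; for [s = - e a] and [e q <= 1]
   it is at most [|X|^2 - e a^2]. *)
set e : R := (q + 1)^-1; have e0 : 0 < e by rewrite invr_gt0 ltr_wpDl.
have eq1 : e * q <= 1 by rewrite -ler_pdivlMl // invrK mulr1 lerDl.
set s : R := - (e * a).
have Gs : G (mexp X *m mexp (s *: Y)).
  by apply: (cg_mul HG); apply: lie_exp => //; apply: lieZ.
have [k' [X' [kO' Gk' HX' XT' E]]] := polar_group HG GT Gconn Gs.
have Hs : fixes (mexp (- (s *: Y)) *m h).
  apply: fixesM Hh; split; first by apply: lie_exp; apply: lieN; apply: lieZ.
  by apply: mexp_fix; rewrite mulNmx -scalemxAl Yv scaler0 oppr0.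
(* [exp (s Y)] is inserted after [exp X] and cancelled inside the stabilizer, to which it belongs
   since [Y v = 0]. *)
have D : decomp g (k *m k', X', mexp (- (s *: Y)) *m h).
  split=> //; [exact: orthM|exact: (cg_mul HG)|].
  rewrite -!mulmxA (mulmxA k') -E gE -!mulmxA; congr (_ *m (_ *m _)).
  by rewrite mulmxA mexpNK mul1mx.
have := Xmin _ D; rewrite /=; apply/negP; rewrite -ltNge.
have aX : 0 <= nrm X ^+ 2 - e * a ^+ 2 /\ forall t : R, 0 <= t <= 1 ->
    nrm (X + mexp ((t * -1 + 1) *: X) *m (mexp (t *: 0) *m (s *: Y - 0) *m mexp (t *: - 0)) *m
      mexp ((t * -1 + 1) *: - X)) <= Num.sqrt (nrm X ^+ 2 - e * a ^+ 2).
  have H (t : R) : 0 <= t <= 1 ->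
    nrm (X + mexp ((t * -1 + 1) *: X) *m (mexp (t *: 0) *m (s *: Y - 0) *m mexp (t *: - 0)) *m
      mexp ((t * -1 + 1) *: - X)) ^+ 2 <= nrm X ^+ 2 - e * a ^+ 2.
    move=> t01; have t01' := onem01 t01.
    rewrite oppr0 addr0 scaler0 mexp0 mul1mx mulmx1 -scalemxAr -scalemxAl.
    set P := mexp _; set P' := mexp _.
    have PT : P^T = P by rewrite mexp_sym // linearZ /= XT.
    have PT' : P'^T = P' by rewrite mexp_sym // linearZ linearN /= XT.
    have PP : P *m P' = 1%:M by rewrite /P /P' scalerN mexpNK.
    have PX : P *m X = X *m P by rewrite /P mexpZ_comm.
    have dP : dotm X (P *m Y *m P') = a.
      by rewrite dotmC dotm_mulr PT' dotm_mull PT mulmxA PX -mulmxA PP mulmx1 dotmC.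
    have nP : nrm (P *m Y *m P') <= b * nrm Y.
      have p1 : nrm P <= nrm (1%:M : 'M[R]_n) * exp (nrm X) by apply: nrm_mexpZ.
      have p2 : nrm P' <= nrm (1%:M : 'M[R]_n) * exp (nrm X) by apply: nrm_mexpZ; rewrite ?nrmN.
      apply: le_trans (nrm_mulmx _ _) _; rewrite /b expr2 mulrAC.
      apply: ler_pM; rewrite ?nrm_ge0 //; apply: le_trans (nrm_mulmx _ _) _.
      by apply: ler_wpM2r; rewrite ?nrm_ge0.
    have nP2 : nrm (P *m Y *m P') ^+ 2 <= q.
      by rewrite ler_pXn2r ?nnegrE ?nrm_ge0 // mulr_ge0 ?nrm_ge0.
    rewrite sqr_nrm !dotmE_lin (dotmC _ X) dP -!sqr_nrm /s.
    move: (nrm (P *m Y *m P') ^+ 2) nP2 => z zq.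
    have -> : nrm X ^+ 2 + - (e * a) * a + (- (e * a) * a + - (e * a) * (- (e * a) * z)) =
      nrm X ^+ 2 - 2 * (e * a ^+ 2) + e * (e * z) * a ^+ 2 by ring.
    have ez : e * z <= 1 by apply: le_trans eq1; rewrite ler_wpM2l // ltW.
    have := ler_wpM2l (mulr_ge0 (ltW e0) (sqr_ge0 a)) ez; rewrite mulr1 => H1.
    have E1 : e * (e * z) * a ^+ 2 = e * a ^+ 2 * (e * z) by ring.
    by rewrite E1; lra.
  have pos : 0 <= nrm X ^+ 2 - e * a ^+ 2.
    by apply: le_trans (H 0 _); rewrite ?sqr_ge0 // lexx ler01.
  split=> // t t01; rewrite -(ler_pXn2r (isT : (0 < 2)%nat)) ?nnegrE ?sqrtr_ge0 ?nrm_ge0 //.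
  by rewrite [X in _ <= X]sqr_sqrtr //; apply: H.
case: aX => pos H.
apply: le_lt_trans (_ : Num.sqrt (nrm X ^+ 2 - e * a ^+ 2) < _).
  by apply: (mexp_calibration XT' kO' _ H); rewrite oppr0 mexp0 mulmx1.
rewrite -(ltr_pXn2r (isT : (0 < 2)%nat)) ?nnegrE ?sqrtr_ge0 ?nrm_ge0 // [X in X < _]sqr_sqrtr //.
by rewrite ltrBlDr ltrDl mulr_gt0 // exprn_even_gt0.
Qed.

(** Right translation by the inverse of the endpoint [h'] leaves [eta] unchanged and makes the curve
    end at 1. The calibration then applies to the factorization of [g] whose last factor is this
    same [h'], and minimality compares the two symmetric parts. *)
Lemma decomp_min_length g (T : 'M[R]_n * 'M[R]_n * 'M[R]_n) h' (gam gam' eta : R -> 'M[R]_n)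
    (pr : Riemann_integrable (fun t => nrm (eta t)) 0%R 1%R) :
  G g -> (forall T', decomp g T' -> nrm T.1.2 <= nrm T'.1.2) -> fixes h' ->
  (forall t, mder gam t (gam' t)) -> (forall t : R, 0 <= t <= 1 -> G (gam t)) ->
  (forall t : R, 0 <= t <= 1 -> eta t *m gam t = gam' t) ->
  gam 0 = g -> gam 1 = h' -> nrm T.1.2 <= RiemannInt pr.
Proof.
move=> Gg Tmin Hh' dg Ggam Heta g0 g1.
have hU : h' \in unitmx by case: Hh' => /(cg_unit HG).
have [k [X D]] := decomp_of_fixes Gg Hh'; apply: le_trans (Tmin _ D) _ => /=.
case: D => kO _ [_ XT] _ gE.
have int_ge0 : 0 <= RiemannInt pr.
  have := @IntegralBound.le_RiemannInt (fun=> 0) (fun=> 0) (fun t => nrm (eta t)) _ _ pr.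
  rewrite /= Rminus_diag => H; apply/RleP; apply: H => t _; first exact: dpt_cst.
  exact/RleP/nrm_ge0.
have [->|X0] := eqVneq X 0; first by rewrite nrm0.
have [|||||F [F' [FX HF]]] := @calibration n (fun t => gam t *m invmx h')
   (fun t => gam' t *m invmx h') eta k X _ _ _ kO XT.
- by move=> t; apply: mderMr.
- by move=> t /Ggam/(cg_unit HG) gU; rewrite unitmx_mul gU unitmx_inv.
- by move=> t t01; rewrite mulmxA Heta.
- by rewrite g0 gE mulmxK.
- by rewrite g1 mulmxV.
rewrite -(ler_pM2l (nrm_gt0 X0)) -expr2 -FX.
have nX := nrm_gt0 X0.
have := @IntegralBound.le_RiemannInt (fun t => F t / nrm X) (fun t => F' t / nrm X) (fun t => nrm (eta t)) _ _ pr.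
move=> H; have {}H : F 1 / nrm X - F 0 / nrm X <= RiemannInt pr.
  apply/RleP; apply: H => t [/RleP t0 /RleP t1]; have [dF leF] := HF t (introT andP (conj t0 t1)).
    apply: eq_dpt (dptM dF (dpt_cst (nrm X)^-1 t)) => //; by rewrite mulr0 addr0.
  by apply/RleP; rewrite ler_pdivrMr // mulrC.
by move: H; rewrite -mulrBl ler_pdivrMr // mulrC.
Qed.

Lemma decomp_path : exists C, forall g k X h, decomp g (k, X, h) ->
  exists (gam eta : R -> 'M[R]_n) (pr : Riemann_integrable (fun t => nrm (eta t)) 0%R 1%R),
  [/\ gam 0 = g, gam 1 = h, forall t, mder gam t (eta t *m gam t) /\ G (gam t),
      mcont (fun t => eta t *m gam t) & RiemannInt pr <= nrm X + C].
Proof.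
have [C HC] := path_to_orth HG Gconn; exists C => g k X h [kO Gk [HX XT] [Gh hv] gE].
have [gam [eta [[g0 g1 dg ceta Ggam] Hb]]] := concat_path HG (HC k Gk kO) HX Gh.
have cnt := continuity_nrm ceta.
have pr : Riemann_integrable (fun t => nrm (eta t)) 0%R 1%R.
  by apply: continuity_implies_RiemannInt => [|t _]; [exact: Rle_0_1|exact: cnt].
exists gam, eta, pr; split=> //; first by rewrite g0 gE.
  by apply: mcontM => //; apply: mder_mcont dg.
(* An antiderivative of the speed bound; it rises by exactly [|X| + C] over [0, 1]. *)
pose B (t : R) := - C * ppart (t * -2 + 1) ^+ 2 + nrm X * ppart (t * 2 + -1) ^+ 2.
pose B' (t : R) := 4 * ppart (t * -2 + 1) * C + 4 * ppart (t * 2 + -1) * nrm X.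
have dB t : derivable_pt_lim B t (B' t).
  have d1 := dpt_comp (dpt_affine (-2) 1 t) (dpt_sqr_ppart _).
  have d2 := dpt_comp (dpt_affine 2 (-1) t) (dpt_sqr_ppart _).
  apply: eq_dpt (dptD (dptM (dpt_cst (- C) t) d1) (dptM (dpt_cst (nrm X) t) d2)) => //.
  by rewrite /B'; ring.
have cont_aff (a b : R) : continuity (fun t => ppart (t * a + b)).
  apply: (continuity_comp (fun t => t * a + b) ppart); last exact: continuity_ppart.
  by move=> t; apply: derivable_continuous_pt; exists a; apply: dpt_affine.
have cB : continuity B'.
  apply: (continuity_plus (fun t => 4 * ppart (t * -2 + 1) * C) (fun t => 4 * ppart (t * 2 + -1) * nrm X)).
    apply: (continuity_mult (fun t => 4 * ppart (t * -2 + 1)) (fun=> C)); last exact: continuity_const.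
    by apply: (continuity_mult (fun=> 4)) => //; apply: continuity_const.
  apply: (continuity_mult (fun t => 4 * ppart (t * 2 + -1)) (fun=> nrm X)); last exact: continuity_const.
  by apply: (continuity_mult (fun=> 4)) => //; apply: continuity_const.
have := @IntegralBound.RiemannInt_le (fun t => nrm (eta t)) pr B B' dB cB.
move=> H; have {}H : RiemannInt pr <= B 1 - B 0.
  by apply/RleP; apply: H => t [/Rlt_le/RleP t0 /Rlt_le/RleP t1]; apply/RleP/Hb; rewrite t0 t1.
apply: le_trans H _; rewrite /B !mul1r !mul0r !add0r.
rewrite (@ppart_pos 1) // (@ppart_neg (-1)) ?lerN10 //.
rewrite (@ppart_neg (-2 + 1)); last lra.
rewrite (@ppart_pos (2 + -1)); last lra.
rewrite le_eqVlt; apply/orP; left; apply/eqP; ring.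
Qed.

Lemma decomp_growth g k X h : decomp g (k, X, h) -> nrm (g *m v) = nrm (mexp X *m v).
Proof. by case=> kO _ _ [_ hv] ->; rewrite -mulmxA hv -mulmxA nrm_orthl. Qed.

End Distance.

(** * Matrices as functions *)

Section Encoding.
Variable n : nat.
Implicit Types (A B : mat n) (M : 'M[R]_n) (u w : vec n) (x y : 'cV[R]_n).

Definition tomx A : 'M[R]_n := \matrix_(i, j) A i j.
Definition ofmx M : mat n := fun i j => M i j.
Definition tocV u : 'cV[R]_n := \col_i u i.
Definition ofcV x : vec n := fun i => x i 0.

Lemma ofmxK M : tomx (ofmx M) = M.
Proof. by apply/matrixP => i j; rewrite mxE. Qed.

Lemma tomxK A : ofmx (tomx A) = A.
Proof. by do 2!apply: functional_extensionality => ?; rewrite /ofmx mxE. Qed.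

Lemma ofcVK x : tocV (ofcV x) = x.
Proof. by apply/colP => i; rewrite mxE. Qed.

Lemma tocVK u : ofcV (tocV u) = u.
Proof. by apply: functional_extensionality => ?; rewrite /ofcV mxE. Qed.

Lemma tomx_inj A B : tomx A = tomx B -> A = B.
Proof. by move=> E; rewrite -(tomxK A) E tomxK. Qed.

Lemma tocV_inj u w : tocV u = tocV w -> u = w.
Proof. by move=> E; rewrite -(tocVK u) E tocVK. Qed.

Lemma rsumE (f : 'I_n -> R) : rsum f = \sum_i f i.
Proof. by []. Qed.

Lemma tomx_mul A B : tomx (mmul A B) = tomx A *m tomx B.
Proof.
by apply/matrixP => i j; rewrite !mxE [LHS]rsumE; apply: eq_bigr => k _; rewrite !mxE.
Qed.

Lemma tocV_mul A u : tocV (mvmul A u) = tomx A *m tocV u.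
Proof.
by apply/colP => i; rewrite !mxE [LHS]rsumE; apply: eq_bigr => k _; rewrite !mxE.
Qed.

Lemma tomx_id : tomx mid = 1%:M.
Proof. by apply/matrixP => i j; rewrite !mxE /mid; case: eqP. Qed.

Lemma tomx_tr A : tomx (mtr A) = (tomx A)^T.
Proof. by apply/matrixP => i j; rewrite !mxE. Qed.

Lemma tomx_opp A : tomx (mopp A) = - tomx A.
Proof. by apply/matrixP => i j; rewrite !mxE. Qed.

Lemma tomx_add A B : tomx (madd A B) = tomx A + tomx B.
Proof. by apply/matrixP => i j; rewrite !mxE. Qed.

Lemma tomx_sub A B : tomx (msub A B) = tomx A - tomx B.
Proof. by apply/matrixP => i j; rewrite !mxE. Qed.

Lemma tomx_scale a A : tomx (mscale a A) = a *: tomx A.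
Proof. by apply/matrixP => i j; rewrite !mxE. Qed.

Lemma tocV_scale a u : tocV (vscale a u) = a *: tocV u.
Proof. by apply/colP => i; rewrite !mxE. Qed.

Lemma tocV_sub u w : tocV (vsub u w) = tocV u - tocV w.
Proof. by apply/colP => i; rewrite !mxE. Qed.

Lemma tocV_zero : tocV vzero = 0.
Proof. by apply/colP => i; rewrite !mxE. Qed.

Lemma minnerE A B : minner A B = dotm (tomx A) (tomx B).
Proof.
rewrite /minner /mtrace rsumE dotmE; apply: eq_bigr => i _.
by rewrite /mmul rsumE; apply: eq_bigr => j _; rewrite !mxE.
Qed.

Lemma mnormE A : mnorm A = nrm (tomx A).
Proof. by rewrite /mnorm RsqrtE minnerE nrmE. Qed.

Lemma vdotE u w : vdot u w = dotm (tocV u) (tocV w).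
Proof.
rewrite /vdot rsumE dotmE; apply: eq_bigr => i _; by rewrite big_ord1 !mxE.
Qed.

Lemma vnormE u : vnorm u = nrm (tocV u).
Proof. by rewrite /vnorm RsqrtE vdotE nrmE. Qed.

Lemma tomx_pow A k : tomx (mpow A k) = mxpow (tomx A) k.
Proof. by elim: k => [|k IH] /=; rewrite ?tomx_id // tomx_mul IH. Qed.

Lemma is_mexpE A B : is_mexp A B <-> tomx B = mexp (tomx A).
Proof.
have E i j N : sum_f_R0 (fun k => (mpow A k i j / INR (Factorial.fact k))%R) N = esum (tomx A) N i j.
  rewrite sum_f_R0_ord /esum summxE; apply: eq_bigr => k _.
  by rewrite mxE -tomx_pow mxE RdivE mulrC.
split=> [H|BE i j].
  apply: mcv_uniq _ (mexp_cv (tomx A)) => i j; rewrite mxE.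
  by apply: eq_cv (H i j) => N; rewrite E.
have := mexp_cv (tomx A) i j; rewrite -BE mxE.
by apply: eq_cv => N; rewrite E.
Qed.

Lemma invertibleE A : invertible A <-> tomx A \in unitmx.
Proof.
split=> [[B [AB BA]]|AU].
  by have := congr1 tomx AB; rewrite tomx_mul tomx_id => /mulmx1_unit [].
exists (ofmx (invmx (tomx A))); split; apply: tomx_inj.
  by rewrite tomx_mul tomx_id ofmxK mulmxV.
by rewrite tomx_mul tomx_id ofmxK mulVmx.
Qed.

End Encoding.

(** [Rinf] is an arbitrary number unless a greatest lower bound exists, so every use has to exhibit
    an element and a bound. *)
Lemma Rinf_glb (S : R -> Prop) (b : R) : (exists x, S x) -> (forall x, S x -> b <= x) ->
  is_glb S (Rinf S).
Proof.
move=> [x0 Sx0] Hb; apply: epsilon_spec.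
have [||m [ub lub]] := completeness (fun r => exists2 x, S x & r = - x).
- by exists (- b) => r [x /Hb Sx ->]; apply/RleP; rewrite lerN2.
- by exists (- x0), x0.
exists (- m); split=> [x Sx|c Hc]; apply/RleP.
  by rewrite lerNl; apply/RleP/ub; exists x.
rewrite lerNr; apply/RleP/lub => r [x Sx ->]; apply/RleP.
by rewrite lerN2; apply/RleP/Hc.
Qed.

Lemma Rsup_lub (S : R -> Prop) (b : R) : (exists x, S x) -> (forall x, S x -> x <= b) ->
  is_lub S (Rsup S).
Proof.
move=> Sx0 Hb; apply: epsilon_spec.
have [||m Hm] := completeness S => //; last by exists m.
by exists b => x /Hb Sx; apply/RleP.
Qed.

(** * The stated group in matrix form, and the distance to the stabilizer *)

Section Transfer.
Variables (n : nat) (G : mat n -> Prop) (v : vec n).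
Hypotheses (Ggrp : subgroup_GL G) (Gclosed : closed_in_GL G) (Gconn : mat_connected G).
Hypotheses (Gself : self_adjoint G) (v_neq0 : v <> vzero).

Definition mxset (M : 'M[R]_n) : Prop := G (ofmx M).

Local Notation w := (tocV v).

Lemma mxset_tomx A : mxset (tomx A) <-> G A.
Proof. by rewrite /mxset tomxK. Qed.

Lemma tocV_neq0 : w != 0.
Proof.
by apply/eqP => w0; apply: v_neq0; apply: tocV_inj; rewrite w0 tocV_zero.
Qed.

Lemma mxset_group : closed_group mxset.
Proof.
have [GU [G1 [GM GV]]] := Ggrp.
have U g : mxset g -> g \in unitmx by move=> /GU/invertibleE; rewrite ofmxK.
split=> //.
- by rewrite -tomx_id mxset_tomx.
- move=> g h Gg Gh; rewrite -(ofmxK g) -(ofmxK h) -tomx_mul mxset_tomx; exact: GM.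
- move=> g Gg; have [h [Gh [gh hg]]] := GV _ Gg.
  have : g *m tomx h = 1%:M by have := congr1 (@tomx n) gh; rewrite tomx_mul ofmxK tomx_id.
  move=> E; have -> : invmx g = tomx h by rewrite -[LHS]mulmx1 -E mulKmx // U.
  by rewrite mxset_tomx.
move=> u L Gu uL LU; apply: NNPP => nL.
have [|e [/RltP e0 He]] := Gclosed (g := ofmx L) _ nL; first by apply/invertibleE; rewrite ofmxK.
have [N HN] := (Un_cvP _ _).1 ((mcvP _ _).1 uL) _ e0.
apply: (He (ofmx (u N)) _ _ (Gu N)); first exact: GU (Gu N).
rewrite mnormE tomx_sub !ofmxK; apply/RltP.
by have := HN N (leqnn N); rewrite subr0 ger0_norm ?nrm_ge0.
Qed.

Lemma mxset_tr g : mxset g -> mxset g^T.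
Proof.
by move=> /Gself; rewrite -{2}(ofmxK g) -tomx_tr mxset_tomx.
Qed.

Lemma mxset_conn (U : 'M[R]_n -> Prop) :
  (forall x, mxset x -> U x ->
    exists2 e : R, 0 < e & forall y, mxset y -> nrm (y - x) < e -> U y) ->
  (forall x, mxset x -> ~ U x ->
    exists2 e : R, 0 < e & forall y, mxset y -> nrm (y - x) < e -> ~ U y) ->
  U 1%:M -> forall g, mxset g -> U g.
Proof.
move=> Uo Uc U1 g Gg; apply: NNPP => nUg.
have ro (V : 'M[R]_n -> Prop) : (forall x, mxset x -> V x ->
    exists2 e : R, 0 < e & forall y, mxset y -> nrm (y - x) < e -> V y) ->
    rel_open G (fun A => G A /\ V (tomx A)).
  move=> H; split=> [x []//|x [/mxset_tomx Gx Vx]].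
  have [e e0 He] := H _ Gx Vx; exists e; split; first exact/RltP.
  move=> y Gy; rewrite mnormE tomx_sub => /RltP yx; split=> //.
  by apply: He => //; apply/mxset_tomx.
have [x Gx|x [[_ ?] [_ ?]] //|H|H] := Gconn (ro _ Uo) (ro _ Uc).
- by case: (classic (U (tomx x))) => ?; [left|right].
- apply: (H mid); split; first by case: Ggrp => _ [].
  by rewrite tomx_id.
by apply: (H (ofmx g)); split=> //; rewrite ofmxK.
Qed.

Local Notation HG := mxset_group.
Local Notation lie := (lie mxset).

Lemma lie_algE A : lie_alg G A <-> lie (tomx A).
Proof.
split=> H t.
  have [B [/is_mexpE BE GB]] := H t.
  by rewrite -tomx_scale -BE mxset_tomx.
exists (ofmx (mexp (t *: tomx A))); split; last exact: H.
by apply/is_mexpE; rewrite ofmxK tomx_scale.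
Qed.

Definition slice (X : 'M[R]_n) : Prop := lie X /\
  forall K Y, lie K -> K^T = - K -> lie Y -> Y *m w = 0 -> dotm X (K + Y) = 0.

Lemma PtildeE A : Ptilde G v A <-> slice (tomx A).
Proof.
split=> -[/lie_algE HA H]; split=> //; last first.
  move=> K Y [/lie_algE HK KT] [/lie_algE HY Yv]; rewrite minnerE tomx_add; apply: H => //.
    by rewrite -tomx_tr KT tomx_opp.
  by rewrite -tocV_mul Yv tocV_zero.
move=> K Y HK KT HY Yv; have := H (ofmx K) (ofmx Y); rewrite minnerE tomx_add !ofmxK; apply.
  split; first by apply/lie_algE; rewrite ofmxK.
  by apply: tomx_inj; rewrite tomx_tr tomx_opp ofmxK.
split; first by apply/lie_algE; rewrite ofmxK.
by apply: tocV_inj; rewrite tocV_mul ofmxK tocV_zero.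
Qed.

(** As [G] is self adjoint, [K = X - X^T] is a skew element of the Lie algebra, so [X] is orthogonal
    to it; so is [X^T], and hence [K] is orthogonal to itself. *)
Lemma slice_sym X : slice X -> X^T = X.
Proof.
move=> [HX H]; apply/esym/subr0_eq/nrm_eq0/eqP; rewrite -sqrf_eq0 sqr_nrm; apply/eqP.
set K := X - X^T; have KT : K^T = - K by rewrite /K linearB /= trmxK opprB.
have HK : lie K by apply: (lieB HG) => //; apply: (lie_tr mxset_tr).
have XK : dotm X K = 0.
  by have := H K 0 HK KT (lie0 HG); rewrite mul0mx addr0; apply.
have XTK : dotm X^T K = 0 by rewrite -dotm_tr trmxK KT dotmNr XK oppr0.
by rewrite {1}/K dotmDl dotmNl XK XTK subrr.
Qed.

Lemma dotm_sym_skew (X K : 'M[R]_n) : X^T = X -> K^T = - K -> dotm X K = 0.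
Proof.
move=> XT KT; have : dotm X K = - dotm X K by rewrite -{1}dotm_tr XT KT dotmNr.
lra.
Qed.

Lemma slice_lim (X : nat -> 'M[R]_n) L : (forall k, slice (X k)) -> mcv X L -> slice L.
Proof.
move=> HX XL; split; first by apply: (lie_lim HG _ XL) => k; case: (HX k).
move=> K Y HK KT HY Yv; apply: cv_uniq (cv_dotm XL (mcv_cst (K + Y))) _.
by apply: eq_cv (cv_cst 0) => k; have [_ ->] := HX k.
Qed.

Lemma sliceZ a X : slice X -> slice (a *: X).
Proof.
move=> [HX H]; split; first exact: lieZ.
by move=> K Y HK KT HY Yv; rewrite dotmZl H ?mulr0.
Qed.

Lemma has_componentE A l : has_component A v l <-> component w (tomx A) l.
Proof.
split=> [[c [Ac [Hc c0]]]|[c [Ac Hc c0]]].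
  exists (tocV c); split.
  - by rewrite -tocV_mul Ac tocV_scale.
  - move=> y Ay; rewrite -tocV_sub -(ofcVK y) -vdotE; apply: Hc.
    by apply: tocV_inj; rewrite tocV_mul tocV_scale ofcVK.
  by apply/eqP => E; apply: c0; apply: tocV_inj; rewrite E tocV_zero.
exists (ofcV c); split; [|split].
- by apply: tocV_inj; rewrite tocV_mul tocV_scale ofcVK.
- move=> y Ay; rewrite vdotE tocV_sub ofcVK; apply: Hc.
  by rewrite -tocV_mul Ay tocV_scale.
by move=> E; move/eqP: c0; apply; rewrite -(ofcVK c) E tocV_zero.
Qed.

Lemma is_lambdaXE A l : is_lambdaX A v l <-> max_component w (tomx A) l.
Proof.
by split=> -[/has_componentE C M]; split=> // mu /has_componentE /M /RleP.
Qed.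

Lemma stabE A : stab G v A <-> fixes mxset w (tomx A).
Proof.
split=> -[/mxset_tomx GA Av]; split=> //; first by rewrite -tocV_mul Av.
by apply: tocV_inj; rewrite tocV_mul.
Qed.

Definition dstab (g : 'M[R]_n) : R := dR_set G (ofmx g) (stab G v).

(* The witness is a factorization with [|X|] minimal. *)
Lemma dstab_bounds : exists C, forall g, mxset g -> exists k X h,
  [/\ decomp mxset w g (k, X, h), slice X, nrm X <= dstab g & dstab g <= nrm X + C].
Proof.
have [C HC] := decomp_path w HG mxset_conn; exists C => g Gg.
have [[[k X] h] D Xmin] := decomp_min w HG mxset_tr mxset_conn Gg.
exists k, X, h.
have [kO Gk [HX XT] Hh gE] := D.
pose lens (s : mat n) l := exists gam, gam 0%R = ofmx g /\ gam 1%R = s /\ curve_len G gam l.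
have path_len (k' X' h' : 'M[R]_n) : decomp mxset w g (k', X', h') ->
    exists2 l, lens (ofmx h') l & l <= nrm X' + C.
  move=> /HC[gam [eta [pr [g0 g1 dg cg le]]]]; exists (RiemannInt pr) => //.
  exists (fun t => ofmx (gam t)); rewrite g0 g1; split=> //; split=> //.
  exists (fun t => ofmx (eta t *m gam t)), (fun t => ofmx (eta t)); split.
    by move=> t i j; case: (dg t) => + _; apply.
  split; first by move=> i j; apply: cg.
  split; first by move=> t _; case: (dg t).
  split; first by move=> t _; apply: tomx_inj; rewrite tomx_mul !ofmxK.
  have E : (fun t => mnorm (ofmx (eta t))) = (fun t => nrm (eta t)).
    by apply: functional_extensionality => t; rewrite mnormE ofmxK.
  by rewrite E; exists pr.
have len_low s l : stab G v s -> lens s l -> nrm X <= l.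
  move=> /stabE Hs [gam [g0 [g1 [gam' [eta [dg [_ [Ggam [Heta [pr <-]]]]]]]]]].
  have E : (fun t => mnorm (eta t)) = (fun t => nrm (tomx (eta t))).
    by apply: functional_extensionality => t; rewrite mnormE.
  move: pr; rewrite E => pr.
  have in01 (t : R) : 0 <= t <= 1 -> Rle 0 t /\ Rle t 1.
    by case/andP=> /RleP ? /RleP.
  apply: (decomp_min_length (T := (k, X, h)) HG mxset_tr mxset_conn
    (gam := fun t => tomx (gam t)) (gam' := fun t => tomx (gam' t)) pr Gg Xmin Hs).
  - move=> t i j; apply: eq_dpt (dg t i j) => [s'|]; by rewrite mxE.
  - by move=> t /in01 /Ggam /mxset_tomx.
  - by move=> t /in01 /Heta H; rewrite -tomx_mul H.
  - by rewrite g0 ofmxK.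
  - by rewrite g1.
have len_ex s : stab G v s -> exists l, lens s l.
  move=> /stabE Hs; have [k' [X' D']] := decomp_of_fixes HG mxset_tr mxset_conn Gg Hs.
  by have [l] := path_len _ _ _ D'; rewrite tomxK; exists l.
have dR_glb s : stab G v s -> is_glb (lens s) (dR G (ofmx g) s).
  by move=> Hs; apply: (@Rinf_glb _ (nrm X)); [exact: len_ex|move=> l; exact: len_low].
have dR_low s : stab G v s -> nrm X <= dR G (ofmx g) s.
  move=> Hs; have [_ H] := dR_glb s Hs; apply/RleP/H => l Hl; apply/RleP; exact: len_low Hl.
have Hh' : stab G v (ofmx h) by apply/stabE; rewrite ofmxK.
have [lb glb] : is_glb (fun d => exists s, stab G v s /\ d = dR G (ofmx g) s) (dstab g).
  apply: (@Rinf_glb _ (nrm X)); first by exists (dR G (ofmx g) (ofmx h)), (ofmx h).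
  by move=> d [s [Hs ->]]; apply: dR_low.
split=> //.
- split=> // K Y HK KT HY Yv; rewrite dotmDr dotm_sym_skew // add0r.
  exact: (decomp_min_perp HG mxset_tr mxset_conn Gg D Xmin).
- by apply/RleP/glb => d [s [Hs ->]]; apply/RleP/dR_low.
have [l Hl lC] := path_len _ _ _ D.
apply: le_trans _ lC; apply: le_trans (_ : dR G (ofmx g) (ofmx h) <= _).
  by apply/RleP/lb; exists (ofmx h).
by apply/RleP; have [H _] := dR_glb _ Hh'; apply: H.
Qed.

End Transfer.

(** * Growth along the orbit *)

Section OrbitGrowth.
Variables (n : nat) (G : mat n -> Prop) (v : vec n).
Hypotheses (Ggrp : subgroup_GL G) (Gclosed : closed_in_GL G) (Gconn : mat_connected G).
Hypotheses (Gself : self_adjoint G) (v_neq0 : v <> vzero).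

Local Notation w := (tocV v).
Local Notation HG := (mxset_group Ggrp Gclosed).
Local Notation dstab := (dstab G v).
Local Notation w0 := (tocV_neq0 v_neq0).

Definition unit_slice (X : 'M[R]_n) : Prop := slice G v X /\ nrm X = 1.

Lemma unit_slice_spec X : unit_slice X -> X^T = X /\ nrm X = 1.
Proof. by move=> [/(slice_sym Ggrp Gclosed Gself)]. Qed.

Lemma unit_slice_lim (X : nat -> 'M[R]_n) L : (forall k, unit_slice (X k)) -> mcv X L -> unit_slice L.
Proof.
move=> HX XL; split; first by apply: (slice_lim Ggrp Gclosed _ XL) => k; case: (HX k).
by apply: cv_uniq (cv_nrm XL) _; apply: eq_cv (cv_cst 1) => k; case: (HX k).
Qed.

Lemma nrm_mexp_le (X : 'M[R]_n) : X^T = X -> nrm (mexp X *m w) <= exp (nrm X) * nrm w.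
Proof.
move=> XT; have [l [_ lX + _ _]] := max_component_spec w0 XT.
move=> /(_ 1 ler01); rewrite scale1r mul1r => H; apply: le_trans H _.
rewrite ler_wpM2r ?nrm_ge0 //; apply: expR_le; apply: le_trans lX; exact: ler_norm.
Qed.

Definition exponents (l : R) : Prop := exists2 X, unit_slice X & max_component w X l.

Lemma exponentsE l :
  (exists X, Ptilde G v X /\ mnorm X = 1%R /\ is_lambdaX X v l) <-> exponents l.
Proof.
split=> [[X [/PtildeE HX [X1 /is_lambdaXE Xl]]]|[X [HX X1] Xl]].
  by exists (tomx X) => //; split=> //; rewrite -mnormE.
exists (ofmx X); split; first by apply/PtildeE; rewrite ofmxK.
by rewrite mnormE ofmxK; split=> //; apply/is_lambdaXE; rewrite ofmxK.
Qed.

Lemma exponents_norm l : exponents l -> `|l| <= 1.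
Proof.
move=> [X /unit_slice_spec[XT X1] Xl].
have [m [Xm mX _ _ _]] := max_component_spec w0 XT.
by rewrite (max_component_uniq Xl Xm) -X1.
Qed.

Lemma orbit_unboundedP (M : R) : orbit_unbounded G v ->
  exists2 g, mxset G g & M < nrm (g *m w).
Proof.
move=> /(_ M)[g [Gg /RltP]]; rewrite vnormE tocV_mul => H.
by exists (tomx g) => //; apply/mxset_tomx.
Qed.

Lemma dstab_unbounded (M : R) : orbit_unbounded G v -> exists2 g, mxset G g & M < dstab g.
Proof.
move=> /(orbit_unboundedP (exp M * nrm w))[g Gg gM]; exists g => //.
have [C /(_ g Gg)[k [X [h [D HX Xd _]]]]] := dstab_bounds v Ggrp Gclosed Gconn Gself.
apply: lt_le_trans Xd; rewrite ltNge; apply/negP => /expR_le XM.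
move: gM; rewrite (decomp_growth D) ltNge => /negP; apply.
apply: le_trans (nrm_mexp_le (slice_sym Ggrp Gclosed Gself HX)) _.
by rewrite ler_wpM2r ?nrm_ge0.
Qed.

(** Polar coordinates [t = |X|], [Y = X / |X|]. The disjunction covers [X = 0], where the quotient
    is 0 and has no direction. *)
Lemma growth_dstab : exists C, forall g, mxset G g -> exists t Y,
  [/\ 0 <= t, t <= dstab g, dstab g <= t + C, t = 0 \/ unit_slice Y &
      ln (nrm (g *m w)) = lgrow w Y t + ln (nrm w)].
Proof.
have [C HC] := dstab_bounds v Ggrp Gclosed Gconn Gself; exists C => g /HC.
move=> [k [X [h [D HX Xd dX]]]]; exists (nrm X), ((nrm X)^-1 *: X); split=> //.
- exact: nrm_ge0.
- have [->|X0] := eqVneq (nrm X) 0; [by left|right]; split; first exact: sliceZ.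
  by rewrite nrmZ ger0_norm ?invr_ge0 ?nrm_ge0 // mulVf.
rewrite /lgrow scalerA (decomp_growth D) addrNK.
have [X0|X0] := eqVneq (nrm X) 0; last by rewrite mulfV // scale1r.
by rewrite (nrm_eq0 X0) scaler0.
Qed.

(** An element at distance more than [C] has [t > 0], hence a unit direction. This makes the infimum
    and supremum of exponents meaningful. *)
Lemma exponents_neq0 : orbit_unbounded G v -> exists l, exponents l.
Proof.
have [C HC] := growth_dstab.
move=> /(dstab_unbounded C)[g /HC[t [Y [_ _ dC [t0|HY] _]]] Cd].
  by move: (lt_le_trans Cd dC); rewrite t0 add0r ltxx.
have [YT _] := unit_slice_spec HY.
by have [l [Yl _ _ _ _]] := max_component_spec w0 YT; exists l, Y.
Qed.

Hypothesis Gunb : orbit_unbounded G v.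

Lemma lambda_minus_glb : is_glb exponents (lambda_minus G v).
Proof.
have [lb glb] : is_glb (fun l => exists X, Ptilde G v X /\ mnorm X = 1%R /\ is_lambdaX X v l)
    (lambda_minus G v).
  apply: (@Rinf_glb _ (-1)) => [|l /exponentsE /exponents_norm].
    by have [l Hl] := exponents_neq0 Gunb; exists l; apply/exponentsE.
  by rewrite ler_norml => /andP[].
split=> [l /exponentsE /lb|b Hb] //; apply: glb => l /exponentsE; exact: Hb.
Qed.

Lemma lambda_plus_lub : is_lub exponents (lambda_plus G v).
Proof.
have [ub lub] : is_lub (fun l => exists X, Ptilde G v X /\ mnorm X = 1%R /\ is_lambdaX X v l)
    (lambda_plus G v).
  apply: (@Rsup_lub _ 1) => [|l /exponentsE /exponents_norm].
    by have [l Hl] := exponents_neq0 Gunb; exists l; apply/exponentsE.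
  by rewrite ler_norml => /andP[].
split=> [l /exponentsE /ub|b Hb] //; apply: lub => l /exponentsE; exact: Hb.
Qed.

Lemma lambda_minus_le l : exponents l -> lambda_minus G v <= l.
Proof. by move=> Hl; apply/RleP; apply: (lambda_minus_glb.1). Qed.

Lemma lambda_plus_ge l : exponents l -> l <= lambda_plus G v.
Proof. by move=> Hl; apply/RleP; apply: (lambda_plus_lub.1). Qed.

Lemma lambda_bounds :
  [/\ -1 <= lambda_minus G v, lambda_minus G v <= lambda_plus G v & lambda_plus G v <= 1].
Proof.
have B l : exponents l -> -1 <= l <= 1 by rewrite -ler_norml; apply: exponents_norm.
split.
- by apply/RleP/(lambda_minus_glb.2) => l /B/andP[/RleP].
- by have [l Hl] := exponents_neq0 Gunb; apply: le_trans (lambda_minus_le Hl) (lambda_plus_ge Hl).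
by apply/RleP/(lambda_plus_lub.2) => l /B/andP[_ /RleP].
Qed.

Lemma minimal_exponent_gt0 l : minimal_vec G v -> exponents l -> 0 < l.
Proof.
move=> vmin [X HX Xl]; have [XT X1] := unit_slice_spec HX.
have [m [Xm _ _ _ H]] := max_component_spec w0 XT.
rewrite (max_component_uniq Xl Xm) ltNge; apply/negP => /H H0.
have [[Xlie Xperp] _] := HX.
have Xw : X *m w = 0.
  apply: H0; have := vmin (ofmx (mexp X)); rewrite !vnormE tocV_mul ofmxK => E.
  by apply/RleP/E; have := Xlie 1; rewrite scale1r.
have := Xperp 0 X (lie0 HG); rewrite trmx0 oppr0 add0r => /(_ erefl Xlie Xw).
by rewrite -sqr_nrm X1 expr1n => /eqP; rewrite oner_eq0.
Qed.

Lemma exponent_of_slow_growth (X : nat -> 'M[R]_n) (a : R) : (forall k, unit_slice (X k)) ->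
  (forall k, lgrow w (X k) k.+1%:R <= k.+1%:R * a + 1) -> exists2 l, exponents l & l <= a.
Proof.
move=> HX Ha.
have [Y [l [HY Yl la]]] := max_component_lsc w0 unit_slice_spec unit_slice_lim HX Ha.
by exists l => //; exists Y.
Qed.

Lemma lgrow_le Y l t : unit_slice Y -> max_component w Y l -> 0 <= t -> lgrow w Y t <= t * l.
Proof.
move=> /unit_slice_spec[YT _] Yl t0; apply/(ler_lgrow w0).
have [m [Ym _ H _ _]] := max_component_spec w0 YT.
by rewrite (max_component_uniq Yl Ym); apply: H.
Qed.

(** Positivity of each exponent must survive the infimum. If that were not positive, directions with
    exponent at most [1 / (k + 1)] would grow by at most 1 up to time [k + 1], and semicontinuity
    would produce an exponent at most 0. *)
Lemma lambda_minus_gt0 : minimal_vec G v -> 0 < lambda_minus G v.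
Proof.
move=> vmin; rewrite ltNge; apply/negP => lm0.
have small k : exists X, unit_slice X /\ lgrow w X k.+1%:R <= k.+1%:R * 0 + 1.
  have k0 : (0 : R) < k.+1%:R by rewrite ltr0n.
  have [l [X HX Xl] lk] : exists2 l, exponents l & l <= k.+1%:R^-1.
    apply: NNPP => H; suff : k.+1%:R^-1 <= lambda_minus G v.
      by move=> /le_trans/(_ lm0); rewrite invr_le0 leNgt k0.
    apply/RleP/(lambda_minus_glb.2) => l Hl; apply/RleP.
    by rewrite leNgt; apply/negP => /ltW lk; apply: H; exists l.
  exists X; split=> //; apply: le_trans (lgrow_le HX Xl (ltW k0)) _.
  by rewrite mulr0 add0r mulrC -ler_pdivlMr // div1r.
have [X HX] := choice _ small.
have [l Hl] := exponent_of_slow_growth (fun k => (HX k).1) (fun k => (HX k).2).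
by rewrite leNgt (minimal_exponent_gt0 vmin Hl).
Qed.

(** A failure at some time [t >= k + 1] is, by monotonicity of slopes, a failure at time [k + 1];
    semicontinuity then yields an exponent at most [a]. *)
Lemma lgrow_ge_uniform (a : R) : a < lambda_minus G v ->
  exists2 T : R, 0 < T & forall Y t, unit_slice Y -> T <= t -> t * a <= lgrow w Y t.
Proof.
move=> al; apply: NNPP => H.
have slow k : exists X, unit_slice X /\ lgrow w X k.+1%:R <= k.+1%:R * a + 1.
  have k0 : (0 : R) < k.+1%:R by rewrite ltr0n.
  apply: NNPP => Hk; apply: H; exists k.+1%:R => // Y t HY kt.
  have t0 : 0 < t by apply: lt_le_trans kt.
  rewrite leNgt; apply/negP => Yt; apply: Hk; exists Y; split=> //.
  have [YT _] := unit_slice_spec HY.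
  suff : lgrow w Y k.+1%:R <= k.+1%:R * a by move=> /le_trans; apply; rewrite lerDl.
  rewrite -(ler_pM2l t0); apply: le_trans (lgrow_slope w0 YT k0 kt) _.
  by rewrite mulrCA ler_pM2l // ltW.
have [X HX] := choice _ slow.
have [l /lambda_minus_le lm la] := exponent_of_slow_growth (fun k => (HX k).1) (fun k => (HX k).2).
by have := lt_le_trans al (le_trans lm la); rewrite ltxx.
Qed.

(** Dividing by the distance [d] in place of the time [t] costs at most [|a| C] or [|b| C], which
    together with [|L|] is negligible against [d]. *)
Lemma ratio_bounds (a b L t d C e x : R) : 0 < d -> t <= d -> d <= t + C ->
  t * a <= x -> x <= t * b -> (`|a| + `|b|) * C + `|L| <= e * d ->
  a - e <= (x + L) / d <= b + e.
Proof.
move=> d0 td dC ax xb He; rewrite ler_pdivlMr // ler_pdivrMr //.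
have B c : `|c * (d - t)| <= `|c| * C.
  by rewrite normrM ler_wpM2l // ger0_norm ?subr_ge0 // lerBlDl.
have := B a; have := B b; rewrite !ler_norml => /andP[b1 b2] /andP[a1 a2].
have C0 : 0 <= C by lra.
have Lb : - `|L| <= L <= `|L| by rewrite -ler_norml.
have aC : 0 <= `|a| * C by rewrite mulr_ge0.
have bC : 0 <= `|b| * C by rewrite mulr_ge0.
lra.
Qed.

Lemma growth_rate (eps : R) : 0 < eps -> exists D, forall g, mxset G g -> D < dstab g ->
  lambda_minus G v - eps <= ln (nrm (g *m w)) / dstab g <= lambda_plus G v + eps.
Proof.
move=> e0; set e := eps / 2; have e1 : 0 < e by rewrite /e; lra.
set a := lambda_minus G v - e; set b := lambda_plus G v; set L := ln (nrm w).
have [|T T0 HT] := @lgrow_ge_uniform a; first by rewrite /a; lra.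
have [C HC] := growth_dstab.
set q := ((`|a| + `|b|) * C + `|L|) / e.
(* [0] keeps the denominator positive, [T + C] puts [t] beyond [T], and [q] makes the constant terms
   at most [e] times the distance. *)
exists (Num.max 0 (Num.max (T + C) q)) => g Gg; rewrite !gt_max => /and3P[d0 dT dq].
have [t [Y [t0 td dC HY ->]]] := HC g Gg.
have Tt : T <= t by lra.
have {}HY : unit_slice Y by case: HY => // tz; lra.
have [YT _] := unit_slice_spec HY.
have [l [Yl _ _ _ _]] := max_component_spec w0 YT.
have xb : lgrow w Y t <= t * b.
  apply: le_trans (lgrow_le HY Yl t0) _; rewrite ler_wpM2l //.
  by apply: lambda_plus_ge; exists Y.
have Ld : (`|a| + `|b|) * C + `|L| <= e * dstab g by rewrite [leRHS]mulrC -ler_pdivrMr // (ltW dq).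
have /andP[] := ratio_bounds d0 td dC (HT _ _ HY Tt) xb Ld.
rewrite /a /b /e => h1 h2; apply/andP; split; first by apply: le_trans h1; lra.
by apply: le_trans h2 _; lra.
Qed.

End OrbitGrowth.

Open Scope R_scope.

Theorem theorem2p1 (n : nat) (G : mat n -> Prop) (v : vec n) :
  subgroup_GL G -> closed_in_GL G -> mat_connected G -> self_adjoint G ->
  ~ mat_compact G -> v <> vzero -> orbit_unbounded G v ->
  (* 1) *)
  (forall M, exists g, G g /\ M < dR_set G g (stab G v)) /\
  (* 2) *)
  (minimal_vec G v -> 0 < lambda_minus G v) /\
  (-1 <= lambda_minus G v /\ lambda_minus G v <= lambda_plus G v /\
   lambda_plus G v <= 1) /\
  (* 3) every limit of log|g_k v| / d_R(g_k,G_v) along sequences with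
        d_R(g_k,G_v) -> oo lies in [lambda^-, lambda^+] *)
  (forall gs : nat -> mat n, (forall k, G (gs k)) ->
     cv_infty (fun k => dR_set G (gs k) (stab G v)) ->
     forall eps, 0 < eps -> exists N, forall k, (N <= k)%nat ->
       lambda_minus G v - eps <=
         ln (vnorm (mvmul (gs k) v)) / dR_set G (gs k) (stab G v) <=
       lambda_plus G v + eps).
Proof.
move=> Ggrp Gcl Gconn Gself _ v0 Gunb; split; [|split; [|split]].
- move=> M; have [g Gg gM] := dstab_unbounded Ggrp Gcl Gconn Gself v0 M Gunb.
  by exists (ofmx g); split=> //; apply/RltP.
- by move=> vmin; apply/RltP; apply: lambda_minus_gt0.
- have [l1 l2 l3] := lambda_bounds Ggrp Gcl Gconn Gself v0 Gunb.
  by split; [|split]; apply/RleP.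
move=> gs Ggs d_oo eps /RltP e0.
have [D HD] := growth_rate Ggrp Gcl Gconn Gself v0 Gunb e0.
have [N HN] := d_oo D; exists N => k /ssrnat.leP /HN /RltP Dk.
have /HD : mxset G (tomx (gs k)) by apply/mxset_tomx.
rewrite /dstab tomxK -tocV_mul -vnormE -RdivE => /(_ Dk)/andP[h1 h2].
by split; apply/RleP.
Qed.
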